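(* (Knörrer periodicity.) Let $k$ be a field and let $(R,w)$ satisfy condition (B) described in the context, with distinguished closed point $\mathfrak s$. Then the 2-periodic dg categories $\operatorname{MF}^\infty(R,w)$ and $\operatorname{MF}^\infty(R[x,y],w+xy)$ are weakly equivalent, i.e. isomorphic in $\operatorname{Ho}(\operatorname{dgcat}_{k[u,u^{-1}]})$. Moreover, the categories of finite rank factorizations become equivalent after passing to completions: $\operatorname{MF}(\widehat{R},w)$ and $\operatorname{MF}(\widehat{R[x,y]},w+xy)$ are weakly equivalent, where $\widehat R$ and $\widehat{R[x,y]}$ are the completions of $R$ at $\mathfrak s$ and of $R[x,y]$ at the maximal ideal $(\mathfrak s,x,y)$.
   Context: Condition (B) on $(R,w)$: $R$ is a $k$-algebra essentially of finite type over $k$, equidimensional of dimension $n$, $\Omega_{R/k}$ is locally free of rank $n$, and the zero locus of $dw\in\Omega_{R/k}$ is a $0$-dimensional scheme supported on a unique closed point $\mathfrak s$ of $\operatorname{Spec}(R)$ with residue field $k$ and $w\in\mathfrak s$. If $(R,w)$ satisfies (B) then so does $(R[x,y],w+xy)$. For a ring $Q$ and $v\in Q$, $\operatorname{MF}^\infty(Q,v)$ is the differential $\mathbb Z/2$-graded category of $\mathbb Z/2$-graded projective $Q$-modules $X=X^0\oplus X^1$ of possibly infinite rank with an odd $Q$-linear $d$, $d^2=v\,\mathrm{id}$; morphism complexes are $Q$-linear maps with $d(f)=d_{X'}f-(-1)^{|f|}fd_X$. $\operatorname{MF}(Q,v)$ is the full subcategory of objects with finitely generated components. $\operatorname{Ho}(\operatorname{dgcat}_{k[u,u^{-1}]})$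 is the localization at quasi-equivalences of the category of (small) categories enriched in dg $k[u,u^{-1}]$-modules, $|u|=2$, equivalently in $\mathbb Z/2$-graded complexes over $k$. *)

(* Defs.v *)
From HB Require Import structures.
From mathcomp Require Import all_boot all_algebra ring_quotient.
From mathcomp Require Import boolp classical_sets.

Set Implicit Arguments.
Unset Strict Implicit.
Unset Printing Implicit Defensive.

Import GRing.Theory.
Local Open Scope ring_scope.
Local Open Scope quotient_scope.

Section Ideals.
Variable Q : comPzRingType.

(* Improper ideals are allowed, unlike in [ring_quotient.idealr]. *)
Definition is_ideal (I : set Q) : Prop :=
  [/\ I 0, forall a b, I a -> I b -> I (a + b) & forall r a, I a -> I (r * a)].

Definition ideal_gen (S : set Q) : set Q :=
  fun a => forall I : set Q, is_ideal I -> (forall s, S s -> I s) -> I a.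

Fixpoint ideal_exp (I : set Q) (n : nat) : set Q :=
  if n is n'.+1 then
    ideal_gen (fun c => exists a b, [/\ I a, ideal_exp I n' b & c = a * b])
  else fun=> True.

Lemma ideal_genP S : is_ideal (ideal_gen S).
Proof.
split=> [I [] //|a b Sa Sb I II SI|r a Sa I II SI].
  by case: (II) => _ addI _; apply: addI; [exact: Sa|exact: Sb].
by case: (II) => _ _; apply; exact: Sa.
Qed.

Lemma ideal_expP I n : is_ideal (ideal_exp I n).
Proof. by case: n => [|n]; [split | exact: ideal_genP]. Qed.

Lemma ideal_opp I : is_ideal I -> forall a, I a -> I (- a).
Proof. by case=> _ _ mI a Ia; rewrite -mulN1r; apply: mI. Qed.

End Ideals.

(** The completion of [Q] at [I] is the inverse limit of the rings [Q/I^n].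
    A point of the limit is presented by a sequence [a] whose classes
    [a n + I^n] are compatible; two sequences present the same point when
    [a n - b n] lies in [I^n] for every [n]. *)
Section Completion.
Variables (Q : comPzRingType) (I : set Q).

Record compat := Compat {
  compat_seq :> nat -> Q;
  compatP : forall n, ideal_exp I n (compat_seq n.+1 - compat_seq n) }.

HB.instance Definition _ := gen_eqMixin compat.
HB.instance Definition _ := gen_choiceMixin compat.

Local Notation J := (ideal_exp I).

Lemma expD n a b : J n a -> J n b -> J n (a + b).
Proof. by have [_ + _] := ideal_expP I n; apply. Qed.
Lemma expM n r a : J n a -> J n (r * a).
Proof. by have [_ _] := ideal_expP I n; apply. Qed.
Lemma exp0 n : J n 0. Proof. by have [] := ideal_expP I n. Qed.
Lemma expN n a : J n a -> J n (- a).
Proof. exact: ideal_opp (ideal_expP I n) a. Qed.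

Lemma mulB (a a' b b' : Q) :
  a * b - a' * b' = b * (a - a') + a' * (b - b').
Proof. by rewrite !mulrBr [b * a]mulrC [b * a']mulrC addrA addrNK. Qed.

Lemma compat_addP (a b : compat) n :
  J n (a n.+1 + b n.+1 - (a n + b n)).
Proof. by rewrite opprD addrACA; apply: expD; apply: compatP. Qed.
Lemma compat_oppP (a : compat) n : J n (- a n.+1 - - a n).
Proof. by rewrite -opprD; apply/expN/compatP. Qed.
Lemma compat_mulP (a b : compat) n : J n (a n.+1 * b n.+1 - a n * b n).
Proof. by rewrite mulB; apply: expD; apply/expM/compatP. Qed.
Lemma compat_constP (c : Q) n : J n (c - c).
Proof. by rewrite subrr; apply: exp0. Qed.

Definition compat_add a b := Compat (compat_addP a b).
Definition compat_opp a := Compat (compat_oppP a).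
Definition compat_mul a b := Compat (compat_mulP a b).
Definition compat_const c := Compat (fun n => compat_constP c n).

Definition compat_eqv (a b : compat) : bool := `[< forall n, J n (a n - b n) >].

Lemma compat_eqv_equiv : equiv_class_of compat_eqv.
Proof.
split=> [a|a b|b a c].
- by apply/asboolP => n; rewrite subrr; apply: exp0.
- by apply: asbool_equiv_eq; split=> h n; rewrite -opprB; apply: expN.
- move=> /asboolP h1 /asboolP h2; apply/asboolP => n.
  by rewrite -[a n](subrK (b n)) -addrA; apply: expD.
Qed.

Canonical compat_equiv := EquivRelPack compat_eqv_equiv.

Definition completion := {eq_quot compat_eqv}.
HB.instance Definition _ : EqQuotient compat compat_eqv completion :=
  EqQuotient.on completion.
HB.instance Definition _ := Choice.on completion.

Local Notation pi := (\pi_completion).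

Lemma pi_eq (a b : compat) : (forall n, J n (a n - b n)) -> pi a = pi b.
Proof. by move=> h; apply/eqquotP/asboolP. Qed.

Lemma repr_pi (a : compat) n : J n (repr (pi a) n - a n).
Proof.
have /eqquotP/asboolP h : repr (pi a) = a %[mod completion] by rewrite reprK.
exact: h.
Qed.

Lemma pi_ext (a b : compat) : (forall n, a n = b n) -> pi a = pi b.
Proof. by move=> h; apply: pi_eq => n; rewrite h subrr; apply: exp0. Qed.

Lemma cpl_ind (P : completion -> Prop) : (forall a, P (pi a)) -> forall x, P x.
Proof. by move=> h x; rewrite -[x]reprK. Qed.

Definition cpl_add (x y : completion) := pi (compat_add (repr x) (repr y)).
Definition cpl_opp (x : completion) := pi (compat_opp (repr x)).
Definition cpl_mul (x y : completion) := pi (compat_mul (repr x) (repr y)).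
Definition cpl_const (c : Q) : completion := pi (compat_const c).

Lemma cpl_addE a b : cpl_add (pi a) (pi b) = pi (compat_add a b).
Proof.
by apply: pi_eq => n /=; rewrite opprD addrACA; apply: expD; apply: repr_pi.
Qed.
Lemma cpl_oppE a : cpl_opp (pi a) = pi (compat_opp a).
Proof. by apply: pi_eq => n /=; rewrite -opprD; apply/expN/repr_pi. Qed.
Lemma cpl_mulE a b : cpl_mul (pi a) (pi b) = pi (compat_mul a b).
Proof.
by apply: pi_eq => n /=; rewrite mulB; apply: expD; apply/expM/repr_pi.
Qed.

Let cE := (cpl_addE, cpl_oppE, cpl_mulE).

Lemma cpl_addA : associative cpl_add.
Proof.
apply: cpl_ind => a; apply: cpl_ind => b; apply: cpl_ind => c; rewrite !cE.
by apply: pi_ext => n /=; rewrite addrA.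
Qed.
Lemma cpl_addC : commutative cpl_add.
Proof.
apply: cpl_ind => a; apply: cpl_ind => b; rewrite !cE.
by apply: pi_ext => n /=; rewrite addrC.
Qed.
Lemma cpl_add0 : left_id (cpl_const 0) cpl_add.
Proof. by apply: cpl_ind => a; rewrite !cE; apply: pi_ext => n /=; rewrite add0r. Qed.
Lemma cpl_addN : left_inverse (cpl_const 0) cpl_opp cpl_add.
Proof. by apply: cpl_ind => a; rewrite !cE; apply: pi_ext => n /=; rewrite addNr. Qed.
Lemma cpl_mulA : associative cpl_mul.
Proof.
apply: cpl_ind => a; apply: cpl_ind => b; apply: cpl_ind => c; rewrite !cE.
by apply: pi_ext => n /=; rewrite mulrA.
Qed.
Lemma cpl_mulC : commutative cpl_mul.
Proof.
apply: cpl_ind => a; apply: cpl_ind => b; rewrite !cE.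
by apply: pi_ext => n /=; rewrite mulrC.
Qed.
Lemma cpl_mul1 : left_id (cpl_const 1) cpl_mul.
Proof. by apply: cpl_ind => a; rewrite !cE; apply: pi_ext => n /=; rewrite mul1r. Qed.
Lemma cpl_mulDl : left_distributive cpl_mul cpl_add.
Proof.
apply: cpl_ind => a; apply: cpl_ind => b; apply: cpl_ind => c; rewrite !cE.
by apply: pi_ext => n /=; rewrite mulrDl.
Qed.

HB.instance Definition _ := GRing.isZmodule.Build completion
  cpl_addA cpl_addC cpl_add0 cpl_addN.
HB.instance Definition _ := GRing.Zmodule_isComPzRing.Build completion
  cpl_mulA cpl_mulC cpl_mul1 cpl_mulDl.

Lemma cpl_const_zmod : zmod_morphism cpl_const.
Proof.
move=> a b; rewrite -[RHS]/(cpl_add (cpl_const a) (cpl_opp (cpl_const b))).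
by rewrite /cpl_const !cE; apply: pi_ext => n.
Qed.
Lemma cpl_const_monoid : monoid_morphism cpl_const.
Proof.
split=> // a b; rewrite -[RHS]/(cpl_mul (cpl_const a) (cpl_const b)).
by rewrite /cpl_const !cE; apply: pi_ext => n.
Qed.

HB.instance Definition _ :=
  GRing.isZmodMorphism.Build Q completion cpl_const cpl_const_zmod.
HB.instance Definition _ :=
  GRing.isMonoidMorphism.Build Q completion cpl_const cpl_const_monoid.

End Completion.

Definition to_completion (Q : comPzRingType) (I : set Q) :
  {rmorphism Q -> completion I} := @cpl_const Q I.

Definition is_localization (A B : comPzRingType) (S : set A)
    (phi : {rmorphism A -> B}) : Prop :=
  [/\ forall s, S s -> exists t, t * phi s = 1,
      forall b, exists a s, S s /\ b * phi s = phi a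
    & forall a, phi a = 0 -> exists s, S s /\ s * a = 0].

Definition is_localization_mod (A B : comPzRingType) (S : set A)
    (phi : {rmorphism A -> B}) (M : lmodType A) (N : lmodType B)
    (psi : {additive M -> N}) : Prop :=
  [/\ forall a m, psi (a *: m) = phi a *: psi m,
      forall x, exists m s, S s /\ phi s *: x = psi m
    & forall m, psi m = 0 -> exists s, S s /\ s *: m = 0].

Definition finite_type (k : fieldType) (A : comAlgType k) : Prop :=
  exists gs : seq A, forall P : {pred A},
    subalg_closed P -> {subset gs <= P} -> forall a, a \in P.

Definition ess_finite_type (k : fieldType) (R : comAlgType k) : Prop :=
  exists (A : comAlgType k) (S : {pred A}) (phi : {lrmorphism A -> R}),
    [/\ finite_type A, mulr_closed S & is_localization (fun a => a \in S) phi].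

Section Spectrum.
Variable R : comNzRingType.

(* Points of Spec R are the terms of [prime_idealr R], up to [=i]. *)
Definition closed_point (p : prime_idealr R) : Prop :=
  forall q : prime_idealr R, {subset p <= q} -> q =i p.

Definition in_locus (J : set R) (p : prime_idealr R) : Prop :=
  forall a, J a -> a \in p.

Definition prime_chain (J : set R) (m : nat) : Prop :=
  exists p : 'I_m.+1 -> prime_idealr R,
    (forall i, in_locus J (p i)) /\
    (forall i j : 'I_m.+1, (i < j)%N ->
       {subset p i <= p j} /\ exists2 a, a \in p j & a \notin p i).

(* the Krull dimension of R/J, i.e. of the closed subscheme defined by J *)
Definition locus_dim (J : set R) (n : nat) : Prop :=
  prime_chain J n /\ forall m, prime_chain J m -> (m <= n)%N.

Definition minimal_prime (p : prime_idealr R) : Prop :=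
  forall q : prime_idealr R, {subset q <= p} -> q =i p.

Definition equidimensional (n : nat) : Prop :=
  forall p : prime_idealr R, minimal_prime p -> locus_dim (fun a => a \in p) n.

End Spectrum.

Definition free_of_rank (n : nat) (B : comPzRingType) (N : lmodType B) : Prop :=
  exists e : 'I_n -> N,
    forall x, exists! c : {ffun 'I_n -> B}, x = \sum_i c i *: e i.

(* The basic opens D(f), f in fs, cover Spec R and trivialize M. *)
Definition locally_free (n : nat) (R : comPzRingType) (M : lmodType R) : Prop :=
  exists fs : seq R,
    ideal_gen (fun f => f \in fs) 1 /\
    forall f, f \in fs ->
      exists (B : comPzRingType) (phi : {rmorphism R -> B})
             (N : lmodType B) (psi : {additive M -> N}),
        [/\ is_localization (fun a => exists m, a = f ^+ m) phi,
            is_localization_mod (fun a => exists m, a = f ^+ m) phi psi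
          & free_of_rank n N].

Section Differentials.
Variables (k : fieldType) (R : comAlgType k).

Definition derivation (M : lmodType R) (D : R -> M) : Prop :=
  [/\ forall a b, D (a + b) = D a + D b,
      forall a b, D (a * b) = a *: D b + b *: D a
    & forall c : k, D c%:A = 0].

(* [d : R -> Om] is the universal k-linear derivation, i.e. Om = Omega_{R/k} *)
Definition kahler_differentials (Om : lmodType R) (d : R -> Om) : Prop :=
  derivation d /\
  forall (M : lmodType R) (D : R -> M), derivation D ->
    exists2 f : {linear Om -> M}, D =1 f \o d &
      forall g : {linear Om -> M}, D =1 g \o d -> g =1 f.

(* The ideal of the zero scheme of a section [o] of the locally free sheaf
   [Om] is the image of evaluation at [o] on the dual of [Om]. *)
Definition zero_ideal (Om : lmodType R) (o : Om) : set R :=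
  fun a => exists phi : {linear Om -> R^o}, a = phi o.

Definition conditionB (n : nat) (w : R) (s : prime_idealr R) : Prop :=
  [/\ ess_finite_type R,
      equidimensional R n
    & exists (Om : lmodType R) (d : R -> Om),
        [/\ kahler_differentials d,
            locally_free n Om,
            locus_dim (zero_ideal (d w)) 0
          & forall p, in_locus (zero_ideal (d w)) p <-> p =i s]]
  /\ [/\ closed_point s,
         bijective (fun c : k => \pi_({ideal_quot s}) (c%:A : R))
       & w \in s].

End Differentials.

(** A Z/2-graded complex over k, equivalently a dg module over k[u,u^-1] with
    |u| = 2. The total module is the data; the grading is recorded by the projections
    [cx_part false] and [cx_part true] onto the even and the odd summand. *)
Record complex (k : fieldType) := Complex {
  cx_mod :> lmodType k;
  cx_part : bool -> {linear cx_mod -> cx_mod};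
  cx_d : {linear cx_mod -> cx_mod};
  cx_part_idem : forall i j f,
    cx_part i (cx_part j f) = if i == j then cx_part j f else 0;
  cx_part_sum : forall f, cx_part false f + cx_part true f = f;
  cx_d_odd : forall i f, cx_d (cx_part i f) = cx_part (~~ i) (cx_d f);
  cx_dd : forall f, cx_d (cx_d f) = 0 }.

Definition homog (k : fieldType) (C : complex k) (i : bool) (f : C) : Prop :=
  cx_part C i f = f.

(** Objects range over a universe above that of MathComp modules, so that
    categories whose objects are arbitrary modules are small. *)
Record dgcat (k : fieldType) := DGCat {
  dg_obj :> Type;
  dg_hom : dg_obj -> dg_obj -> complex k;
  dg_id : forall x, dg_hom x x;
  dg_comp : forall x y z, dg_hom y z -> dg_hom x y -> dg_hom x z;
  dg_comp_linl : forall x y z (f : dg_hom x y),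
    linear (fun g : dg_hom y z => dg_comp g f);
  dg_comp_linr : forall x y z (g : dg_hom y z),
    linear (fun f : dg_hom x y => dg_comp g f);
  dg_compA : forall x y z t (h : dg_hom z t) (g : dg_hom y z) (f : dg_hom x y),
    dg_comp h (dg_comp g f) = dg_comp (dg_comp h g) f;
  dg_comp1l : forall x y (f : dg_hom x y), dg_comp (dg_id y) f = f;
  dg_comp1r : forall x y (f : dg_hom x y), dg_comp f (dg_id x) = f;
  dg_id_even : forall x, homog false (dg_id x);
  dg_d_id : forall x, cx_d _ (dg_id x) = 0;
  dg_comp_homog : forall x y z i j (g : dg_hom y z) (f : dg_hom x y),
    homog i g -> homog j f -> homog (i (+) j) (dg_comp g f);
  dg_leibniz : forall x y z (i : bool) (g : dg_hom y z) (f : dg_hom x y),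
    homog i g ->
    cx_d _ (dg_comp g f) = dg_comp (cx_d _ g) f
                           + (-1) ^+ i *: dg_comp g (cx_d _ f) }.

Record dgfun (k : fieldType) (A B : dgcat k) := DGFun {
  dgf_obj :> A -> B;
  dgf_hom : forall x y, {linear dg_hom x y -> dg_hom (dgf_obj x) (dgf_obj y)};
  dgf_part : forall x y i (f : dg_hom x y),
    dgf_hom x y (cx_part _ i f) = cx_part _ i (dgf_hom x y f);
  dgf_d : forall x y (f : dg_hom x y),
    dgf_hom x y (cx_d _ f) = cx_d _ (dgf_hom x y f);
  dgf_id : forall x, dgf_hom x x (dg_id x) = dg_id (dgf_obj x);
  dgf_comp : forall x y z (g : dg_hom y z) (f : dg_hom x y),
    dgf_hom x z (dg_comp g f) = dg_comp (dgf_hom y z g) (dgf_hom x y f) }.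

Section DGFunctors.
Variable k : fieldType.

Definition dgf_one (A : dgcat k) : dgfun A A :=
  @DGFun k A A id (fun x y => idfun) (fun x y i f => erefl)
    (fun x y f => erefl) (fun x => erefl) (fun x y z g f => erefl).

Definition dgf_o (A B C : dgcat k) (G : dgfun B C) (F : dgfun A B) :
    dgfun A C :=
  @DGFun k A C (G \o F) (fun x y => dgf_hom G (F x) (F y) \o dgf_hom F x y)
    (fun x y i f => etrans (congr1 _ (dgf_part F i f)) (dgf_part G i _))
    (fun x y f => etrans (congr1 _ (dgf_d F f)) (dgf_d G _))
    (fun x => etrans (congr1 _ (dgf_id F x)) (dgf_id G _))
    (fun x y z g f => etrans (congr1 _ (dgf_comp F g f)) (dgf_comp G _ _)).

(* bijectivity of the map induced by a chain map on cohomology *)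
Definition quasi_iso (C D : complex k) (F : {linear C -> D}) : Prop :=
  (forall f, cx_d C f = 0 -> (exists g, F f = cx_d D g) ->
     exists g, f = cx_d C g) /\
  (forall g, cx_d D g = 0 ->
     exists f h, cx_d C f = 0 /\ F f - g = cx_d D h).

Definition H0_iso (A : dgcat k) (x y : A) : Prop :=
  exists (f : dg_hom x y) (g : dg_hom y x),
    [/\ homog false f /\ cx_d _ f = 0,
        homog false g /\ cx_d _ g = 0,
        exists2 h, homog true h & dg_comp g f - dg_id x = cx_d _ h
      & exists2 h, homog true h & dg_comp f g - dg_id y = cx_d _ h].

Definition quasi_equiv (A B : dgcat k) (F : dgfun A B) : Prop :=
  (forall x y, quasi_iso (dgf_hom F x y)) /\
  (forall b : B, exists a : A, H0_iso (F a) b).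

(** The localization Ho of the category of dg categories at the
    quasi-equivalences: its morphisms are formal composites of dg functors and
    of formal inverses of quasi-equivalences, modulo [ho_eq]. *)
Inductive ho_word : dgcat k -> dgcat k -> Type :=
| HoFun A B of dgfun A B : ho_word A B
| HoInv A B (F : dgfun A B) of quasi_equiv F : ho_word B A
| HoComp A B C of ho_word B C & ho_word A B : ho_word A C.

Inductive ho_eq : forall A B, ho_word A B -> ho_word A B -> Prop :=
| HoRefl A B (u : ho_word A B) : ho_eq u u
| HoSym A B (u v : ho_word A B) of ho_eq u v : ho_eq v u
| HoTrans A B (u v t : ho_word A B) of ho_eq u v & ho_eq v t : ho_eq u t
| HoCong A B C (u u' : ho_word B C) (v v' : ho_word A B) of
    ho_eq u u' & ho_eq v v' : ho_eq (HoComp u v) (HoComp u' v')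
| HoAssoc A B C D (u : ho_word C D) (v : ho_word B C) (t : ho_word A B) :
    ho_eq (HoComp u (HoComp v t)) (HoComp (HoComp u v) t)
| HoId_l A B (u : ho_word A B) : ho_eq (HoComp (HoFun (dgf_one B)) u) u
| HoId_r A B (u : ho_word A B) : ho_eq (HoComp u (HoFun (dgf_one A))) u
| HoFunctor A B C (G : dgfun B C) (F : dgfun A B) :
    ho_eq (HoFun (dgf_o G F)) (HoComp (HoFun G) (HoFun F))
| HoInv_l A B (F : dgfun A B) (qF : quasi_equiv F) :
    ho_eq (HoComp (HoInv qF) (HoFun F)) (HoFun (dgf_one A))
| HoInv_r A B (F : dgfun A B) (qF : quasi_equiv F) :
    ho_eq (HoComp (HoFun F) (HoInv qF)) (HoFun (dgf_one B)).

Definition weakly_equivalent (A B : dgcat k) : Prop :=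
  exists (u : ho_word A B) (v : ho_word B A),
    ho_eq (HoComp v u) (HoFun (dgf_one A)) /\
    ho_eq (HoComp u v) (HoFun (dgf_one B)).

Definition dg_full (A : dgcat k) (P : A -> Prop) : dgcat k :=
  @DGCat k {x : A | P x} (fun x y => dg_hom (sval x) (sval y))
    (fun x => dg_id (sval x)) (fun x y z g f => dg_comp g f)
    (fun x y z f => dg_comp_linl f) (fun x y z g => dg_comp_linr g)
    (fun x y z t h g f => dg_compA h g f)
    (fun x y f => dg_comp1l f) (fun x y f => dg_comp1r f)
    (fun x => dg_id_even (sval x)) (fun x => dg_d_id (sval x))
    (fun x y z i j g f => @dg_comp_homog k A _ _ _ i j g f)
    (fun x y z i g f => @dg_leibniz k A _ _ _ i g f).

End DGFunctors.

Definition projective (Q : comPzRingType) (X : lmodType Q) : Prop :=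
  forall (M N : lmodType Q) (p : {linear M -> N}) (f : {linear X -> N}),
    (forall y, exists x, p x = y) ->
    exists g : {linear X -> M}, p \o g =1 f.

Definition fin_gen (Q : comPzRingType) (X : lmodType Q) : Prop :=
  exists n (e : 'I_n -> X),
    forall x, exists c : 'I_n -> Q, x = \sum_i c i *: e i.

Definition mk_linear (Q : comPzRingType) (X Y : lmodType Q) (f : X -> Y)
    (fL : linear f) : {linear X -> Y} :=
  HB.pack f (GRing.isLinear.Build Q X Y *:%R f fL).

Lemma linear_ext (Q : comPzRingType) (X Y : lmodType Q)
  (f g : {linear X -> Y}) : f =1 g -> f = g.
Proof.
case: f g => [f [[f1] [f2]]] [g [[g1] [g2]]] /= /funext e.
case: _ / e in g1 g2 *.
by rewrite (Prop_irrelevance g1 f1) (Prop_irrelevance g2 f2).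
Qed.

(** [Hom(X,Y)] as a k-module, with k acting through [rho : k -> Q] *)
Definition lin_hom (k : fieldType) (Q : comPzRingType)
  (rho : {rmorphism k -> Q}) (X Y : lmodType Q) := {linear X -> Y}.

Section LinHom.
Variables (k : fieldType) (Q : comPzRingType) (rho : {rmorphism k -> Q}).
Variables (X Y : lmodType Q).

Local Notation H := (lin_hom rho X Y).

HB.instance Definition _ := gen_eqMixin H.
HB.instance Definition _ := gen_choiceMixin H.

Definition lh_zero : H := (\0 : X -> Y).
Definition lh_opp (f : H) : H := \- (f : {linear X -> Y}).
Definition lh_add (f g : H) : H :=
  (f : {linear X -> Y}) \+ (g : {linear X -> Y}).
Definition lh_scale (c : k) (f : H) : H := rho c \*: (f : {linear X -> Y}).

Lemma lh_addA : associative lh_add.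
Proof. by move=> f g h; apply: linear_ext => x /=; rewrite addrA. Qed.
Lemma lh_addC : commutative lh_add.
Proof. by move=> f g; apply: linear_ext => x /=; rewrite addrC. Qed.
Lemma lh_add0 : left_id lh_zero lh_add.
Proof. by move=> f; apply: linear_ext => x /=; rewrite add0r. Qed.
Lemma lh_addN : left_inverse lh_zero lh_opp lh_add.
Proof. by move=> f; apply: linear_ext => x /=; rewrite addNr. Qed.

HB.instance Definition _ := GRing.isZmodule.Build H
  lh_addA lh_addC lh_add0 lh_addN.

Lemma lh_scaleA a b f : lh_scale a (lh_scale b f) = lh_scale (a * b) f.
Proof. by apply: linear_ext => x /=; rewrite rmorphM scalerA. Qed.
Lemma lh_scale1 : left_id 1 lh_scale.
Proof. by move=> f; apply: linear_ext => x /=; rewrite rmorph1 scale1r. Qed.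
Lemma lh_scaleDr : right_distributive lh_scale +%R.
Proof. by move=> a f g; apply: linear_ext => x /=; rewrite scalerDr. Qed.
Lemma lh_scaleDl f : {morph lh_scale^~ f : a b / a + b}.
Proof. by move=> a b; apply: linear_ext => x /=; rewrite rmorphD scalerDl. Qed.

HB.instance Definition _ := GRing.Zmodule_isLmodule.Build k H
  lh_scaleA lh_scale1 lh_scaleDr lh_scaleDl.

Lemma lhD (f g : H) x : (f + g) x = f x + g x. Proof. by []. Qed.
Lemma lhN (f : H) x : (- f) x = - f x. Proof. by []. Qed.
Lemma lhZ c (f : H) x : (c *: f) x = rho c *: f x. Proof. by []. Qed.
Lemma lh0 x : (0 : H) x = 0. Proof. by []. Qed.

End LinHom.

Section MatrixFactorizations.
Variables (k : fieldType) (Q : comPzRingType) (rho : {rmorphism k -> Q}).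
Variable v : Q.

Record mfact := MFact {
  mf0 : lmodType Q;
  mf1 : lmodType Q;
  mf_proj0 : projective mf0;
  mf_proj1 : projective mf1;
  mf_d01 : {linear mf0 -> mf1};
  mf_d10 : {linear mf1 -> mf0};
  mf_d2_0 : forall x, mf_d10 (mf_d01 x) = v *: x;
  mf_d2_1 : forall x, mf_d01 (mf_d10 x) = v *: x }.

Definition mf_tot (X : mfact) : lmodType Q := (mf0 X * mf1 X)%type.

Definition mf_d_fun (X : mfact) (p : mf_tot X) : mf_tot X :=
  (mf_d10 X p.2, mf_d01 X p.1).

Definition mf_pr_fun (X : mfact) (i : bool) (p : mf_tot X) : mf_tot X :=
  if i then (0, p.2) else (p.1, 0).

Lemma mf_d_linear X : linear (@mf_d_fun X).
Proof. by move=> a p q; rewrite /mf_d_fun /= !linearP. Qed.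

Lemma mf_pr_linear X i : linear (@mf_pr_fun X i).
Proof.
move=> a [p1 p2] [q1 q2]; rewrite /mf_pr_fun.
by case: i; congr pair => /=; rewrite ?scaler0 ?addr0.
Qed.

Definition mf_d X : {linear mf_tot X -> mf_tot X} := mk_linear (@mf_d_linear X).
Definition mf_pr X i : {linear mf_tot X -> mf_tot X} :=
  mk_linear (@mf_pr_linear X i).

Local Notation H X Y := (lin_hom rho (mf_tot X) (mf_tot Y)).

(* The component of degree i of f collects the blocks X^j -> Y^(i+j). *)
Definition mf_part X Y (i : bool) (f : H X Y) : H X Y :=
  (mf_pr Y i \o f \o mf_pr X false) \+ (mf_pr Y (~~ i) \o f \o mf_pr X true).

(* d f = d_Y f - (-1)^|f| f d_X on homogeneous f, extended additively *)
Definition mf_dhom X Y (f : H X Y) : H X Y :=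
  (mf_d Y \o f) \- (mf_part false f \o mf_d X) \+ (mf_part true f \o mf_d X).

Let lhD X Y := @lhD k Q rho (mf_tot X) (mf_tot Y).
Let lhZ X Y := @lhZ k Q rho (mf_tot X) (mf_tot Y).
Let lh0 X Y := @lh0 k Q rho (mf_tot X) (mf_tot Y).

Lemma mf_partE X Y i (f : H X Y) p :
  mf_part i f p = mf_pr Y i (f (mf_pr X false p))
                  + mf_pr Y (~~ i) (f (mf_pr X true p)).
Proof. by []. Qed.
Lemma mf_dhomE X Y (f : H X Y) p :
  mf_dhom f p = mf_d Y (f p) - mf_part false f (mf_d X p)
                + mf_part true f (mf_d X p).
Proof. by []. Qed.

Lemma mf_pr_idem X i j p :
  mf_pr X i (mf_pr X j p) = if i == j then mf_pr X j p else 0.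
Proof. by case: i; case: j. Qed.
Lemma mf_pr_sum X p : mf_pr X false p + mf_pr X true p = p.
Proof. by case: p => a b; congr pair; rewrite /= ?addr0 ?add0r. Qed.
Lemma mf_d_pr X i p : mf_d X (mf_pr X i p) = mf_pr X (~~ i) (mf_d X p).
Proof. by rewrite /=/mf_d_fun /mf_pr_fun; case: i; congr pair; rewrite /= ?linear0. Qed.
Lemma mf_dd X p : mf_d X (mf_d X p) = v *: p.
Proof. by case: p => a b; congr pair; rewrite /= ?mf_d2_0 ?mf_d2_1. Qed.

Lemma mf_pr_id X i p : mf_pr X i (mf_pr X i p) = mf_pr X i p.
Proof. by case: i. Qed.
Lemma mf_pr_dif X i p : mf_pr X (~~ i) (mf_pr X i p) = 0.
Proof. by case: i. Qed.
Lemma mf_pr_difV X i p : mf_pr X i (mf_pr X (~~ i) p) = 0.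
Proof. by case: i. Qed.

Lemma mf_part_pr X Y i (f : H X Y) j p :
  mf_part i f (mf_pr X j p) = mf_pr Y (i (+) j) (f (mf_pr X j p)).
Proof.
rewrite mf_partE; case: j; rewrite (mf_pr_dif true, mf_pr_dif false) mf_pr_id.
  by rewrite !linear0 add0r addbT.
by rewrite !linear0 addr0 addbF.
Qed.

Lemma mf_hom_ext X Y (f g : H X Y) :
  (forall i p, f (mf_pr X i p) = g (mf_pr X i p)) -> f = g.
Proof.
by move=> e; apply: linear_ext => p; rewrite -[p]mf_pr_sum !linearD !e.
Qed.

Lemma mf_part_linear X Y i : linear (@mf_part X Y i).
Proof.
move=> c f g; apply: mf_hom_ext => j p.
rewrite (lhD (c *: mf_part i f)) (lhZ c (mf_part i f)) !mf_part_pr.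
by rewrite (lhD (c *: f)) (lhZ c f) linearP.
Qed.

Definition mf_part_lin X Y i : {linear H X Y -> H X Y} :=
  HB.pack (@mf_part X Y i)
    (GRing.isLinear.Build k (H X Y) (H X Y) *:%R _ (@mf_part_linear X Y i)).

Lemma mf_part_idem X Y i j (f : H X Y) :
  mf_part i (mf_part j f) = if i == j then mf_part j f else 0.
Proof.
apply: mf_hom_ext => l p; rewrite !mf_part_pr mf_pr_idem.
have -> : (i (+) l == j (+) l) = (i == j) by case: i; case: j; case: l.
by case: (i == j); [rewrite mf_part_pr | rewrite lh0].
Qed.

Lemma mf_part_sum X Y (f : H X Y) : mf_part false f + mf_part true f = f.
Proof.
apply: mf_hom_ext => i p; rewrite (lhD (mf_part false f)) !mf_part_pr.
by case: i => /=; [rewrite addrC|]; rewrite mf_pr_sum.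
Qed.

Lemma mf_dhom_pr X Y (f : H X Y) i p :
  mf_dhom f (mf_pr X i p) = mf_d Y (f (mf_pr X i p))
    - mf_pr Y (~~ i) (f (mf_pr X (~~ i) (mf_d X p)))
    + mf_pr Y i (f (mf_pr X (~~ i) (mf_d X p))).
Proof. by rewrite mf_dhomE mf_d_pr !mf_part_pr; case: i. Qed.

Lemma mf_dhom_linear X Y : linear (@mf_dhom X Y).
Proof.
move=> c f g; apply: mf_hom_ext => j p.
rewrite (lhD (c *: mf_dhom f)) (lhZ c (mf_dhom f)) !mf_dhom_pr.
rewrite !(lhD (c *: f)) !(lhZ c f) (linearP (mf_d Y)).
rewrite (linearP (mf_pr Y (~~ j))) (linearP (mf_pr Y j)).
rewrite scalerDr scalerBr opprD [RHS]addrACA; congr (_ + _).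
exact: addrACA.
Qed.

Definition mf_dhom_lin X Y : {linear H X Y -> H X Y} :=
  HB.pack (@mf_dhom X Y)
    (GRing.isLinear.Build k (H X Y) (H X Y) *:%R _ (@mf_dhom_linear X Y)).

Lemma mf_dhom_part X Y i (f : H X Y) :
  mf_dhom (mf_part i f) = mf_part (~~ i) (mf_dhom f).
Proof.
apply: mf_hom_ext => j p.
rewrite mf_part_pr !mf_dhom_pr !mf_part_pr (linearD (mf_pr Y _)).
rewrite (linearB (mf_pr Y _)) mf_d_pr addNb.
case: i; rewrite ?addTb ?addFb ?negbK ?mf_pr_id ?mf_pr_dif ?mf_pr_difV //.

Qed.

Lemma mf_dhom_homog X Y (i : bool) (f : H X Y) p : mf_part i f = f ->
  mf_dhom f p = mf_d Y (f p) - (-1) ^+ i *: f (mf_d X p).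
Proof.
move=> fi; have fN : mf_part (~~ i) f = 0.
  by rewrite -fi mf_part_idem; case: (i).
rewrite mf_dhomE; case: i fi fN => fi fN; rewrite fi fN lh0.
  by rewrite subr0 scaleN1r opprK.
by rewrite addr0 scale1r.
Qed.

Lemma mf_dhom_dd X Y (f : H X Y) : mf_dhom (mf_dhom f) = 0.
Proof.
have dd i (g : H X Y) : mf_part i g = g -> mf_dhom (mf_dhom g) = 0.
  move=> gi; have di : mf_part (~~ i) (mf_dhom g) = mf_dhom g.
    by rewrite -mf_dhom_part gi.
  apply: linear_ext => p; rewrite (mf_dhom_homog _ di) !(mf_dhom_homog _ gi).
  rewrite (linearB (mf_d Y)) (linearZ_LR (mf_d Y)) !mf_dd (linearZ_LR g) lh0.
  case: i {gi di}; rewrite expr1 expr0 !scaleN1r !scale1r !opprK.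
    by rewrite [X in _ - X]addrC subrr.
  by rewrite addrA addrNK subrr.
have dD (g h : H X Y) : mf_dhom (g + h) = mf_dhom g + mf_dhom h.
  exact: linearD (mf_dhom_lin X Y) g h.
rewrite -(mf_part_sum f) (dD (mf_part false f)) (dD (mf_dhom _)).
rewrite (dd _ _ (mf_part_idem false false f)).
by rewrite (dd _ _ (mf_part_idem true true f)) addr0.
Qed.

Definition mf_hom X Y : complex k :=
  @Complex k (H X Y) (@mf_part_lin X Y) (@mf_dhom_lin X Y)
    (@mf_part_idem X Y) (@mf_part_sum X Y) (@mf_dhom_part X Y)
    (@mf_dhom_dd X Y).

Definition mf_id X : mf_hom X X := (idfun : {linear mf_tot X -> mf_tot X}).
Definition mf_comp X Y Z (g : mf_hom Y Z) (f : mf_hom X Y) : mf_hom X Z :=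
  (g : {linear mf_tot Y -> mf_tot Z}) \o (f : {linear mf_tot X -> mf_tot Y}).

Lemma mf_comp_linl X Y Z (f : mf_hom X Y) :
  linear (fun g : mf_hom Y Z => mf_comp g f).
Proof. by move=> c g g'; apply: linear_ext. Qed.

Lemma mf_comp_linr X Y Z (g : mf_hom Y Z) :
  linear (fun f : mf_hom X Y => mf_comp g f).
Proof. by move=> c f f'; apply: linear_ext => p; apply: linearP. Qed.

Lemma mf_compA X Y Z T (h : mf_hom Z T) (g : mf_hom Y Z) (f : mf_hom X Y) :
  mf_comp h (mf_comp g f) = mf_comp (mf_comp h g) f.
Proof. exact: linear_ext. Qed.

Lemma mf_comp1l X Y (f : mf_hom X Y) : mf_comp (mf_id Y) f = f.
Proof. exact: linear_ext. Qed.

Lemma mf_comp1r X Y (f : mf_hom X Y) : mf_comp f (mf_id X) = f.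
Proof. exact: linear_ext. Qed.

Lemma mf_id_even X : homog false (mf_id X).
Proof.
by apply: mf_hom_ext => j p; rewrite mf_part_pr; exact: mf_pr_id.
Qed.

Lemma mf_homogP X Y i (f : H X Y) : mf_part i f = f ->
  forall j p, f (mf_pr X j p) = mf_pr Y (i (+) j) (f (mf_pr X j p)).
Proof. by move=> fi j p; rewrite -{1}fi mf_part_pr. Qed.

Lemma mf_d_id X : cx_d _ (mf_id X) = 0.
Proof.
apply: linear_ext => p; rewrite -[LHS]/(mf_dhom (mf_id X) p).
by rewrite (mf_dhom_homog _ (mf_id_even X)) scale1r subrr.
Qed.

Lemma mf_comp_homog X Y Z i j (g : mf_hom Y Z) (f : mf_hom X Y) :
  homog i g -> homog j f -> homog (i (+) j) (mf_comp g f).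
Proof.
move=> gi fj; apply: mf_hom_ext => l p; rewrite mf_part_pr.
have -> : mf_comp g f (mf_pr X l p)
          = mf_pr Z (i (+) j (+) l) (g (f (mf_pr X l p))).
  rewrite -[LHS]/(g (f (mf_pr X l p))) (mf_homogP fj) -addbA.
  exact: (mf_homogP gi).
exact: mf_pr_id.
Qed.

Lemma mf_leibniz X Y Z (i : bool) (g : mf_hom Y Z) (f : mf_hom X Y) :
  homog i g ->
  cx_d _ (mf_comp g f) = mf_comp (cx_d _ g) f
                         + (-1) ^+ i *: mf_comp g (cx_d _ f).
Proof.
move=> gi.
have lz j (h : mf_hom X Y) : homog j h ->
  mf_dhom (mf_comp g h) = mf_comp (mf_dhom g) h
                          + (-1) ^+ i *: mf_comp g (mf_dhom h).
  move=> hj; have gh := mf_comp_homog gi hj.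
  apply: linear_ext => p; rewrite (mf_dhom_homog _ gh).
  rewrite (lhD (mf_comp (mf_dhom g) h)) (lhZ _ (mf_comp g (mf_dhom h))).
  rewrite -[X in _ = X + _]/(mf_dhom g (h p)).
  rewrite -[X in _ = _ + _ *: X]/(g (mf_dhom h p)).
  rewrite (mf_dhom_homog _ gi) (mf_dhom_homog _ hj) (linearB g) (linearZ_LR g).
  by rewrite rmorph_sign scalerBr addrA addrNK scalerA signr_addb.
have cD (u : mf_hom Y Z) (h h' : mf_hom X Y) :
  mf_comp u (h + h') = mf_comp u h + mf_comp u h'.
  by have := mf_comp_linr u 1 h h'; rewrite !scale1r.
have dD A B (h h' : mf_hom A B) : mf_dhom (h + h') = mf_dhom h + mf_dhom h'.
  exact: linearD (mf_dhom_lin A B) h h'.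
rewrite -[cx_d _ _]/(mf_dhom _) -[cx_d _ g]/(mf_dhom g) -[cx_d _ f]/(mf_dhom f).
rewrite -(mf_part_sum f); set f0 := mf_part false f; set f1 := mf_part true f.
rewrite (cD g f0 f1) (dD _ _ (mf_comp g f0)) (dD _ _ f0 f1).
rewrite (cD (mf_dhom g) f0 f1) (cD g (mf_dhom f0)) scalerDr [RHS]addrACA.
congr (_ + _); [apply: (lz false) | apply: (lz true)].
  exact: (mf_part_idem false false).
exact: (mf_part_idem true true).
Qed.

Definition MFinf : dgcat k :=
  @DGCat k mfact mf_hom mf_id mf_comp mf_comp_linl mf_comp_linr mf_compA
    mf_comp1l mf_comp1r mf_id_even mf_d_id mf_comp_homog mf_leibniz.

Definition MF : dgcat k :=
  dg_full (fun X : MFinf => fin_gen (mf0 X) /\ fin_gen (mf1 X)).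

End MatrixFactorizations.

(** R[x,y] is [{poly {poly R}}], with x = ['X%:P] and y = ['X]. *)
Section PolyXY.
Variables (k : fieldType) (R : comAlgType k).

Definition polyxy : comNzRingType := {poly {poly R}}.

Definition to_polyxy : {rmorphism R -> polyxy} := polyC \o polyC.

Definition in_polyxy : {rmorphism k -> polyxy} := to_polyxy \o in_alg R.

Definition knorrer_potential (w : R) : polyxy :=
  to_polyxy w + 'X%:P * 'X.

Definition ideal_sxy (s : {pred R}) : set polyxy :=
  ideal_gen (fun p =>
    (exists2 a, a \in s & p = to_polyxy a) \/ p = 'X%:P \/ p = 'X).

End PolyXY.

(* Main.v *)
Require Import Defs.
From HB Require Import structures.
From mathcomp Require Import all_boot all_algebra ring_quotient.
From mathcomp Require Import boolp classical_sets.

Set Implicit Arguments.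
Unset Strict Implicit.
Unset Printing Implicit Defensive.

Import GRing.Theory.
Local Open Scope ring_scope.

(** Let [Q] be [R[x,y]] or its completion. Stabilization tensors a factorization
    [X] of [w] with the rank one factorization [x * y] of [xy] over [Q].

    It is fully faithful up to homotopy: a closed map out of the stabilization
    of [X] is determined, up to homotopy, by its value on [X] modulo [(x, y)].

    For essential surjectivity, [y] and [x] are the partial derivatives of
    [v = w + xy], so they act on factorizations of [v] by nullhomotopic maps,
    with the derivatives of the differential as homotopies. Hence a contraction
    modulo [(x, y)] of the mapping cone of a comparison map lifts to the cone.

    In infinite rank the Eilenberg swindle makes the components of a
    factorization [Y] of [v] free. Then [Y/xY] is a factorization of [w] over
    [R], because [R[y]] is free over [R], and its shift stabilizes to [Y].

    In finite rank over the completion the components of [Y] are free. Write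
    [d = D + x phi + y theta + xy psi + ...]. From [d^2 = w + xy] one gets
    [phi theta + theta phi ~ 1], [phi^2 ~ 0] and [theta^2 ~ 0] for chain
    homotopies with respect to [D], so [phi theta] is idempotent up to homotopy.
    Fitting's lemma over the residue field and Newton iteration replace it by
    a strict idempotent commuting with [D], whose image stabilizes to [Y]. *)

Local Open Scope quotient_scope.

(** Modulo [(x, y)] the stabilization of [X] is [X] plus a shifted copy of [X], so undoing it means
    halving [Y/(x, y)]. The two ranks need two ways of halving: [Y/xY] is in general not finitely
    generated over [R], so in finite rank a half has to be cut out of [Y/(x, y)] itself. The
    idempotent that does this is given only up to homotopy, and making it strict is where a complete
    local base enters.

    Neither infinite rank nor the polynomial ring leaves room for Nakayama's lemma. Instead, extend
    a contraction found modulo [(x, y)] linearly; its error commutes with the differential [D] and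
    has the form [x a + y b]. Since [x, y] is a regular sequence, [[D, a] = y E] and [[D, b] = - x
    E] for a single [E], and the nullhomotopies of [x] and [y] absorb the error in one pass, without
    any limit.

    Both extensions are handled through a few operators: setting [x = y = 0], dividing by a
    variable, differentiating. Each lowers the adic filtration by at most one step, so it passes to
    the completion, where identities between them hold by density. *)

Definition mk_additive (U V : zmodType) (f : U -> V) (fB : zmod_morphism f) :
  {additive U -> V} := HB.pack f (GRing.isZmodMorphism.Build U V f fB).

Arguments mk_additive : simpl never.
Arguments mk_linear : simpl never.

(* A module over [Q] is presented by generators [q (x) m], with [q] in [Q] and
   [m] in [pM], and by the functions out of the generators that should extend
   additively: two words are identified when no such function separates them. *)
Record presentation (Q : comPzRingType) := Presentation {
  pM : Type;
  pC : forall A : zmodType, (Q -> pM -> A) -> Prop;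
  pC_add : forall (A : zmodType) (f : Q -> pM -> A), pC f ->
    forall m, zmod_morphism (f^~ m);
  pC_act : forall (A : zmodType) (f : Q -> pM -> A) q, pC f ->
    pC (fun q' m => f (q * q') m) }.

(** * Modules presented by a universal property *)

Section PresentedModule.
Variables (Q : comPzRingType) (P : presentation Q).

Definition word := seq (Q * pM P).
HB.instance Definition _ := gen_eqMixin word.
HB.instance Definition _ := gen_choiceMixin word.

Definition word_sum (A : zmodType) (f : Q -> pM P -> A) (s : word) : A :=
  \sum_(p <- s) f p.1 p.2.

Definition word_eqv (s t : word) : bool :=
  `[< forall (A : zmodType) (f : Q -> pM P -> A), pC f ->
      word_sum f s = word_sum f t >].

Lemma word_eqv_equiv : equiv_class_of word_eqv.
Proof.
split=> [s|s t|t s u]; first by apply/asboolP.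
  by apply: asbool_equiv_eq; split=> h A f Cf; rewrite h.
by move=> /asboolP h1 /asboolP h2; apply/asboolP => A f Cf; rewrite h1 ?h2.
Qed.

Canonical word_equiv := EquivRelPack word_eqv_equiv.

Definition pmod := {eq_quot word_eqv}.
HB.instance Definition _ : EqQuotient word word_eqv pmod :=
  EqQuotient.on pmod.
HB.instance Definition _ := Choice.on pmod.

Local Notation pi := (\pi_pmod).

Lemma pmod_eq (s t : word) :
  (forall (A : zmodType) (f : Q -> pM P -> A), pC f ->
     word_sum f s = word_sum f t) -> pi s = pi t.
Proof. by move=> h; apply/eqquotP/asboolP. Qed.

Lemma pmod_repr (A : zmodType) (f : Q -> pM P -> A) (s : word) : pC f ->
  word_sum f (repr (pi s)) = word_sum f s.
Proof.
move=> Cf; have /eqquotP/asboolP h : repr (pi s) = s %[mod pmod].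
  by rewrite reprK.
exact: h.
Qed.

Lemma pmod_ind (T : pmod -> Prop) : (forall s, T (pi s)) -> forall x, T x.
Proof. by move=> h x; rewrite -[x]reprK. Qed.

Definition word_act q (s : word) : word := [seq (q * p.1, p.2) | p <- s].

Lemma word_sum_cat (A : zmodType) (f : Q -> pM P -> A) s t :
  word_sum f (s ++ t) = word_sum f s + word_sum f t.
Proof. by rewrite /word_sum big_cat. Qed.

Lemma word_sum_act (A : zmodType) (f : Q -> pM P -> A) q s :
  word_sum f (word_act q s) = word_sum (fun q' => f (q * q')) s.
Proof. by rewrite /word_sum big_map. Qed.

Lemma word_sum_nil (A : zmodType) (f : Q -> pM P -> A) : word_sum f [::] = 0.
Proof. by rewrite /word_sum big_nil. Qed.

Lemma word_actD (A : zmodType) (f : Q -> pM P -> A) a b s : pC f ->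
  word_sum f (word_act (a + b) s)
  = word_sum f (word_act a s) + word_sum f (word_act b s).
Proof.
move=> Cf; rewrite !word_sum_act /word_sum -big_split /=.
apply: eq_bigr => p _; rewrite mulrDl.
exact: (raddfD (mk_additive (pC_add Cf p.2))).
Qed.

Lemma word_actN (A : zmodType) (f : Q -> pM P -> A) s : pC f ->
  word_sum f (word_act (-1) s) = - word_sum f s.
Proof.
move=> Cf; rewrite word_sum_act /word_sum -sumrN.
apply: eq_bigr => p _; rewrite mulN1r.
exact: (raddfN (mk_additive (pC_add Cf p.2))).
Qed.

Definition pmod_add (x y : pmod) : pmod := pi (repr x ++ repr y : word).
Definition pmod_scale q (x : pmod) : pmod := pi (word_act q (repr x)).
(** Acting by [-1] is an additive inverse because of [pC_add], so words need no formal inverses of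
    generators. *)
Definition pmod_opp (x : pmod) : pmod := pmod_scale (-1) x.
Definition pmod_zero : pmod := pi ([::] : word).

Lemma pmod_addE s t : pmod_add (pi s) (pi t) = pi (s ++ t : word).
Proof. by apply: pmod_eq => A f Cf; rewrite !word_sum_cat !pmod_repr. Qed.
Lemma pmod_scaleE q s : pmod_scale q (pi s) = pi (word_act q s).
Proof.
apply: pmod_eq => A f Cf; rewrite !word_sum_act.
exact: (pmod_repr _ (pC_act q Cf)).
Qed.

Lemma pmod_addA : associative pmod_add.
Proof.
apply: pmod_ind => s; apply: pmod_ind => t; apply: pmod_ind => u.
by rewrite !pmod_addE catA.
Qed.
Lemma pmod_addC : commutative pmod_add.
Proof.
apply: pmod_ind => s; apply: pmod_ind => t; rewrite !pmod_addE.
by apply: pmod_eq => A f Cf; rewrite !word_sum_cat addrC.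
Qed.
Lemma pmod_add0 : left_id pmod_zero pmod_add.
Proof. by apply: pmod_ind => s; rewrite pmod_addE. Qed.
Lemma pmod_addN : left_inverse pmod_zero pmod_opp pmod_add.
Proof.
apply: pmod_ind => s; rewrite /pmod_opp pmod_scaleE pmod_addE.
apply: pmod_eq => A f Cf.
by rewrite word_sum_cat word_actN // addNr word_sum_nil.
Qed.

HB.instance Definition _ := GRing.isZmodule.Build pmod
  pmod_addA pmod_addC pmod_add0 pmod_addN.

Lemma pmod_scaleA a b x : pmod_scale a (pmod_scale b x) = pmod_scale (a * b) x.
Proof.
move: x; apply: pmod_ind => s; rewrite !pmod_scaleE; congr (pi _).
by rewrite /word_act -map_comp; apply: eq_map => p /=; rewrite mulrA.
Qed.
Lemma pmod_scale1 : left_id 1 pmod_scale.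
Proof.
apply: pmod_ind => s; rewrite pmod_scaleE; congr (pi _).
by rewrite /word_act -[RHS]map_id; apply: eq_map => -[q m] /=; rewrite mul1r.
Qed.
Lemma pmod_scaleDr : right_distributive pmod_scale +%R.
Proof.
move=> a; apply: pmod_ind => s; apply: pmod_ind => t.
rewrite -![_ + _]/(pmod_add _ _) pmod_addE !pmod_scaleE pmod_addE.
by rewrite /word_act map_cat.
Qed.
Lemma pmod_scaleDl x : {morph pmod_scale^~ x : a b / a + b}.
Proof.
move=> a b; move: x; apply: pmod_ind => s.
rewrite -[RHS]/(pmod_add _ _) !pmod_scaleE pmod_addE.
by apply: pmod_eq => A f Cf; rewrite word_sum_cat word_actD.
Qed.

HB.instance Definition _ := GRing.Zmodule_isLmodule.Build Q pmod
  pmod_scaleA pmod_scale1 pmod_scaleDr pmod_scaleDl.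

Definition pgen q m : pmod := pi ([:: (q, m)] : word).

Lemma pgenZ a q m : a *: pgen q m = pgen (a * q) m.
Proof. by rewrite -[LHS]/(pmod_scale _ _) pmod_scaleE. Qed.

Lemma word_sum_gen (A : zmodType) (f : Q -> pM P -> A) q m :
  word_sum f [:: (q, m)] = f q m.
Proof. by rewrite /word_sum big_seq1. Qed.

Section Lift.
Variables (A : zmodType) (f : Q -> pM P -> A) (Cf : pC f).

(** Independent of the representative because [word_eqv] quantifies over all admissible functions,
    [f] among them: the universal property is built into the relation. *)
Definition plift_fun (x : pmod) : A := word_sum f (repr x).

Lemma plift_funB : zmod_morphism plift_fun.
Proof.
apply: pmod_ind => s; apply: pmod_ind => t; rewrite /plift_fun.
rewrite -[_ - _]/(pmod_add _ (pmod_scale _ _)) pmod_scaleE pmod_addE.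
by rewrite !pmod_repr // word_sum_cat word_actN.
Qed.

Definition plift : {additive pmod -> A} := mk_additive plift_funB.

Lemma plift_gen q m : plift (pgen q m) = f q m.
Proof. by rewrite /= /plift_fun pmod_repr // word_sum_gen. Qed.

End Lift.

Lemma pmod_cons p s : pi (p :: s : word) = pgen p.1 p.2 + pi s.
Proof.
rewrite -[RHS]/(pmod_add _ _) pmod_addE.
by case: p => q m.
Qed.

Lemma pmod_span (T : pmod -> Prop) : T 0 ->
  (forall q m x, T x -> T (pgen q m + x)) -> forall x, T x.
Proof.
move=> T0 Tg; apply: pmod_ind; elim=> [//|p s Ts].
by rewrite pmod_cons; apply: Tg.
Qed.

Lemma padd_ext (A : zmodType) (f g : {additive pmod -> A}) :
  (forall q m, f (pgen q m) = g (pgen q m)) -> f =1 g.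
Proof.
move=> e; apply: pmod_span => [|q m x ex]; first by rewrite !raddf0.
by rewrite !raddfD e ex.
Qed.

End PresentedModule.

(** * Free modules and restriction of scalars *)

Section Free.
Variables (R : comPzRingType) (S : Type).

Definition free_class (A : zmodType) (f : R -> S -> A) : Prop :=
  forall s, zmod_morphism (f^~ s).

Lemma free_class_act (A : zmodType) (f : R -> S -> A) q : free_class f ->
  free_class (fun q' m => f (q * q') m).
Proof. by move=> Cf s a b; rewrite mulrBr Cf. Qed.

Definition free_presentation :=
  @Presentation R S free_class (fun A f Cf => Cf) free_class_act.

Local Notation free := (pmod free_presentation).
Definition fgen (s : S) : free := pgen (P := free_presentation) 1 s.

Lemma fgenE q s : pgen (P := free_presentation) q s = q *: fgen s.
Proof. by rewrite pgenZ mulr1. Qed.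

Lemma free_ext (M : lmodType R) (f g : {linear free -> M}) :
  (forall s, f (fgen s) = g (fgen s)) -> f =1 g.
Proof. move=> e; apply: padd_ext => q m.
by rewrite fgenE -[LHS]/(f (q *: fgen m)) -[RHS]/(g (q *: fgen m)) !linearZ_LR e.
Qed.

Lemma free_lift_class (M : lmodType R) (h : S -> M) :
  free_class (fun r s => r *: h s).
Proof. by move=> s a b; rewrite scalerBl. Qed.

Lemma free_lift_linear (M : lmodType R) (h : S -> M) :
  linear (plift (P := free_presentation) (free_lift_class h)).
Proof.
move=> a u v; rewrite raddfD; congr (_ + _).
elim/pmod_span: u => [|q m x ex]; first by rewrite scaler0 raddf0 scaler0.
rewrite scalerDr !raddfD ex; congr (_ + _).
by rewrite pgenZ !plift_gen /= scalerA.
Qed.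

Definition free_lift (M : lmodType R) (h : S -> M) : {linear free -> M} :=
  mk_linear (free_lift_linear h).

Lemma free_liftE (M : lmodType R) (h : S -> M) s :
  free_lift h (fgen s) = h s.
Proof.
by rewrite -[LHS]/(plift (P := free_presentation) (free_lift_class h) (fgen s)) plift_gen scale1r.
Qed.

Lemma free_projective : projective (pmod free_presentation).
Proof.
move=> M N p f ps; pose h s := sval (cid (ps (f (fgen s)))).
exists (free_lift h); apply: (free_ext (f := p \o free_lift h)) => s.
rewrite -[LHS]/(p (free_lift h (fgen s))) free_liftE /h.
by case: cid.
Qed.

End Free.

(** A copy of [M] that carries the [B]-module structure, so that a map semilinear along [c] into [M]
    is an ordinary linear map into [restr c M]. *)
Definition restr (B Q : comPzRingType) (c : {rmorphism B -> Q})
  (M : lmodType Q) : Type := M.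

Section Restriction.
Variables (B Q : comPzRingType) (c : {rmorphism B -> Q}) (M : lmodType Q).
Local Notation restr := (restr c M).

HB.instance Definition _ := GRing.Zmodule.on restr.

Definition restr_scale (r : B) (m : restr) : restr := c r *: (m : M).

Lemma restr_scaleA a b m : restr_scale a (restr_scale b m) = restr_scale (a * b) m.
Proof. by rewrite /restr_scale scalerA rmorphM. Qed.
Lemma restr_scale1 : left_id 1 restr_scale.
Proof. by move=> m; rewrite /restr_scale rmorph1 scale1r. Qed.
Lemma restr_scaleDr : right_distributive restr_scale +%R.
Proof. by move=> a m m'; rewrite /restr_scale scalerDr. Qed.
Lemma restr_scaleDl m : {morph restr_scale^~ m : a b / a + b}.
Proof. by move=> a b; rewrite /restr_scale rmorphD scalerDl. Qed.

HB.instance Definition _ := GRing.Zmodule_isLmodule.Build B restr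
  restr_scaleA restr_scale1 restr_scaleDr restr_scaleDl.

End Restriction.

Definition semilinear (B Q : comPzRingType) (c : B -> Q) (V : lmodType B)
  (N : lmodType Q) (g : V -> N) := forall r v, g (r *: v) = c r *: g v.

Section RestrictionMaps.
Variables (B Q : comPzRingType) (c : {rmorphism B -> Q}).

Lemma restr_linear_linear (M N : lmodType Q) (f : {linear M -> N}) :
  linear (f : restr c M -> restr c N).
Proof. by move=> a u v; rewrite -[RHS]/(c a *: f u + f v) -linearP. Qed.
Definition restr_linear M N f : {linear restr c M -> restr c N} :=
  mk_linear (@restr_linear_linear M N f).

Lemma semilinear_restr (V : lmodType B) (N : lmodType Q)
  (g : {linear V -> restr c N}) : semilinear c (g : V -> N).
Proof. by move=> r v; rewrite linearZ_LR. Qed.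

End RestrictionMaps.

(** * Extension of scalars *)

Section Tensor.
Variables (B Q : comPzRingType) (c : {rmorphism B -> Q}) (V : lmodType B).

Definition balanced (A : zmodType) (f : Q -> V -> A) : Prop :=
  [/\ forall v, zmod_morphism (f^~ v), forall q, zmod_morphism (f q)
    & forall q r v, f (q * c r) v = f q (r *: v)].

Lemma balanced_act (A : zmodType) (f : Q -> V -> A) q : balanced f ->
  balanced (fun q' v => f (q * q') v).
Proof.
case=> h1 h2 h3; split=> [v a b|q'|q' r v]; first by rewrite mulrBr h1.
  exact: h2.
by rewrite mulrA h3.
Qed.

Definition tens_presentation :=
  @Presentation Q V balanced (fun A f Cf => let: And3 h _ _ := Cf in h)
    balanced_act.

Local Notation tens := (pmod tens_presentation).

Definition tin (q : Q) (v : V) : tens := pgen (P := tens_presentation) q v.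

Lemma tinE q v : tin q v = q *: tin 1 v.
Proof. by rewrite pgenZ mulr1. Qed.

Lemma tin_additive q : zmod_morphism (tin q).
Proof.
move=> u v; have eN : - tin q v = tin (- q) v.
  by rewrite -scaleN1r pgenZ mulN1r.
rewrite eN -[RHS]/(pmod_add _ _) pmod_addE; apply: pmod_eq => A f Cf.
rewrite (word_sum_cat f [:: (q, u)]) !word_sum_gen.
case: Cf => h1 h2 _; rewrite (h2 q); congr (_ + _).
exact/esym/(raddfN (mk_additive (h1 v))).
Qed.

Lemma tin_balanced q r v : tin (q * c r) v = tin q (r *: v).
Proof.
by apply: pmod_eq => A f Cf; rewrite !word_sum_gen; case: Cf => _ _.
Qed.

Definition ti : {additive V -> tens} := mk_additive (tin_additive 1).

Lemma tiE v : ti v = tin 1 v. Proof. by []. Qed.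

Lemma tiZ : semilinear c ti.
Proof.
by move=> r v; rewrite !tiE -tin_balanced mul1r tinE.
Qed.

Definition tlift (A : zmodType) (f : Q -> V -> A) (Cf : balanced f) :
  {additive tens -> A} := plift (P := tens_presentation) Cf.

Lemma tlift_in (A : zmodType) (f : Q -> V -> A) (Cf : balanced f) q v :
  tlift Cf (tin q v) = f q v.
Proof. exact: plift_gen. Qed.

Lemma tlift_exists (A : zmodType) (f : Q -> V -> A) : balanced f ->
  {g : {additive tens -> A} | forall q v, g (tin q v) = f q v}.
Proof. by move=> Cf; exists (tlift Cf) => q v; exact: tlift_in. Qed.

Lemma tens_ext (A : zmodType) (f g : {additive tens -> A}) :
  (forall q v, f (tin q v) = g (tin q v)) -> f =1 g.
Proof. by move=> e; apply: padd_ext. Qed.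

Lemma tens_span (T : tens -> Prop) : T 0 ->
  (forall q v x, T x -> T (tin q v + x)) -> forall x, T x.
Proof. by move=> T0 Tg x; apply: (pmod_span (T := T)). Qed.

Lemma tens_lext (N : lmodType Q) (f g : {linear tens -> N}) :
  (forall v, f (ti v) = g (ti v)) -> f =1 g.
Proof.
move=> e; apply: tens_ext => q v.
by rewrite tinE -[LHS]/(f (q *: ti v)) -[RHS]/(g (q *: ti v)) !linearZ_LR e.
Qed.

(** The existence half of the adjunction between extension and restriction of scalars; uniqueness is
    [tens_lext]. *)
Lemma tens_extend (N : lmodType Q) (g : {additive V -> N}) : semilinear c g ->
  {f : {linear tens -> N} | forall v, f (ti v) = g v}.
Proof.
move=> gZ; have bal : balanced (fun q v => q *: g v).
  split=> [v a b|q u v|q r v]; first by rewrite scalerBl.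
    by rewrite raddfB scalerBr.
  by rewrite gZ scalerA.
have [f fE] := tlift_exists bal.
have fL : linear f.
  move=> a u v; rewrite raddfD; congr (_ + _).
  elim/tens_span: u => [|q m x ex]; first by rewrite scaler0 raddf0 scaler0.
  rewrite scalerDr !raddfD ex; congr (_ + _).
  by rewrite pgenZ !fE /= scalerA.
exists (mk_linear fL) => v; rewrite -[LHS]/(f (tin 1 v)) fE.
by rewrite scale1r.
Qed.

(** By adjunction a lifting problem over [Q] becomes one for [V] over [B] against the restricted
    modules, and restriction keeps surjections surjective. *)
Lemma tens_projective : projective V -> projective (pmod tens_presentation).
Proof.
move=> pV M N p f ps.
have fL : linear (f \o ti : V -> restr c N).
  move=> a u v; rewrite -[LHS]/(f (ti (a *: u + v))).
  by rewrite -[RHS]/(c a *: f (ti u) + f (ti v)) raddfD tiZ linearP.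
have [g gE] := pV (restr c M) (restr c N) (restr_linear c p) (mk_linear fL) ps.
have [h hE] := tens_extend (@semilinear_restr _ _ c _ _ g).
exists h; apply: (tens_lext (f := p \o h)) => v.
by rewrite -[LHS]/(p (h (ti v))) hE; exact: gE.
Qed.

Lemma tens_fin_gen : fin_gen V -> fin_gen (pmod tens_presentation).
Proof.
case=> n [e he]; exists n, (fun i => ti (e i)) => x.
elim/tens_span: x => [|q v x [a ->]].
  by exists (fun=> 0); rewrite big1 // => i _; rewrite scale0r.
have [b ->] := he v; exists (fun i => q * c (b i) + a i).
under [RHS]eq_bigr do rewrite scalerDl; rewrite big_split; congr (_ + _).
rewrite tinE -tiE raddf_sum scaler_sumr; apply: eq_bigr => i _.
by rewrite tiZ scalerA.
Qed.

End Tensor.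

Arguments ti {B Q} c {V}.
Arguments tin {B Q} c {V}.
Notation tens c V := (pmod (tens_presentation c V)).

Section TensorMaps.
Variables (B Q Q' : comPzRingType).
Variables (c : {rmorphism B -> Q}) (c' : {rmorphism B -> Q'}) (V : lmodType B).

Lemma top_balanced (T : {additive Q -> Q'}) :
  (forall q r, T (q * c r) = T q * c' r) ->
  balanced c (fun q v => tin c' (T q) v : tens c' V).
Proof.
move=> TZ; split=> [v a b|q|q r v]; last by rewrite TZ tin_balanced.
  rewrite raddfB [LHS]tinE scalerBl; congr (_ - _); exact/esym/tinE.
exact: tin_additive.
Qed.

(** Only compatibility with [B] is asked of [T], so division by a variable and partial derivatives,
    which are not [Q]-linear, act on the ring factor of an extended module. *)
Definition top (T : {additive Q -> Q'})
    (TZ : forall q r, T (q * c r) = T q * c' r) :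
  {additive tens c V -> tens c' V} := tlift (top_balanced TZ).

Lemma top_in (T : {additive Q -> Q'}) TZ q v :
  @top T TZ (tin c q v) = tin c' (T q) v.
Proof. exact: tlift_in. Qed.

End TensorMaps.

Arguments top {B Q Q' c c' V T} TZ.

Section TensorFunctor.
Variables (B Q : comPzRingType) (c : {rmorphism B -> Q}).

Lemma tmap_additive (V W : lmodType B) (f : {linear V -> W}) :
  zmod_morphism (fun v => ti c (f v)).
Proof. by move=> u v; rewrite linearB raddfB. Qed.

Lemma tmap_semilinear (V W : lmodType B) (f : {linear V -> W}) :
  semilinear c (mk_additive (tmap_additive f)).
Proof. by move=> r v; rewrite -[LHS]/(ti c (f (r *: v))) linearZ_LR tiZ. Qed.

Definition tmap V W f : {linear tens c V -> tens c W} :=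
  sval (tens_extend (@tmap_semilinear V W f)).

Lemma tmap_i V W f v : @tmap V W f (ti c v) = ti c (f v).
Proof. by rewrite /tmap; case: tens_extend. Qed.

Lemma tmap_in V W f q v : @tmap V W f (tin c q v) = tin c q (f v).
Proof. by rewrite tinE -tiE linearZ_LR tmap_i [RHS]tinE. Qed.

Lemma tmap_comp (U V W : lmodType B) (g : {linear V -> W}) (f : {linear U -> V}) x :
  tmap g (tmap f x) = tmap (g \o f) x.
Proof.
move: x; apply: (tens_lext (f := tmap g \o tmap f)) => v.
by rewrite -[LHS]/(tmap g (tmap f (ti c v))) !tmap_i.
Qed.

Lemma tmap_ext (V W : lmodType B) (f g : {linear V -> W}) : f =1 g -> tmap f =1 tmap g.
Proof. by move=> e; apply: tens_lext => v; rewrite !tmap_i e. Qed.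

Lemma tmap_id (V : lmodType B) x : tmap (idfun : {linear V -> V}) x = x.
Proof.
move: x; apply: (tens_lext (g := idfun)) => v.
by rewrite tmap_i.
Qed.

Lemma tmapD (V W : lmodType B) (f g : {linear V -> W}) x :
  tmap (f \+ g) x = tmap f x + tmap g x.
Proof.
move: x; apply: (tens_lext (g := tmap f \+ tmap g)) => v.
rewrite -[RHS]/(tmap f (ti c v) + tmap g (ti c v)) !tmap_i.
by rewrite -raddfD.
Qed.

Lemma tmapN (V W : lmodType B) (f : {linear V -> W}) x : tmap (\- f) x = - tmap f x.
Proof.
move: x; apply: (tens_lext (g := \- tmap f)) => v.
by rewrite -[RHS]/(- tmap f (ti c v)) !tmap_i -raddfN.
Qed.

Lemma tmap0 (V W : lmodType B) x : tmap (\0 : {linear V -> W}) x = 0.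
Proof.
move: x; apply: (tens_lext (g := \0)) => v.
by rewrite tmap_i -[RHS]/0 -[RHS](raddf0 (ti c)).
Qed.

Lemma tmapZ (V W : lmodType B) r (f : {linear V -> W}) x :
  tmap (r \*: f) x = c r *: tmap f x.
Proof.
move: x; apply: (tens_lext (g := c r \*: tmap f)) => v.
by rewrite -[RHS]/(c r *: tmap f (ti c v)) !tmap_i -tiZ.
Qed.

Lemma top_tmap (T : {additive Q -> Q}) TZ (V W : lmodType B) (f : {linear V -> W}) x :
  @top B Q Q c c W T TZ (tmap f x) = tmap f (@top B Q Q c c V T TZ x).
Proof.
move: x; apply: (tens_ext (f := @top B Q Q c c W T TZ \o tmap f)
                          (g := tmap f \o @top B Q Q c c V T TZ)) => q v.
rewrite -[LHS]/(top TZ (tmap f (tin c q v))) tmap_in top_in.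
by rewrite -[RHS]/(tmap f (top TZ (tin c q v))) top_in tmap_in.
Qed.

End TensorFunctor.

(** * Polynomial-like extensions in two variables *)

(* An extension [xc : B -> Q] with the features of [B[x,y]] that survive
   completion: [xev] sets [x = y = 0], [xdx] and [xdy] divide the part
   divisible by the variable and kill the rest, [xpx] and [xpy] are the
   partial derivatives. *)
Record xalg (B Q : comPzRingType) := XAlg {
  xc : {rmorphism B -> Q};
  xx : Q;
  xy : Q;
  xev : {rmorphism Q -> B};
  xdx : {additive Q -> Q};
  xdy : {additive Q -> Q};
  xpx : {additive Q -> Q};
  xpy : {additive Q -> Q};
  xev_c : forall r, xev (xc r) = r;
  xev_x : xev xx = 0;
  xev_y : xev xy = 0;
  xdxc : forall q r, xdx (q * xc r) = xdx q * xc r;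
  xdyc : forall q r, xdy (q * xc r) = xdy q * xc r;
  xdx_x : forall q, xdx (xx * q) = q;
  xdx_y : forall q, xdx (xy * q) = xy * xdx q;
  xdx_1 : xdx 1 = 0;
  xdy_x : forall q, xdy (xx * q) = xx * xdy q;
  xdy_y : forall q, xdy (xy * q) = q;
  xdy_1 : xdy 1 = 0;
  xdecomp : forall q, q = xc (xev q) + xx * xdx q + xy * xdy (q - xx * xdx q);
  xpxM : forall p q, xpx (p * q) = xpx p * q + p * xpx q;
  xpyM : forall p q, xpy (p * q) = xpy p * q + p * xpy q;
  xpxc : forall r, xpx (xc r) = 0;
  xpyc : forall r, xpy (xc r) = 0;
  xpx_x : xpx xx = 1;
  xpx_y : xpx xy = 0;
  xpy_x : xpy xx = 0;
  xpy_y : xpy xy = 1 }.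

Section XMod.
Variables (B Q : comPzRingType) (A : xalg B Q).
Local Notation c := (xc A).
Local Notation x := (xx A).
Local Notation y := (xy A).

(* The modules extended from [B] to [Q] by the same constructions. *)
Record xmod := XMod {
  xm : lmodType Q;
  xb : lmodType B;
  xi : {additive xb -> xm};
  xe : {additive xm -> xb};
  mdx : {additive xm -> xm};
  mdy : {additive xm -> xm};
  mpx : {additive xm -> xm};
  mpy : {additive xm -> xm};
  xiZ : semilinear c xi;
  xeZ : forall q m, xe (q *: m) = xev A q *: xe m;
  xei : forall t, xe (xi t) = t;
  mdxc : forall r m, mdx (c r *: m) = c r *: mdx m;
  mdyc : forall r m, mdy (c r *: m) = c r *: mdy m;
  mdx_x : forall m, mdx (x *: m) = m;
  mdx_y : forall m, mdx (y *: m) = y *: mdx m;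
  mdx_i : forall t, mdx (xi t) = 0;
  mdy_x : forall m, mdy (x *: m) = x *: mdy m;
  mdy_y : forall m, mdy (y *: m) = m;
  mdy_i : forall t, mdy (xi t) = 0;
  mdecomp : forall m, m = xi (xe m) + x *: mdx m + y *: mdy (m - x *: mdx m);
  mpxZ : forall q m, mpx (q *: m) = xpx A q *: m + q *: mpx m;
  mpyZ : forall q m, mpy (q *: m) = xpy A q *: m + q *: mpy m;
  xext : forall (N : lmodType Q) (g : {additive xb -> N}), semilinear c g ->
    exists f : {linear xm -> N}, forall t, f (xi t) = g t;
  xuniq : forall (N : lmodType Q) (f g : {linear xm -> N}),
    (forall t, f (xi t) = g (xi t)) -> f =1 g }.

Section TensXMod.
Variable V : lmodType B.
Local Notation T := (tens c V).

Lemma tev_balanced : balanced c (fun q (v : V) => xev A q *: v).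
Proof.
split=> [v a b|q u v|q r v]; first by rewrite raddfB scalerBl.
  by rewrite scalerBr.
by rewrite rmorphM xev_c scalerA.
Qed.

Definition tev : {additive T -> V} := tlift tev_balanced.

Lemma tev_in q v : tev (tin c q v) = xev A q *: v.
Proof. exact: tlift_in. Qed.

Lemma xpxcM q r : xpx A (q * c r) = xpx A q * c r.
Proof. by rewrite xpxM xpxc mulr0 addr0. Qed.
Lemma xpycM q r : xpy A (q * c r) = xpy A q * c r.
Proof. by rewrite xpyM xpyc mulr0 addr0. Qed.

Local Notation tdx := (top (xdxc A) : {additive T -> T}).
Local Notation tdy := (top (xdyc A) : {additive T -> T}).
Local Notation tpx := (top xpxcM : {additive T -> T}).
Local Notation tpy := (top xpycM : {additive T -> T}).

Lemma tinD q q' (v : V) : tin c (q + q') v = tin c q v + tin c q' v.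
Proof. by rewrite [LHS]tinE scalerDl -!tinE. Qed.

Lemma tev_scale q m : tev (q *: m) = xev A q *: tev m.
Proof.
elim/tens_span: m => [|q' v m IH]; first by rewrite !(scaler0, raddf0).
rewrite scalerDr !(raddfD tev) scalerDr IH; congr (_ + _).
by rewrite pgenZ -/(tin c (q * q') v) -/(tin c q' v) !tev_in rmorphM scalerA.
Qed.

Lemma top_scale (S : {additive Q -> Q}) SZ a b :
  (forall q, S (a * q) = b * S q) ->
  forall m : T, @top _ _ _ c c V S SZ (a *: m) = b *: top SZ m.
Proof.
move=> h; elim/tens_span => [|q v m IH]; first by rewrite !(scaler0, raddf0).
rewrite ?scalerDr !(raddfD (top SZ)) ?scalerDr IH; congr (_ + _).
rewrite pgenZ -/(tin c (a * q) v) -/(tin c q v) !top_in h.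
by rewrite [LHS]tinE -scalerA -tinE.
Qed.

Lemma top_id (S : {additive Q -> Q}) SZ a :
  (forall q, S (a * q) = q) -> forall m : T, @top _ _ _ c c V S SZ (a *: m) = m.
Proof.
move=> h; elim/tens_span => [|q v m IH]; first by rewrite !(scaler0, raddf0).
rewrite ?scalerDr !(raddfD (top SZ)) ?scalerDr IH; congr (_ + _).
by rewrite pgenZ -/(tin c (a * q) v) -/(tin c q v) !top_in h.
Qed.

Lemma top_i (S : {additive Q -> Q}) SZ : S 1 = 0 ->
  forall t : V, @top _ _ _ c c V S SZ (ti c t) = 0.
Proof. by move=> h t; rewrite tiE top_in h tinE scale0r. Qed.

Lemma top_deriv (S : {additive Q -> Q}) SZ :
  (forall p q, S (p * q) = S p * q + p * S q) ->
  forall q (m : T), @top _ _ _ c c V S SZ (q *: m) = S q *: m + q *: top SZ m.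
Proof.
move=> h q; elim/tens_span => [|q' v m IH].
  by rewrite !(scaler0, raddf0) addr0.
rewrite !scalerDr !(raddfD (top SZ)) scalerDr IH addrACA; congr (_ + _).
rewrite pgenZ -/(tin c (q * q') v) -/(tin c q' v) !top_in h tinD.
by rewrite !(tinE c (_ * _)) -!scalerA -!tinE.
Qed.

Lemma tmdecomp (m : T) :
  m = ti c (tev m) + x *: tdx m + y *: tdy (m - x *: tdx m).
Proof.
pose G1 : {additive T -> T} := ti c \o tev.
pose G2 : {additive T -> T} := *:%R x \o tdx.
pose G3 : {additive T -> T} := *:%R y \o (tdy \o (idfun \- G2)).
move: m; apply: (tens_ext (f := idfun) (g := G1 \+ G2 \+ G3)) => q v.
rewrite -[RHS]/(ti c (tev (tin c q v)) + x *: tdx (tin c q v)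
  + y *: tdy (tin c q v - x *: tdx (tin c q v))) tev_in tiE -tin_balanced.
rewrite mul1r !top_in pgenZ -/(tin c (x * _) v) -[- tin _ _ _]scaleN1r.
rewrite pgenZ -/(tin c (-1 * _) v) -tinD mulN1r top_in pgenZ.
by rewrite -/(tin c (y * _) v) -!tinD -xdecomp.
Qed.

Definition tens_xmod : xmod.
Proof.
refine (@XMod T V (ti c) tev tdx tdy tpx tpy (@tiZ _ _ c V) tev_scale _
  _ _ _ _ _ _ _ _ tmdecomp _ _ _ _).
- by move=> t; rewrite tiE tev_in rmorph1 scale1r.
- by move=> r m; apply: top_scale => q; rewrite mulrC xdxc mulrC.
- by move=> r m; apply: top_scale => q; rewrite mulrC xdyc mulrC.
- by move=> m; apply: top_id; exact: xdx_x.
- by move=> m; apply: top_scale; exact: xdx_y.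
- by apply: top_i; exact: xdx_1.
- by move=> m; apply: top_scale; exact: xdy_x.
- by move=> m; apply: top_id; exact: xdy_y.
- by apply: top_i; exact: xdy_1.
- by apply: top_deriv; exact: xpxM.
- by apply: top_deriv; exact: xpyM.
- by move=> N g gZ; have [f fE] := tens_extend gZ; exists f.
- by move=> N f g; exact: tens_lext.
Defined.

End TensXMod.

Section ProdXMod.
Variables M N : xmod.

Definition pair_fun (U1 U2 W1 W2 : Type) (f : U1 -> W1) (g : U2 -> W2)
  (p : U1 * U2) := (f p.1, g p.2).

Lemma pair_additive (U1 U2 W1 W2 : zmodType) (f : {additive U1 -> W1})
  (g : {additive U2 -> W2}) : zmod_morphism (pair_fun f g).
Proof. by move=> [a b] [a' b']; rewrite /pair_fun /= !raddfB. Qed.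

Definition pair_add (U1 U2 W1 W2 : zmodType) (f : {additive U1 -> W1})
  (g : {additive U2 -> W2}) : {additive (U1 * U2)%type -> (W1 * W2)%type} :=
  mk_additive (pair_additive f g).

Definition prod_xmod : xmod.
Proof.
refine (@XMod (xm M * xm N)%type (xb M * xb N)%type
  (pair_add (xi M) (xi N)) (pair_add (xe M) (xe N))
  (pair_add (mdx M) (mdx N)) (pair_add (mdy M) (mdy N))
  (pair_add (mpx M) (mpx N)) (pair_add (mpy M) (mpy N))
  _ _ _ _ _ _ _ _ _ _ _ _ _ _ _ _).
- by move=> r [u v]; congr pair; apply: xiZ.
- by move=> q [u v]; congr pair; apply: xeZ.
- by move=> [u v]; congr pair; apply: xei.
- by move=> r [u v]; congr pair; apply: mdxc.
- by move=> r [u v]; congr pair; apply: mdyc.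
- by move=> [u v]; congr pair; apply: mdx_x.
- by move=> [u v]; congr pair; apply: mdx_y.
- by move=> [u v]; congr pair; apply: mdx_i.
- by move=> [u v]; congr pair; apply: mdy_x.
- by move=> [u v]; congr pair; apply: mdy_y.
- by move=> [u v]; congr pair; apply: mdy_i.
- by move=> [u v]; congr pair; apply: mdecomp.
- by move=> q [u v]; congr pair; apply: mpxZ.
- by move=> q [u v]; congr pair; apply: mpyZ.
- move=> L g gZ.
  have g1B : zmod_morphism (fun u : xb M => g (u, 0)).
    by move=> a b; rewrite -raddfB; congr (g (_, _)); rewrite subr0.
  have g2B : zmod_morphism (fun v : xb N => g (0, v)).
    by move=> a b; rewrite -raddfB; congr (g (_, _)); rewrite subr0.
  have [r a|f1 f1E] := @xext M L (mk_additive g1B).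
    by rewrite -[RHS]gZ; congr (g (_, _)); rewrite scaler0.
  have [r a|f2 f2E] := @xext N L (mk_additive g2B).
    by rewrite -[RHS]gZ; congr (g (_, _)); rewrite scaler0.
  have fL : linear (fun p : xm M * xm N => f1 p.1 + f2 p.2).
    by move=> a p q; rewrite /= !linearP scalerDr addrACA.
  exists (mk_linear fL) => -[u v].
  rewrite -[LHS]/(f1 (xi M u) + f2 (xi N v)) f1E f2E.
  rewrite -[LHS]/(g (u, 0) + g (0, v)) -raddfD; congr (g (_, _)).
    by rewrite addr0.
  by rewrite add0r.
- move=> L f g e.
  have f1L (h : {linear (xm M * xm N)%type -> L}) : linear (fun u => h (u, 0)).
    move=> a u v; rewrite -linearP; congr (h _).
    by congr pair; rewrite /= scaler0 addr0.
  have f2L (h : {linear (xm M * xm N)%type -> L}) : linear (fun u => h (0, u)).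
    move=> a u v; rewrite -linearP; congr (h _).
    by congr pair; rewrite /= scaler0 addr0.
  have e1 := @xuniq M L (mk_linear (f1L f)) (mk_linear (f1L g)).
  have e2 := @xuniq N L (mk_linear (f2L f)) (mk_linear (f2L g)).
  move=> [u v]; have -> : (u, v) = (u, 0) + (0, v).
    by congr pair; rewrite ?addr0 ?add0r.
  rewrite !raddfD; congr (_ + _).
    by apply: e1 => t; have := e (t, 0); rewrite /= /pair_fun /= raddf0.
  by apply: e2 => t; have := e (0, t); rewrite /= /pair_fun /= raddf0.
Defined.

End ProdXMod.

Section TwistXMod.
Variables (M : xmod) (P : lmodType B).
Variables (s : {linear P -> xb M}) (s' : {linear xb M -> P}).
Variables (sK : cancel s s') (s'K : cancel s' s).

(** Relabels the base only. It serves for a stabilization, whose components each mix [X^0] and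
    [X^1], whereas the natural base consists of the two copies [X] and [X e]. *)
Definition twist_xmod : xmod.
Proof.
refine (@XMod (xm M) P (xi M \o s) (s' \o xe M) (mdx M) (mdy M) (mpx M) (mpy M)
  _ _ _ (@mdxc M) (@mdyc M) (@mdx_x M) (@mdx_y M) _ (@mdy_x M) (@mdy_y M)
  _ _ (@mpxZ M) (@mpyZ M) _ _).
- by move=> r t; rewrite /= linearZ_LR xiZ.
- by move=> q m; rewrite /= xeZ linearZ_LR.
- by move=> t; rewrite /= xei sK.
- by move=> t; rewrite /= mdx_i.
- by move=> t; rewrite /= mdy_i.
- by move=> m; rewrite /= s'K -mdecomp.
- move=> L g gZ; have [r t|f fE] := @xext M L (g \o s').
    by rewrite /= linearZ_LR gZ.
  by exists f => t; rewrite /= fE /= sK.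
- move=> L f g e; apply: xuniq => t.
  by have := e (s' t); rewrite /= s'K.
Defined.

End TwistXMod.

Section XModTheory.
Variable M : xmod.
Local Notation i := (xi M).
Local Notation e := (xe M).
Local Notation dx := (mdx M).
Local Notation dy := (mdy M).

Lemma x_inj m m' : x *: m = x *: m' :> xm M -> m = m'.
Proof. by move=> h; rewrite -[m]mdx_x h mdx_x. Qed.
Lemma y_inj m m' : y *: m = y *: m' :> xm M -> m = m'.
Proof. by move=> h; rewrite -[m]mdy_y h mdy_y. Qed.
Lemma e_x m : e (x *: m) = 0. Proof. by rewrite xeZ xev_x scale0r. Qed.
Lemma e_y m : e (y *: m) = 0. Proof. by rewrite xeZ xev_y scale0r. Qed.

(** Reduction modulo [x], realized inside the module itself as the projection onto the kernel of
    [dx]. *)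
Definition mex (m : xm M) : xm M := m - x *: dx m.

Lemma mexB : zmod_morphism mex.
Proof.
move=> a b; rewrite /mex raddfB scalerBr [in LHS]opprD opprK addrACA.
by congr (_ + _); rewrite opprB addrC.
Qed.
Definition ex : {additive xm M -> xm M} := mk_additive mexB.

Lemma exE m : ex m = m - x *: dx m. Proof. by []. Qed.
Lemma dx_ex m : dx (ex m) = 0.
Proof. by rewrite exE raddfB mdx_x subrr. Qed.
Lemma ex_x m : ex (x *: m) = 0.
Proof. by rewrite exE mdx_x subrr. Qed.
Lemma ex_y m : ex (y *: m) = y *: ex m.
Proof. by rewrite !exE mdx_y scalerBr !scalerA mulrC. Qed.
Lemma ex_c r m : ex (c r *: m) = c r *: ex m.
Proof. by rewrite !exE mdxc scalerBr !scalerA mulrC. Qed.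
Lemma ex_i t : ex (i t) = i t.
Proof. by rewrite exE mdx_i scaler0 subr0. Qed.
Lemma ex_ex m : ex (ex m) = ex m.
Proof. by rewrite exE dx_ex scaler0 subr0. Qed.
Lemma e_ex m : e (ex m) = e m.
Proof. by rewrite exE raddfB e_x subr0. Qed.
Lemma ex_decomp m : ex m = i (e m) + y *: dy (ex m).
Proof. by rewrite {1}exE {1}[m]mdecomp -exE addrAC addrK. Qed.
Lemma dx_dy_ex m : dx (dy (ex m)) = 0.
Proof.
apply: y_inj; rewrite -mdx_y scaler0.
have -> : y *: dy (ex m) = ex m - i (e m) by rewrite {2}ex_decomp addrAC subrr add0r.
by rewrite raddfB dx_ex mdx_i subrr.
Qed.
Lemma ex_dy_ex m : ex (dy (ex m)) = dy (ex m).
Proof. by rewrite exE dx_dy_ex scaler0 subr0. Qed.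

(** Regularity of the sequence [x, y]. Dividing [x u = - y v] by [y] gives [x dy u = - v], because
    [dy] commutes with [x]; multiplying by [y] and cancelling [x] ends the argument. *)
Lemma xy_regular (u v : xm M) : x *: u + y *: v = 0 -> u = y *: dy u.
Proof.
move=> h; have : x *: dy u = - v.
  rewrite -mdy_x; have -> : x *: u = - (y *: v) by apply/eqP; rewrite -addr_eq0 h.
  by rewrite raddfN mdy_y.
move=> h'; apply: x_inj; rewrite scalerA mulrC -scalerA h' scalerN.
by apply/eqP; rewrite -addr_eq0 h.
Qed.

End XModTheory.
End XMod.

(** * A decision procedure for equalities of abelian groups *)

Inductive zexp := ZVar of nat | ZAdd of zexp & zexp | ZOpp of zexp | ZZero.

Section ZExp.
Variables (M : zmodType) (env : seq M).

Fixpoint zeval (e : zexp) : M :=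
  match e with
  | ZVar n => nth 0 env n
  | ZAdd a b => zeval a + zeval b
  | ZOpp a => - zeval a
  | ZZero => 0
  end.

(** Positive and negative occurrences are counted apart in [nat]; two expressions then agree when
    the cross sums of these counts agree, which is checked by computation. *)
Fixpoint zcoef (pos : bool) (e : zexp) (n : nat) : nat :=
  match e with
  | ZVar m => (pos && (m == n)) : nat
  | ZAdd a b => (zcoef pos a n + zcoef pos b n)%N
  | ZOpp a => zcoef (~~ pos) a n
  | ZZero => 0
  end.

Fixpoint zbound (N : nat) (e : zexp) : bool :=
  match e with
  | ZVar m => m < N
  | ZAdd a b => zbound N a && zbound N b
  | ZOpp a => zbound N a
  | ZZero => true
  end%N.

Lemma zevalE N e : zbound N e ->
  zeval e = \sum_(n < N) (env`_n *+ zcoef true e n - env`_n *+ zcoef false e n).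
Proof.
elim: e => [m|a IHa b IHb|a IHa|] /=.
- move=> mN; rewrite (bigD1 (Ordinal mN)) //= eqxx mulr1n mulr0n subr0.
  rewrite big1 ?addr0 // => i; rewrite -val_eqE /= eq_sym => /negbTE ->.
  by rewrite mulr0n subr0.
- move=> /andP[/IHa -> /IHb ->]; rewrite -big_split; apply: eq_bigr => n _ /=.
  by rewrite !mulrnDr opprD addrACA.
- by move=> /IHa ->; rewrite -sumrN; apply: eq_bigr => n _; rewrite opprB.
- by move=> _; rewrite big1 // => n _; rewrite subr0.
Qed.

Lemma zeval_eq N e1 e2 :
  [&& zbound N e1, zbound N e2 & all (fun n => zcoef true e1 n + zcoef false e2 n
     == zcoef true e2 n + zcoef false e1 n)%N (iota 0 N)] ->
  zeval e1 = zeval e2.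
Proof.
move=> /and3P[b1 b2 /allP h]; rewrite (zevalE b1) (zevalE b2).
apply: eq_bigr => n _; have /h/eqP e : val n \in iota 0 N.
  by rewrite mem_iota /= add0n ltn_ord.
apply/eqP; rewrite subr_eq addrAC eq_sym subr_eq -!mulrnDr; apply/eqP.
by rewrite e.
Qed.

End ZExp.

Ltac zsame b t h :=
  lazymatch b with true => constr_eq t h | false => unify t h end.
Ltac zlookup b t env :=
  match env with
  | nil => fail
  | cons ?h ?r => match constr:(Set) with
    | _ => let _ := match constr:(Set) with _ => zsame b t h end in constr:(0%N)
    | _ => let n := zlookup b t r in constr:(S n)
    end
  end.
Ltac zsnoc t env :=
  match env with
  | nil => constr:(cons t nil)
  | cons ?h ?r => let r' := zsnoc t r in constr:(cons h r')
  end.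
Ltac zpush b t env :=
  match constr:(Set) with
  | _ => let _ := zlookup b t env in env
  | _ => let r := zsnoc t env in r
  end.
Ltac zatoms b t env :=
  lazymatch t with
  | (?a + ?c)%R => let env1 := zatoms b a env in zatoms b c env1
  | (- ?a)%R => zatoms b a env
  | 0%R => env
  | _ => zpush b t env
  end.
Ltac zreify b t env :=
  lazymatch t with
  | (?a + ?c)%R => let a' := zreify b a env in let c' := zreify b c env in
      constr:(ZAdd a' c')
  | (- ?a)%R => let a' := zreify b a env in constr:(ZOpp a')
  | 0%R => constr:(ZZero)
  | _ => let n := zlookup b t env in constr:(ZVar n)
  end.
Ltac zlength env :=
  lazymatch env with
  | nil => constr:(0%N)
  | cons _ ?r => let n := zlength r in constr:(S n)
  end.
Ltac abel_up_to b :=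
  lazymatch goal with
  | |- @eq ?T ?l ?r =>
    let env0 := zatoms b l (@nil T) in
    let env := zatoms b r env0 in
    let l' := zreify b l env in
    let r' := zreify b r env in
    let N := zlength env in
    apply: (@zeval_eq _ env N l' r'); reflexivity
  end.
(* Atoms are first compared syntactically, then up to conversion. *)
Ltac abel := first [abel_up_to true | abel_up_to false].

(** * Stabilization of a matrix factorization by xy *)

Lemma prod_projective (B : comPzRingType) (V W : lmodType B) :
  projective V -> projective W -> projective (V * W)%type.
Proof.
move=> pV pW M N p f ps.
have f1L : linear (fun u : V => f (u, 0)).
  move=> a u v; rewrite -linearP; congr (f _).
  by congr pair; rewrite /= scaler0 addr0.
have f2L : linear (fun u : W => f (0, u)).
  move=> a u v; rewrite -linearP; congr (f _).
  by congr pair; rewrite /= scaler0 addr0.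
have [g1 g1E] := pV M N p (mk_linear f1L) ps.
have [g2 g2E] := pW M N p (mk_linear f2L) ps.
have gL : linear (fun u : V * W => g1 u.1 + g2 u.2).
  by move=> a u v; rewrite /= !linearP scalerDr addrACA.
exists (mk_linear gL) => -[u v].
rewrite -[LHS]/(p (g1 u + g2 v)) linearD.
have -> : p (g1 u) = f (u, 0) by exact: g1E.
have -> : p (g2 v) = f (0, v) by exact: g2E.
rewrite -linearD; congr (f _).
by congr pair; rewrite /= ?addr0 ?add0r.
Qed.

Section Parts.
Variables (k : fieldType) (Q : comPzRingType) (rho : {rmorphism k -> Q}).
Variable v : Q.
Local Notation mfact := (mfact v).

Definition mf_sg_fun (X : mfact) (p : mf_tot X) : mf_tot X := (p.1, - p.2).
Lemma mf_sg_linear X : linear (@mf_sg_fun X).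
Proof.
by move=> a [p1 p2] [q1 q2]; congr pair; rewrite /= opprD scalerN.
Qed.
Definition mf_sg X : {linear mf_tot X -> mf_tot X} := mk_linear (@mf_sg_linear X).

Lemma mf_sgE X p : mf_sg X p = mf_pr X false p - mf_pr X true p.
Proof. by case: p => a b; congr pair; rewrite /= ?subr0 ?sub0r. Qed.
Lemma mf_sgK X p : mf_sg X (mf_sg X p) = p.
Proof. by case: p => a b; congr pair; rewrite /= ?opprK. Qed.
Lemma mf_d_sg X p : mf_d X (mf_sg X p) = - mf_sg X (mf_d X p).
Proof. by case: p => a b; congr pair; rewrite /= ?opprK ?raddfN. Qed.

Lemma mf_part_sg (X Y : mfact) (f : mf_hom rho X Y) p :
  mf_part false f p - mf_part true f p = mf_sg Y (f (mf_sg X p)).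
Proof.
rewrite !mf_partE [mf_sg X p]mf_sgE (linearB f) (mf_sgE (f _ - _)).
rewrite !(linearB (mf_pr Y _)). rewrite -[~~ false]/true -[~~ true]/false; abel.
Qed.

(** Conjugating by the grading involution multiplies a homogeneous [f] by [(-1)^|f|]. This gives one
    formula for the differential of all maps, with no splitting by parity. *)
Lemma mf_dhom_sg (X Y : mfact) (f : mf_hom rho X Y) p :
  mf_dhom f p = mf_d Y (f p) - mf_sg Y (f (mf_sg X (mf_d X p))).
Proof. by rewrite mf_dhomE -mf_part_sg; abel. Qed.

(** Locked so that the component counts as one map to be extended by [tmap], not as a sum of
    blocks. *)
Definition mf_comp_lin (X Y : mfact) (i : bool) (f : mf_hom rho X Y) :
  {linear mf_tot X -> mf_tot Y} := locked (mf_part i f).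

Lemma mf_comp_linE (X Y : mfact) i (f : mf_hom rho X Y) :
  mf_comp_lin i f = mf_part i f.
Proof. by rewrite /mf_comp_lin -lock. Qed.

End Parts.

Section Stabilization.
Variables (k : fieldType) (B Q : comPzRingType) (A : xalg B Q).
Variables (rho : {rmorphism k -> B}) (rhoQ : {rmorphism k -> Q}).
Hypothesis rhoQE : forall a, rhoQ a = xc A (rho a).
Variables (w : B) (v : Q).
Hypothesis vE : v = xc A w + xx A * xy A.
Local Notation c := (xc A).
Local Notation x := (xx A).
Local Notation y := (xy A).

Section Object.
Variable X : mfact w.
Local Notation T := (mf_tot X).
Local Notation FT := (tens c T).
Local Notation tp i := (tmap c (mf_pr X i)).
Local Notation tD := (tmap c (mf_d X)).

Lemma tp_idem i j (u : FT) : tp i (tp j u) = if i == j then tp j u else 0.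
Proof.
rewrite tmap_comp; case: eqP => [->|ij].
  by apply: tmap_ext => t; exact: mf_pr_id.
rewrite -[RHS](tmap0 T u); apply: tmap_ext => t.
by rewrite -[LHS]/(mf_pr X i (mf_pr X j t)) mf_pr_idem; case: eqP ij.
Qed.
Lemma tp_sum (u : FT) : tp false u + tp true u = u.
Proof.
rewrite -tmapD -[RHS]tmap_id; apply: tmap_ext => t.
exact: mf_pr_sum.
Qed.
Lemma tD_p i (u : FT) : tD (tp i u) = tp (~~ i) (tD u).
Proof. by rewrite !tmap_comp; apply: tmap_ext => t; exact: mf_d_pr. Qed.
Lemma tDD (u : FT) : tD (tD u) = c w *: u.
Proof.
rewrite tmap_comp -[u in RHS]tmap_id -tmapZ; apply: tmap_ext => t.
exact: mf_dd.
Qed.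

(* With [FT = Q (x) (X^0 + X^1)], the even part of [FX] is [X^0 + X^1 e] and
   the odd part is [X^1 + X^0 e] for an odd generator [e]; the differential is
   [d t = D t + (-1)^|t| y t e] and [d (t e) = D t e + (-1)^|t| x t]. *)
Definition st_d01 : {linear FT -> FT} :=
  (tD \- x \*: tp true) \+ y \*: tp false.
Definition st_d10 : {linear FT -> FT} :=
  (tD \+ x \*: tp false) \- y \*: tp true.

Lemma st_d01E u : st_d01 u = tD u - x *: tp true u + y *: tp false u.
Proof. by []. Qed.
Lemma st_d10E u : st_d10 u = tD u + x *: tp false u - y *: tp true u.
Proof. by []. Qed.

Lemma v_scale (m : FT) : v *: m = c w *: m + x *: (y *: tp false m)
   + x *: (y *: tp true m).
Proof. by rewrite vE scalerDl -scalerA -{2}(tp_sum m) !scalerDr addrA. Qed.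

Lemma st_d2_0 u : st_d10 (st_d01 u) = v *: u.
Proof.
have eD : tD (st_d01 u)
    = c w *: u - x *: tp false (tD u) + y *: tp true (tD u).
  by rewrite st_d01E (linearD tD) (linearB tD) !(linearZ_LR tD) tDD !tD_p.
have e0 : tp false (st_d01 u) = tp false (tD u) + y *: tp false u.
  by rewrite st_d01E (linearD (tp false)) (linearB (tp false)) !(linearZ_LR (tp false)) !tp_idem /= scaler0 subr0.
have e1 : tp true (st_d01 u) = tp true (tD u) - x *: tp true u.
  by rewrite st_d01E (linearD (tp true)) (linearB (tp true)) !(linearZ_LR (tp true)) !tp_idem /= scaler0 addr0.
rewrite st_d10E eD e0 e1 v_scale scalerDr scalerBr [y *: (x *: _)]scalerA.
rewrite [y * x]mulrC -scalerA; abel.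
Qed.

Lemma st_d2_1 u : st_d01 (st_d10 u) = v *: u.
Proof.
have eD : tD (st_d10 u)
    = c w *: u + x *: tp true (tD u) - y *: tp false (tD u).
  by rewrite st_d10E (linearB tD) (linearD tD) !(linearZ_LR tD) tDD !tD_p.
have e0 : tp false (st_d10 u) = tp false (tD u) + x *: tp false u.
  by rewrite st_d10E (linearB (tp false)) (linearD (tp false)) !(linearZ_LR (tp false)) !tp_idem /= scaler0 subr0.
have e1 : tp true (st_d10 u) = tp true (tD u) - y *: tp true u.
  by rewrite st_d10E (linearB (tp true)) (linearD (tp true)) !(linearZ_LR (tp true)) !tp_idem /= scaler0 addr0.
rewrite st_d01E eD e0 e1 v_scale scalerBr scalerDr [y *: (x *: _)]scalerA.
rewrite [y * x]mulrC -scalerA; abel.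
Qed.

Lemma mf_tot_projective : projective T.
Proof. by apply: prod_projective; [exact: mf_proj0|exact: mf_proj1]. Qed.

Definition st_obj : mfact v :=
  MFact (tens_projective (c := c) mf_tot_projective)
    (tens_projective (c := c) mf_tot_projective) st_d2_0 st_d2_1.

End Object.

Section Morphism.
Variables X Y : mfact w.
Local Notation FX := (st_obj X).
Local Notation FY := (st_obj Y).
Local Notation cp i f := (tmap c (@mf_comp_lin k B rho w X Y i f)).

(** This is [f] tensored with the identity. The generator [e] stands on the right of [t], so
    [f (t e) = f t e] carries no sign; the odd component of [f] exchanges the even and odd parts. *)
Definition st_hom_fun (f : mf_hom rho X Y) (p : mf_tot FX) : mf_tot FY :=
  (cp false f p.1 + cp true f p.2, cp true f p.1 + cp false f p.2).

Lemma st_hom_fun_linear f : linear (st_hom_fun f).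
Proof.
move=> a p q; congr pair; rewrite /= !linearP /= scalerDr; abel.
Qed.

Definition st_hom (f : mf_hom rho X Y) : mf_hom rhoQ FX FY :=
  mk_linear (@st_hom_fun_linear f).

Lemma cp_linear i a f g (u : tens c (mf_tot X)) :
  cp i (a *: f + g) u = c (rho a) *: cp i f u + cp i g u.
Proof.
rewrite -tmapZ -tmapD; apply: tmap_ext => t.
rewrite -[RHS]/(rho a *: mf_comp_lin i f t + mf_comp_lin i g t) !mf_comp_linE.
by rewrite mf_part_linear.
Qed.

Lemma st_hom_linear : linear st_hom.
Proof.
move=> a f g; apply: linear_ext => p.
rewrite -[RHS]/(rhoQ a *: st_hom_fun f p + st_hom_fun g p) rhoQE.
have E i u := cp_linear i a f g u.
congr pair.
  rewrite -[LHS]/(cp false (a *: f + g) p.1 + cp true (a *: f + g) p.2).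
  rewrite -[RHS]/(c (rho a) *: (cp false f p.1 + cp true f p.2)
                  + (cp false g p.1 + cp true g p.2)).
  by rewrite (E false) (E true) scalerDr; abel.
rewrite -[LHS]/(cp true (a *: f + g) p.1 + cp false (a *: f + g) p.2).
rewrite -[RHS]/(c (rho a) *: (cp true f p.1 + cp false f p.2)
                + (cp true g p.1 + cp false g p.2)).
by rewrite (E false) (E true) scalerDr; abel.
Qed.

Definition st_hom_lin : {linear mf_hom rho X Y -> mf_hom rhoQ FX FY} :=
  HB.pack st_hom (GRing.isLinear.Build k (mf_hom rho X Y) (mf_hom rhoQ FX FY)
    *:%R _ st_hom_linear).

Lemma cp_part i j f (u : tens c (mf_tot X)) :
  cp i (mf_part j f) u = if i == j then cp i f u else 0.
Proof.
have := mf_part_idem i j f; case: eqP => [-> e|_ e].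
  by apply: tmap_ext => t; rewrite !mf_comp_linE e.
rewrite -[RHS](tmap0 (mf_tot Y) u); apply: tmap_ext => t.
by rewrite mf_comp_linE e.
Qed.

Lemma st_hom_part i f : st_hom (mf_part i f) = mf_part i (st_hom f).
Proof.
apply: linear_ext => -[u1 u2].
rewrite mf_partE -[LHS]/(st_hom_fun (mf_part i f) (u1, u2)).
have P j l u := cp_part j l f u.
have z j : cp j f 0 = 0 := linear0 _.
case: i; congr pair; rewrite (P false) (P true) /=.
- by rewrite -[RHS]/(0 + (cp false f 0 + cp true f u2)) z !add0r.
- by rewrite -[RHS]/((cp true f u1 + cp false f 0) + 0) z !addr0.
- by rewrite -[RHS]/((cp false f u1 + cp true f 0) + 0) z !addr0.
by rewrite -[RHS]/(0 + (cp true f 0 + cp false f u2)) z !add0r.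
Qed.

Lemma cp_sg i f (u : tens c (mf_tot X)) j :
  cp i f (tmap c (mf_pr X j) u) = tmap c (mf_pr Y (i (+) j)) (cp i f u).
Proof.
rewrite !tmap_comp; apply: tmap_ext => t.
rewrite -[LHS]/(mf_comp_lin i f (mf_pr X j t)).
rewrite -[RHS]/(mf_pr Y (i (+) j) (mf_comp_lin i f t)) !mf_comp_linE.
rewrite mf_part_pr mf_partE (linearD (mf_pr Y _)) !mf_pr_idem.
by case: i; case: j => /=; rewrite ?addr0 ?add0r.
Qed.

Lemma cp_d i f (u : tens c (mf_tot X)) :
  cp (~~ i) (mf_dhom f) u = tmap c (mf_d Y) (cp i f u)
     - (-1) ^+ i *: cp i f (tmap c (mf_d X) u).
Proof.
have e : mf_part i (mf_part i f) = mf_part i f by rewrite mf_part_idem eqxx.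
rewrite !tmap_comp -[(-1) ^+ i](rmorph_sign c) -tmapZ -tmapN -tmapD.
apply: tmap_ext => t; rewrite mf_comp_linE -mf_dhom_part (mf_dhom_homog _ e).
by rewrite -(mf_comp_linE i f).
Qed.

Lemma cp_d10 f (u : tens c (mf_tot X)) :
  st_d10 Y (cp false f u) - cp false f (st_d10 X u) = cp true (mf_dhom f) u.
Proof.
have h := cp_sg false f u; set G := cp false f in h *.
have -> : G (st_d10 X u)
    = G (tmap c (mf_d X) u) + x *: tmap c (mf_pr Y false) (G u)
      - y *: tmap c (mf_pr Y true) (G u).
  by rewrite st_d10E (linearB G) (linearD G) !(linearZ_LR G) !h.
by rewrite (cp_d false f u) scale1r -/G st_d10E; abel.
Qed.

Lemma cp_d01 f (u : tens c (mf_tot X)) :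
  st_d01 Y (cp false f u) - cp false f (st_d01 X u) = cp true (mf_dhom f) u.
Proof.
have h := cp_sg false f u; set G := cp false f in h *.
have -> : G (st_d01 X u)
    = G (tmap c (mf_d X) u) - x *: tmap c (mf_pr Y true) (G u)
      + y *: tmap c (mf_pr Y false) (G u).
  by rewrite st_d01E (linearD G) (linearB G) !(linearZ_LR G) !h.
by rewrite (cp_d false f u) scale1r -/G st_d01E; abel.
Qed.

(** An odd component exchanges the projections [tp false] and [tp true]. Under this exchange the [x]
    and [y] terms of [st_d01] become the negatives of those of [st_d10], so they cancel. *)
Lemma cp_d10_odd f (u : tens c (mf_tot X)) :
  st_d10 Y (cp true f u) + cp true f (st_d01 X u) = cp false (mf_dhom f) u.
Proof.
have h := cp_sg true f u; set G := cp true f in h *.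
have -> : G (st_d01 X u)
    = G (tmap c (mf_d X) u) - x *: tmap c (mf_pr Y false) (G u)
      + y *: tmap c (mf_pr Y true) (G u).
  by rewrite st_d01E (linearD G) (linearB G) !(linearZ_LR G) !h.
by rewrite (cp_d true f u) scaleN1r -/G st_d10E; abel.
Qed.

Lemma cp_d01_odd f (u : tens c (mf_tot X)) :
  st_d01 Y (cp true f u) + cp true f (st_d10 X u) = cp false (mf_dhom f) u.
Proof.
have h := cp_sg true f u; set G := cp true f in h *.
have -> : G (st_d10 X u)
    = G (tmap c (mf_d X) u) + x *: tmap c (mf_pr Y true) (G u)
      - y *: tmap c (mf_pr Y false) (G u).
  by rewrite st_d10E (linearB G) (linearD G) !(linearZ_LR G) !h.
by rewrite (cp_d true f u) scaleN1r -/G st_d01E; abel.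
Qed.

Lemma st_hom_d f : st_hom (mf_dhom f) = mf_dhom (st_hom f).
Proof.
apply: linear_ext => -[u1 u2].
rewrite mf_dhomE -!st_hom_part.
have P i j u := cp_part i j f u.
have d0 : mf_d FX (u1, u2) = (st_d10 X u2, st_d01 X u1) by [].
rewrite d0 -[LHS]/(st_hom_fun (mf_dhom f) (u1, u2)).
have -> : mf_d FY (st_hom f (u1, u2)) = (st_d10 Y (cp true f u1 + cp false f u2),
   st_d01 Y (cp false f u1 + cp true f u2)) by [].
have -> : st_hom (mf_part false f) (st_d10 X u2, st_d01 X u1)
   = (cp false f (st_d10 X u2), cp false f (st_d01 X u1)).
  by congr pair; rewrite (P false) (P true) /= ?addr0 ?add0r.
have -> : st_hom (mf_part true f) (st_d10 X u2, st_d01 X u1)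
   = (cp true f (st_d01 X u1), cp true f (st_d10 X u2)).
  by congr pair; rewrite (P false) (P true) /= ?addr0 ?add0r.
congr pair.
  rewrite -[RHS]/(st_d10 Y (cp true f u1 + cp false f u2)
     - cp false f (st_d10 X u2) + cp true f (st_d01 X u1)).
  by rewrite (linearD (st_d10 Y)) -cp_d10 -cp_d10_odd; abel.
rewrite -[RHS]/(st_d01 Y (cp false f u1 + cp true f u2)
   - cp false f (st_d01 X u1) + cp true f (st_d10 X u2)).
by rewrite (linearD (st_d01 Y)) -cp_d01 -cp_d01_odd; abel.
Qed.

End Morphism.

Lemma st_hom_id X : st_hom (mf_id rho X) = mf_id rhoQ (st_obj X).
Proof.
apply: linear_ext => -[u1 u2].
have h0 (u : tens c (mf_tot X)) : tmap c (mf_comp_lin false (mf_id rho X)) u = u.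
  rewrite -[RHS]tmap_id; apply: tmap_ext => t.
  by rewrite mf_comp_linE -[mf_part _ _]/(cx_part (mf_hom rho X X) false _) mf_id_even.
have h1 (u : tens c (mf_tot X)) : tmap c (mf_comp_lin true (mf_id rho X)) u = 0.
  rewrite -[RHS](tmap0 (mf_tot X) u); apply: tmap_ext => t.
  have e : mf_part true (mf_id rho X) = 0.
    by rewrite -[X in mf_part true X](mf_id_even rho X); exact: mf_part_idem.
  by rewrite mf_comp_linE e.
rewrite -[RHS]/(u1, u2) -[LHS]/(st_hom_fun (mf_id rho X) (u1, u2)).
by congr pair; rewrite /= !h0 !h1 ?addr0 ?add0r.
Qed.

Lemma cp_comp (X Y Z : mfact w) (g : mf_hom rho Y Z) (f : mf_hom rho X Y) i (u : tens c (mf_tot X)) :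
  tmap c (mf_comp_lin i (mf_comp g f)) u
  = tmap c (mf_comp_lin false g) (tmap c (mf_comp_lin i f) u)
  + tmap c (mf_comp_lin true g) (tmap c (mf_comp_lin (~~ i) f) u).
Proof.
rewrite !tmap_comp -tmapD; apply: tmap_ext => t.
rewrite -[RHS]/(mf_comp_lin false g (mf_comp_lin i f t)
   + mf_comp_lin true g (mf_comp_lin (~~ i) f t)) !mf_comp_linE.
suff -> : mf_part i (mf_comp g f) = mf_comp (mf_part false g) (mf_part i f)
   + mf_comp (mf_part true g) (mf_part (~~ i) f) :> mf_hom rho X Z by [].
apply: mf_hom_ext => j p; rewrite mf_part_pr.
rewrite -[RHS]/(mf_part false g (mf_part i f (mf_pr X j p))
   + mf_part true g (mf_part (~~ i) f (mf_pr X j p))).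
rewrite -[mf_comp g f _]/(g (f _)) !mf_part_pr addNb.
set r := f _; set l := i (+) j.
have -> : true (+) (~~ l) = l by case: (l).
have -> : false (+) l = l by [].
rewrite -(linearD (mf_pr Z l)) -(linearD g); congr (mf_pr Z l (g _)).
by case: (l); rewrite ?mf_pr_sum // addrC mf_pr_sum.
Qed.

Lemma st_hom_comp (X Y Z : mfact w) (g : mf_hom rho Y Z) (f : mf_hom rho X Y) :
  st_hom (mf_comp g f) = mf_comp (st_hom g) (st_hom f).
Proof.
apply: linear_ext => -[u1 u2].
rewrite -[RHS]/(st_hom_fun g (st_hom_fun f (u1, u2))).
rewrite -[LHS]/(st_hom_fun (mf_comp g f) (u1, u2)).
have E i u := cp_comp g f i u.
congr pair; rewrite /= (E false) (E true) /=.
  rewrite (linearD (tmap c (mf_comp_lin false g))).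
  by rewrite (linearD (tmap c (mf_comp_lin true g))); abel.
rewrite (linearD (tmap c (mf_comp_lin false g))).
by rewrite (linearD (tmap c (mf_comp_lin true g))); abel.
Qed.

Definition stabilization : dgfun (MFinf rho w) (MFinf rhoQ v) :=
  @DGFun k (MFinf rho w) (MFinf rhoQ v) st_obj st_hom_lin
    (fun X Y => @st_hom_part X Y) (@st_hom_d) st_hom_id st_hom_comp.

End Stabilization.

Arguments st_d10 : simpl never.
Arguments st_d01 : simpl never.
Arguments tmap : simpl never.

Section TensorOperators.
Variables (B Q : comPzRingType) (A : xalg B Q).
Variables (V W : lmodType B) (f : {linear V -> W}).
Local Notation MV := (tens_xmod A V).
Local Notation MW := (tens_xmod A W).

Lemma mdx_tmap (u : tens (xc A) V) : mdx MW (tmap (xc A) f u) = tmap (xc A) f (mdx MV u).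
Proof. exact: top_tmap. Qed.
Lemma xe_tmap (u : tens (xc A) V) : xe MW (tmap (xc A) f u) = f (xe MV u).
Proof.
move: u; apply: (tens_ext (f := xe MW \o tmap (xc A) f) (g := f \o xe MV)) => q v.
rewrite -[LHS]/(tev A W (tmap (xc A) f (tin (xc A) q v))) tmap_in tev_in.
by rewrite -[RHS]/(f (tev A V (tin (xc A) q v))) tev_in linearZ_LR.
Qed.
Lemma ex_tmap (u : tens (xc A) V) : ex MW (tmap (xc A) f u) = tmap (xc A) f (ex MV u).
Proof.
rewrite !exE mdx_tmap (linearB (tmap (xc A) f)) (linearZ_LR (tmap (xc A) f)).
by [].
Qed.

End TensorOperators.

(** * Full faithfulness of stabilization up to homotopy *)

Section FullyFaithful.
Variables (k : fieldType) (B Q : comPzRingType) (A : xalg B Q).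
Variables (rho : {rmorphism k -> B}) (rhoQ : {rmorphism k -> Q}).
Variables (w : B) (v : Q).
Hypothesis vE : v = xc A w + xx A * xy A.
Local Notation c := (xc A).
Local Notation x := (xx A).
Local Notation y := (xy A).
Local Notation st X := (st_obj vE X).

Section Slots.
Variable X : mfact w.
Local Notation T := (mf_tot X).
Local Notation FT := (tens c T).
Local Notation M := (tens_xmod A T).
Local Notation tp i := (tmap c (mf_pr X i)).
Local Notation tD := (tmap c (mf_d X)).
Local Notation tg := (tmap c (mf_sg X)).
Local Notation N := (mf_tot (st X)).
Local Notation dx := (mdx M).

Definition slot1_fun (u : FT) : N := (tp false u, tp true u).
Definition slote_fun (u : FT) : N := (tp true u, tp false u).
Lemma slot1_linear : linear slot1_fun.
Proof. by move=> a u u'; congr pair; rewrite linearP. Qed.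
Lemma slote_linear : linear slote_fun.
Proof. by move=> a u u'; congr pair; rewrite linearP. Qed.
(* the inclusions of [FT] and [FT e] *)
Definition slot1 : {linear FT -> N} := mk_linear slot1_linear.
Definition slote : {linear FT -> N} := mk_linear slote_linear.

Definition proj1_fun (n : N) : FT := tp false n.1 + tp true n.2.
Lemma proj1_linear : linear proj1_fun.
Proof. by move=> a n n'; rewrite /proj1_fun /= !linearP scalerDr; abel. Qed.
Definition proj1 : {linear N -> FT} := mk_linear proj1_linear.

Lemma slot1E u : slot1 u = (tp false u, tp true u). Proof. by []. Qed.
Lemma sloteE u : slote u = (tp true u, tp false u). Proof. by []. Qed.
Lemma proj1E n : proj1 n = tp false n.1 + tp true n.2. Proof. by []. Qed.

Lemma proj1P u1 u2 : proj1 (u1, u2) = tp false u1 + tp true u2.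
Proof. by []. Qed.

Lemma mf_d_st (u1 u2 : FT) : mf_d (st X) (u1, u2) = (st_d10 A X u2, st_d01 A X u1).
Proof. by []. Qed.

Lemma tpp i (u : FT) : tp i (tp i u) = tp i u.
Proof. by rewrite tp_idem eqxx. Qed.
Lemma tp0p1 (u : FT) : tp false (tp true u) = 0. Proof. by rewrite tp_idem. Qed.
Lemma tp1p0 (u : FT) : tp true (tp false u) = 0. Proof. by rewrite tp_idem. Qed.

Lemma tgE (u : FT) : tg u = tp false u - tp true u.
Proof.
rewrite -tmapN -tmapD; apply: tmap_ext => t; exact: mf_sgE.
Qed.

Lemma proj1_slot1 u : proj1 (slot1 u) = u.
Proof. by rewrite proj1E slot1E /= !tpp tp_sum. Qed.

Lemma slot_d1 u : mf_d (st X) (slot1 u) = slot1 (tD u) + y *: slote (tg u).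
Proof.
rewrite slot1E mf_d_st slot1E sloteE tgE !(linearB (tp _)) !tpp tp0p1 tp1p0.
rewrite -[RHS]/(tp false (tD u) + y *: (0 - tp true u),
  tp true (tD u) + y *: (tp false u - 0)) sub0r subr0.
rewrite st_d10E st_d01E tp0p1 tp1p0 !tpp scaler0 addr0 subr0 !tD_p.
by rewrite scalerN.
Qed.

Lemma slot_de u : mf_d (st X) (slote u) = slote (tD u) + x *: slot1 (tg u).
Proof.
rewrite sloteE mf_d_st slot1E sloteE tgE !(linearB (tp _)) !tpp tp0p1 tp1p0.
rewrite -[RHS]/(tp true (tD u) + x *: (tp false u - 0),
  tp false (tD u) + x *: (0 - tp true u)) sub0r subr0.
rewrite st_d10E st_d01E tp0p1 tp1p0 !tpp scaler0 addr0 subr0 !tD_p.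
by rewrite scalerN.
Qed.

Lemma slot_sg1 u : mf_sg (st X) (slot1 u) = slot1 (tg u).
Proof.
rewrite slot1E slot1E tgE !(linearB (tp _)) !tpp tp0p1 tp1p0 subr0 sub0r.
by [].
Qed.

Lemma slot_sge u : mf_sg (st X) (slote u) = - slote (tg u).
Proof.
rewrite sloteE sloteE tgE !(linearB (tp _)) !tpp tp0p1 tp1p0 subr0 sub0r.
by congr pair; rewrite /= opprK.
Qed.

Lemma proj1_d n : proj1 (mf_d (st X) n)
  = tD (proj1 n) + x *: (tp false n.2 - tp true n.1).
Proof.
case: n => u1 u2; rewrite mf_d_st !proj1P st_d10E st_d01E.
rewrite -[(u1, u2).1]/u1 -[(u1, u2).2]/u2.
rewrite (linearB (tp false)) (linearD (tp false)).
rewrite (linearD (tp true)) (linearB (tp true)).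
rewrite !(linearZ_LR (tp false)) !(linearZ_LR (tp true)) !tpp tp0p1 tp1p0.
rewrite (linearD tD) !tD_p /= !scaler0 scalerBr; abel.
Qed.

Lemma proj1_sg n : proj1 (mf_sg (st X) n) = tg (proj1 n).
Proof.
case: n => u1 u2; rewrite -[mf_sg _ _]/(u1, - u2) !proj1P tgE.
rewrite !(linearD (tp _)) !tpp tp0p1 tp1p0.
by rewrite linearN addr0 add0r.
Qed.

(** Kills [e], [x] and [y] at once. It is a chain map because the [e]-free part of [d (t e)] is
    divisible by [x]. *)
Definition ev1 (n : N) : T := xe M (proj1 n).
Lemma ev1D n n' : ev1 (n + n') = ev1 n + ev1 n'.
Proof. by rewrite /ev1 linearD raddfD. Qed.
Lemma ev1N n : ev1 (- n) = - ev1 n.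
Proof. by rewrite /ev1 linearN raddfN. Qed.
Lemma ev1Z q n : ev1 (q *: n) = xev A q *: ev1 n.
Proof. by rewrite /ev1 linearZ_LR xeZ. Qed.
Lemma ev1_d n : ev1 (mf_d (st X) n) = mf_d X (ev1 n).
Proof. by rewrite /ev1 proj1_d raddfD e_x addr0 xe_tmap. Qed.
Lemma ev1_sg n : ev1 (mf_sg (st X) n) = mf_sg X (ev1 n).
Proof. by rewrite /ev1 proj1_sg xe_tmap. Qed.
Lemma ev1_slot1 t : ev1 (slot1 (ti c t)) = t.
Proof. by rewrite /ev1 proj1_slot1 (@xei _ _ _ M). Qed.

(* a contraction of the kernel of [N -> X[y]], [x, e |-> 0] *)
Definition hx (n : N) : N := (- dx (tp true n.2), dx (tp false n.1)).

Lemma hxB : zmod_morphism hx.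
Proof.
move=> [a b] [a' b'].
rewrite -[LHS]/(- dx (tp true (b - b')), dx (tp false (a - a'))).
rewrite (linearB (tp true)) (linearB (tp false)).
by rewrite !(raddfB dx) (opprD (dx _)).
Qed.
Lemma hxD n n' : hx (n + n') = hx n + hx n'. Proof. exact: (raddfD (mk_additive hxB)). Qed.
Lemma hxN n : hx (- n) = - hx n. Proof. exact: (raddfN (mk_additive hxB)). Qed.
Lemma hx_c r n : hx (c r *: n) = c r *: hx n.
Proof.
case: n => a b.
rewrite -[LHS]/(- dx (tp true (c r *: b)), dx (tp false (c r *: a))).
by rewrite !(linearZ_LR (tp _)) !(@mdxc _ _ _ M) -scalerN.
Qed.
Lemma hx_y n : hx (y *: n) = y *: hx n.
Proof.
case: n => a b.
rewrite -[LHS]/(- dx (tp true (y *: b)), dx (tp false (y *: a))).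
by rewrite !(linearZ_LR (tp _)) !(@mdx_y _ _ _ M) -scalerN.
Qed.
Lemma hx_sg n : hx (mf_sg (st X) n) = - mf_sg (st X) (hx n).
Proof. case: n => a b; rewrite -[LHS]/(- dx (tp true (- b)), dx (tp false a)).
by rewrite (linearN (tp true)) (raddfN dx) -{1}[dx (tp false a)]opprK. Qed.

(** The term [x t] of [d (t e)], up to sign, is undone by dividing by [x] and attaching [e]. What
    survives is the projection onto the part free of both [x] and [e]. *)
Lemma hx_d n : mf_d (st X) (hx n) + hx (mf_d (st X) n)
  = n - slot1 (ex M (proj1 n)).
Proof.
case: n => u1 u2.
have hE a b : hx (a, b) = (- dx (tp true b), dx (tp false a)) by [].
rewrite hE !mf_d_st hE proj1P slot1E.
have cx i (u : FT) : tp i (dx u) = dx (tp i u) by rewrite mdx_tmap.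
have cD (u : FT) : tD (dx u) = dx (tD u) by rewrite mdx_tmap.
have cE i (u u' : FT) : tp i (ex M (u + u')) = ex M (tp i u) + ex M (tp i u').
  by rewrite -ex_tmap (linearD (tp i)) raddfD.
have l1 : tp true (st_d01 A X u1) = tD (tp false u1) - x *: tp true u1.
  rewrite st_d01E (linearD (tp true)) (linearB (tp true)) !(linearZ_LR (tp true)).
  by rewrite tpp tp1p0 scaler0 addr0 tD_p.
have l2 : tp false (st_d10 A X u2) = tD (tp true u2) + x *: tp false u2.
  rewrite st_d10E (linearB (tp false)) (linearD (tp false)) !(linearZ_LR (tp false)).
  by rewrite tpp tp0p1 scaler0 subr0 tD_p.
have m1 : st_d10 A X (dx (tp false u1))
    = dx (tD (tp false u1)) + x *: dx (tp false u1).
  by rewrite st_d10E !cx tpp tp1p0 raddf0 scaler0 subr0 cD.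
have m2 : st_d01 A X (dx (tp true u2))
    = dx (tD (tp true u2)) - x *: dx (tp true u2).
  by rewrite st_d01E !cx tpp tp0p1 raddf0 scaler0 addr0 cD.
rewrite l1 l2 (linearN (st_d01 A X)) m1 m2 !cE !tpp tp0p1 tp1p0.
rewrite !raddf0 addr0 add0r !exE (raddfB dx) (raddfD dx) !(@mdx_x _ _ _ M).
rewrite -[X in _ = (X, _) - _](tp_sum u1) -[X in _ = (_, X) - _](tp_sum u2).
rewrite -[LHS]/(_ + _, _ + _) -[RHS]/(_ + _ - _, _ + _ - _).
by congr pair; cbn [fst snd]; abel.
Qed.

(** Exchanges two ways of grouping four summands: by the copies [T] and [T e], or by the even and
    odd components of the stabilization. *)
Definition swap_slots_fun (t : T * T) : T * T :=
  (mf_pr X false t.1 + mf_pr X true t.2, mf_pr X true t.1 + mf_pr X false t.2).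
Lemma swap_slots_linear : linear swap_slots_fun.
Proof.
move=> a t t'; congr pair.
  rewrite -[LHS]/(mf_pr X false (a *: t.1 + t'.1) + mf_pr X true (a *: t.2 + t'.2)).
  by rewrite !linearP addrACA -scalerDr.
rewrite -[LHS]/(mf_pr X true (a *: t.1 + t'.1) + mf_pr X false (a *: t.2 + t'.2)).
by rewrite !linearP addrACA -scalerDr.
Qed.
Definition swap_slots : {linear (T * T)%type -> (T * T)%type} :=
  mk_linear swap_slots_linear.
Lemma swap_slotsK : involutive swap_slots.
Proof.
move=> [[a0 a1] [b0 b1]]; congr pair; congr pair.
all: by rewrite /= ?addr0 ?add0r.
Qed.

Definition st_xmod : xmod A :=
  @twist_xmod B Q A (prod_xmod M M) (T * T)%type swap_slots swap_slots
    swap_slotsK swap_slotsK.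

Lemma st_xiE t1 te : xi st_xmod (t1, te) = slot1 (ti c t1) + slote (ti c te) :> N.
Proof.
rewrite slot1E sloteE !tmap_i.
rewrite -[LHS]/(ti c (mf_pr X false t1 + mf_pr X true te),
  ti c (mf_pr X true t1 + mf_pr X false te)).
by rewrite !(raddfD (ti c)).
Qed.

Lemma st_ext (L : lmodType Q) (a b : {additive T -> L}) :
  semilinear c a -> semilinear c b ->
  exists f : {linear N -> L}, forall t,
    f (slot1 (ti c t)) = a t /\ f (slote (ti c t)) = b t.
Proof.
move=> aZ bZ.
have gB : zmod_morphism (fun t : T * T => a t.1 + b t.2).
  by move=> t t'; rewrite /= !raddfB; abel.
have gZ : semilinear c (mk_additive gB).
  by move=> r t; rewrite -[LHS]/(a (r *: t.1) + b (r *: t.2)) aZ bZ -scalerDr.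
have [f fE] := @xext _ _ _ st_xmod L _ gZ.
exists f => t; split.
  have := fE (t, 0); rewrite st_xiE !raddf0 addr0 => ->.
  by rewrite -[LHS]/(a t + b 0) raddf0 addr0.
have := fE (0, t); rewrite st_xiE !raddf0 add0r => ->.
by rewrite -[LHS]/(a 0 + b t) raddf0 add0r.
Qed.

Lemma st_uniq (L : lmodType Q) (f g : {linear N -> L}) :
  (forall t, f (slot1 (ti c t)) = g (slot1 (ti c t))) ->
  (forall t, f (slote (ti c t)) = g (slote (ti c t))) -> f =1 g.
Proof.
move=> e1 e2; apply: (@xuniq _ _ _ st_xmod) => -[t1 te].
by rewrite st_xiE (linearD f) (linearD g) e1 e2.
Qed.

End Slots.
End FullyFaithful.

Section QuasiFullyFaithful.
Variables (k : fieldType) (B Q : comPzRingType) (A : xalg B Q).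
Variables (rho : {rmorphism k -> B}) (rhoQ : {rmorphism k -> Q}).
Hypothesis rhoQE : forall a, rhoQ a = xc A (rho a).
Variables (w : B) (v : Q).
Hypothesis vE : v = xc A w + xx A * xy A.
Local Notation c := (xc A).
Local Notation x := (xx A).
Local Notation y := (xy A).
Local Notation st X := (st_obj vE X).

Section Pair.
Variables X Y : mfact w.
Local Notation T' := (mf_tot Y).
Local Notation M' := (tens_xmod A T').
Local Notation N' := (mf_tot (st Y)).
Local Notation J1 t := (slot1 vE X (ti c t)).
Local Notation Je t := (slote vE X (ti c t)).
Local Notation K1 := (slot1 vE Y).
Local Notation E1 := (ev1 (vE := vE) (X := Y)).
Local Notation d := (mf_d (st X)).
Local Notation d' := (mf_d (st Y)).
Local Notation G := (mf_sg (st X)).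
Local Notation G' := (mf_sg (st Y)).

Lemma J1_d t : d (J1 t) = J1 (mf_d X t) + y *: Je (mf_sg X t).
Proof. by rewrite slot_d1 !tmap_i. Qed.
Lemma Je_d t : d (Je t) = Je (mf_d X t) + x *: J1 (mf_sg X t).
Proof. by rewrite slot_de !tmap_i. Qed.
Lemma J1_sg t : G (J1 t) = J1 (mf_sg X t).
Proof. by rewrite slot_sg1 tmap_i. Qed.
Lemma Je_sg t : G (Je t) = - Je (mf_sg X t).
Proof. by rewrite slot_sge tmap_i. Qed.

Lemma dhom_J1 (h : mf_hom rhoQ (st X) (st Y)) t :
  mf_dhom h (J1 t) = d' (h (J1 t)) - G' (h (G (J1 (mf_d X t)))) + y *: G' (h (Je t)).
Proof.
rewrite mf_dhom_sg J1_d (linearD G) (linearZ_LR G) Je_sg mf_sgK scalerN.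
rewrite (linearB h) (linearZ_LR h) (linearB G') (linearZ_LR G'); abel.
Qed.

Lemma st_hom_J1 (f : mf_hom rho X Y) t :
  st_hom rhoQ vE f (J1 t) = K1 (ti c (f t)).
Proof.
rewrite !slot1E !tmap_i.
rewrite -[LHS]/(tmap c (mf_comp_lin false f) (ti c (mf_pr X false t))
   + tmap c (mf_comp_lin true f) (ti c (mf_pr X true t)),
   tmap c (mf_comp_lin true f) (ti c (mf_pr X false t))
   + tmap c (mf_comp_lin false f) (ti c (mf_pr X true t))).
have e0 : mf_part false f (mf_pr X false t) + mf_part true f (mf_pr X true t)
    = mf_pr Y false (f t).
  by rewrite !mf_part_pr -(linearD (mf_pr Y false)) -(linearD f) mf_pr_sum.
have e1 : mf_part true f (mf_pr X false t) + mf_part false f (mf_pr X true t)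
    = mf_pr Y true (f t).
  by rewrite !mf_part_pr -(linearD (mf_pr Y true)) -(linearD f) mf_pr_sum.
by rewrite !tmap_i !mf_comp_linE -!(raddfD (ti c)) e0 e1.
Qed.

(** Since [d (J1 t)] contains the term [y Je], closedness turns vanishing on [J1] into
    [y g (Je t) = 0] up to sign, and [y] is injective. *)
Lemma closed_J1_eq0 (g : mf_hom rhoQ (st X) (st Y)) :
  mf_dhom g = 0 -> (forall t, g (J1 t) = 0) -> g = 0.
Proof.
move=> g0 gJ1; apply: linear_ext; apply: (st_uniq (vE := vE)) => t.
  by rewrite gJ1.
have := dhom_J1 g t; rewrite g0 J1_sg !gJ1 (linear0 d') (linear0 G') subr0 add0r.
rewrite -[X in X = _]/0 => e.
have : y *: G' (g (Je t)) = y *: 0 by rewrite -e scaler0.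
move/(@y_inj _ _ _ (prod_xmod M' M') _ 0) => e'.
by rewrite -[LHS](mf_sgK (X := st Y)) e' raddf0.
Qed.

Lemma ev1_hom_linear (h : mf_hom rhoQ (st X) (st Y)) :
  linear (fun t => E1 (h (J1 t))).
Proof.
move=> a t t'; rewrite (raddfD (ti c)) tiZ (linearD (slot1 vE X)).
rewrite (linearZ_LR (slot1 vE X)) linearP ev1D ev1Z xev_c.
by [].
Qed.

(** A retraction of [st_hom] by a chain map: the term of [dhom_J1] that involves [Je] is divisible
    by [y], which the evaluation kills. *)
Definition ev1_hom (h : mf_hom rhoQ (st X) (st Y)) : mf_hom rho X Y :=
  mk_linear (ev1_hom_linear h).

Lemma ev1_homE h t : ev1_hom h t = E1 (h (J1 t)). Proof. by []. Qed.

Lemma ev1_dhom h : mf_dhom (ev1_hom h) = ev1_hom (mf_dhom h).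
Proof.
apply: linear_ext => t; rewrite mf_dhom_sg !ev1_homE dhom_J1.
rewrite !ev1D ev1N ev1Z xev_y scale0r addr0 ev1_d ev1_sg J1_sg.
by [].
Qed.

Lemma ev1_hom0 : ev1_hom 0 = 0.
Proof.
apply: linear_ext => t; rewrite ev1_homE.
rewrite -[X in E1 X]/(0 : N') -[RHS]/(0 : T').
by rewrite /ev1 (linear0 (proj1 vE Y)) raddf0.
Qed.

Lemma ev1_st_hom f : ev1_hom (st_hom rhoQ vE f) = f.
Proof.
by apply: linear_ext => t; rewrite ev1_homE st_hom_J1 ev1_slot1.
Qed.

(** A boundary is subtracted so that the values on [J1] become constant, that is, free of [e], [x]
    and [y]. *)
Lemma st_hom_reduce (g : mf_hom rhoQ (st X) (st Y)) : mf_dhom g = 0 ->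
  exists h : mf_hom rhoQ (st X) (st Y),
    forall t, (g - mf_dhom h) (J1 t) = K1 (ti c (E1 ((g - mf_dhom h) (J1 t)))).
Proof.
move=> g0; pose a t := ex M' (proj1 vE Y (g (J1 t))).
have aB : zmod_morphism a.
  move=> t t'; rewrite /a (raddfB (ti c)) (linearB (slot1 vE X)) (linearB g).
  by rewrite (linearB (proj1 vE Y)) raddfB.
have aZ : semilinear c a.
  move=> r t; rewrite /a tiZ (linearZ_LR (slot1 vE X)) (linearZ_LR g).
  by rewrite (linearZ_LR (proj1 vE Y)) ex_c.
(* By [hx_d] this value on [J1] removes everything that involves [x] or [e]; only [K1 (a t)] is
   left, where [a t] may still involve [y]. *)
pose al t := hx (g (J1 t)).
have alB : zmod_morphism al.
  move=> t t'; rewrite /al (raddfB (ti c)) (linearB (slot1 vE X)) (linearB g).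
  by rewrite hxD hxN.
have alZ : semilinear c al.
  move=> r t; rewrite /al tiZ (linearZ_LR (slot1 vE X)) (linearZ_LR g).
  by rewrite hx_c.
(* In [dhom_J1] the value on [Je] is multiplied by [y]. The first summand cancels what [al] leaves
   over from [g (Je t)]; the second removes the part of [a t] divisible by [y]. *)
pose be t := hx (g (Je t)) + G' (K1 (mdy M' (a t))).
have beB : zmod_morphism be.
  move=> t t'; rewrite /be (raddfB (ti c)) (linearB (slote vE X)) (linearB g).
  by rewrite hxD hxN aB raddfB (linearB K1) (linearB G'); abel.
have beZ : semilinear c be.
  move=> r t; rewrite /be tiZ (linearZ_LR (slote vE X)) (linearZ_LR g).
  by rewrite hx_c aZ mdyc (linearZ_LR K1) (linearZ_LR G') scalerDr.
have [h hE] := st_ext vE (a := mk_additive alB) (b := mk_additive beB) alZ beZ.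
exists h => t.
have hJ1 s : h (J1 s) = al s by have [] := hE s.
have hJe s : h (Je s) = be s by have [] := hE s.
have key : (g - mf_dhom h) (J1 t) = K1 (ti c (xe M' (a t))).
  have gd : d' (g (J1 t)) = G' (g (G (J1 (mf_d X t)))) - y *: G' (g (Je t)).
    have := dhom_J1 g t; rewrite g0 -[X in X = _]/0 => e.
    apply/eqP; rewrite -subr_eq0 eq_sym; apply/eqP; rewrite e; abel.
  have := hx_d (g (J1 t)).
  rewrite gd J1_sg hxD hxN hx_y !hx_sg scalerN opprK => hd.
  rewrite -[LHS]/(g (J1 t) - mf_dhom h (J1 t)) dhom_J1 J1_sg hJe !hJ1 /be.
  rewrite (linearD G') mf_sgK scalerDr.
  have aE : a t = ti c (xe M' (a t)) + y *: mdy M' (a t).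
    by rewrite {1}/a ex_decomp -/(a t) /a e_ex.
  have -> : d' (al t) = g (J1 t) - K1 (a t) + G' (al (mf_sg X (mf_d X t)))
      - y *: G' (hx (g (Je t))).
    by rewrite -[g (J1 t) - K1 (a t)]hd /al; abel.
  by rewrite {1}aE (linearD K1) (linearZ_LR K1); abel.
by rewrite key ev1_slot1.
Qed.

(** Injectivity comes from applying the retraction [ev1_hom] to a bounding map. For surjectivity,
    the reduced map and the stabilization of its evaluation are closed and agree on [J1], hence
    coincide. *)
Lemma st_hom_quasi_iso : quasi_iso (st_hom_lin rhoQE vE X Y).
Proof.
split=> [f f0 [h hE]|g g0].
  exists (ev1_hom h); rewrite -[RHS]/(mf_dhom (ev1_hom h)) ev1_dhom.
  by rewrite -[mf_dhom h]hE ev1_st_hom.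
have [h hE] := st_hom_reduce g0; set g' := g - mf_dhom h in hE.
have dB (a b : mf_hom rhoQ (st X) (st Y)) : mf_dhom (a - b) = mf_dhom a - mf_dhom b.
  exact: (raddfB (mf_dhom_lin rhoQ (st X) (st Y))).
have g'0 : mf_dhom g' = 0.
  by rewrite dB mf_dhom_dd subr0.
exists (ev1_hom g'), (- h); split.
  rewrite -[LHS]/(mf_dhom _) ev1_dhom g'0 ev1_hom0.
  by [].
rewrite -[RHS]/(mf_dhom_lin _ _ _ _) raddfN.
rewrite -[RHS]/(- mf_dhom h).
apply/eqP; rewrite -subr_eq0; apply/eqP.
have -> : st_hom_lin rhoQE vE X Y (ev1_hom g') - g - - mf_dhom h
   = st_hom rhoQ vE (ev1_hom g') - g' by rewrite /g'; abel.
apply: closed_J1_eq0 => [|t].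
  rewrite dB g'0 -st_hom_d // ev1_dhom g'0 ev1_hom0 subr0.
  exact: (raddf0 (st_hom_lin rhoQE vE X Y)).
rewrite -[LHS]/(st_hom rhoQ vE (ev1_hom g') (J1 t) - g' (J1 t)) st_hom_J1.
by rewrite ev1_homE [in X in _ - X]hE subrr.
Qed.

End Pair.
End QuasiFullyFaithful.

(** * Lifting contractions modulo x and y *)

Section Nakayama.
Variables (B Q : comPzRingType) (A : xalg B Q) (M : xmod A).
Local Notation c := (xc A).
Local Notation x := (xx A).
Local Notation y := (xy A).
Local Notation i := (xi M).
Local Notation e := (xe M).
Local Notation dx := (mdx M).
Local Notation dy := (mdy M).
Variables (D : {linear xm M -> xm M}) (v : Q).
Hypothesis DD : forall m, D (D m) = v *: m.

(* Differentiating [D^2 = v]: the derivative of [D] contracts that of [v]. *)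
Lemma derivative_nullhomotopy (p : {additive xm M -> xm M}) (dp : {additive Q -> Q}) :
  (forall a m, p (a *: m) = dp a *: m + a *: p m) ->
  {f : {linear xm M -> xm M} | forall m, D (f m) + f (D m) = dp v *: m}.
Proof.
move=> pZ; pose f m := p (D m) - D (p m).
have fL : linear f.
  move=> a m n; rewrite /f (linearP D) (raddfD p) (raddfD p) !pZ.
  rewrite (linearD D) (linearD D) !(linearZ_LR D) scalerBr; abel.
exists (mk_linear fL) => m; rewrite -[LHS]/(D (f m) + f (D m)) /f.
by rewrite (linearB D) !DD pZ; abel.
Qed.

(** The maps [f] and [g] contract multiplication by [x] and by [y]; the error of the extended [H0]
    is written through [x] and [y] and removed with them. *)
Lemma contraction_lift (H0 : {linear xb M -> xb M}) :
  xpx A v = y -> xpy A v = x ->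
  (forall t, e (D (i (H0 t))) + H0 (e (D (i t))) = t) ->
  exists H : {linear xm M -> xm M}, forall m, D (H m) + H (D m) = m.
Proof.
move=> vx vy hH0.
have [f fE] := derivative_nullhomotopy (@mpyZ _ _ _ M).
have [g gE] := derivative_nullhomotopy (@mpxZ _ _ _ M).
rewrite vy in fE; rewrite vx in gE.
have [H1 H1E] : exists H1 : {linear xm M -> xm M}, forall t, H1 (i t) = i (H0 t).
  apply: (@xext _ _ _ M _ (i \o H0)) => r t.
  by rewrite /= linearZ_LR xiZ.
have eH1 m : e (H1 m) = H0 (e m).
  rewrite {1}[m]mdecomp (linearD H1) (linearD H1) !(linearZ_LR H1) H1E.
  rewrite !(raddfD e) e_x e_y xei !addr0.
  by [].
pose n m := m - D (H1 m) - H1 (D m).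
have nL : linear n.
  move=> a m m'; rewrite /n (linearP H1) !(linearP D) (linearP H1).
  by rewrite !scalerBr; abel.
have nB a b : n (a - b) = n a - n b by rewrite -[n]/(mk_linear nL : _ -> _) linearB.
have nD a b : n (a + b) = n a + n b by rewrite -[n]/(mk_linear nL : _ -> _) linearD.
have nZ q m : n (q *: m) = q *: n m by rewrite -[n]/(mk_linear nL : _ -> _) linearZ_LR.
have ei_n t : e (n (i t)) = 0.
  rewrite /n !raddfB H1E eH1.
  by rewrite -[t in e (i t)]hH0 xei; abel.
have nsplit t : n (i t) = x *: dx (n (i t)) + y *: dy (n (i t) - x *: dx (n (i t))).
  by rewrite {1}[n (i t)]mdecomp ei_n raddf0 add0r.
have niZ r t : n (i (r *: t)) = c r *: n (i t) by rewrite xiZ nZ.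
have a1B : zmod_morphism (fun t => dx (n (i t))).
  by move=> t t'; rewrite (raddfB i) nB raddfB.
have a2B : zmod_morphism (fun t => dy (ex M (n (i t)))).
  by move=> t t'; rewrite (raddfB i) nB (raddfB (ex M)) raddfB.
have [|a aE] := @xext _ _ _ M _ (mk_additive a1B).
  by move=> r t; rewrite -[LHS]/(dx (n (i (r *: t)))) niZ mdxc.
have [|b bE] := @xext _ _ _ M _ (mk_additive a2B).
  by move=> r t; rewrite -[LHS]/(dy (ex M (n (i (r *: t))))) niZ ex_c mdyc.
have nE m : n m = x *: a m + y *: b m.
  have := @xuniq _ _ _ M _ (mk_linear nL) ((x \*: a) \+ (y \*: b)).
  apply=> t; rewrite -[RHS]/(x *: a (i t) + y *: b (i t)) aE bE.
  exact: nsplit.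
have nDcomm m : D (n m) = n (D m).
  by rewrite /n !(linearB D) !DD (linearZ_LR H1); abel.
pose U m := D (a m) - a (D m); pose W m := D (b m) - b (D m).
have UW m : x *: U m + y *: W m = 0.
  have := nDcomm m; rewrite !nE (linearD D) !(linearZ_LR D) => h.
  rewrite /U /W !scalerBr; apply/eqP; rewrite -(subr_eq0 _ 0) subr0.
  apply/eqP; transitivity (x *: D (a m) + y *: D (b m)
    - (x *: a (D m) + y *: b (D m))); first by abel.
  by rewrite h subrr.
(* [U] and [W] are the commutators of [D] with [a] and [b]. As [n] commutes with [D], they satisfy
   [x U + y W = 0], so regularity yields one [E] with [U = y E] and [W = - x E]. *)
pose E m := dy (U m).
have yE m : y *: E m = U m by apply/esym/(xy_regular (UW m)).
have UL : linear U.
  by move=> q m m'; rewrite /U !(linearP a) !(linearP D) !(linearP a) scalerBr; abel.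
have EL : linear E.
  move=> q m m'; apply: y_inj; rewrite yE UL -!yE scalerDr !scalerA.
  by rewrite [q * y]mulrC.
have xE m : x *: E m = - W m.
  apply: y_inj; rewrite scalerA mulrC -scalerA yE scalerN.
  by apply/eqP; rewrite -addr_eq0 UW.
have DE m : D (E m) + E (D m) = 0.
  apply: y_inj; rewrite scalerDr -(linearZ_LR D) !yE /U (linearB D) DD scaler0.
  by rewrite DD (linearZ_LR a); abel.
(* [b] alone fails to commute with [D] by [- x E]. Since [E] anticommutes with [D] and [f] contracts
   [x], the term [f E] makes up for it. *)
pose mu m := f (E m) + b m.
have Dmu m : D (mu m) = mu (D m).
  have fED : f (D (E m)) + f (E (D m)) = 0 by rewrite -(linearD f) DE linear0.
  have DfE : D (f (E m)) = x *: E m - f (D (E m)) by rewrite -fE addrK.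
  rewrite /mu (linearD D) DfE xE /W; apply/eqP; rewrite -subr_eq0 -oppr_eq0.
  by rewrite -[X in _ == X]fED; apply/eqP; abel.
have EB q m m' : E (q *: m + m') = q *: E m + E m' by exact: EL.
(* The boundary of [f a] is [x a - y f E], and that of [g mu] is [y mu = y f E + y b]; together they
   give the error [n = x a + y b]. *)
pose H m := H1 m + f (a m) + g (mu m).
have HL : linear H.
  have muP q m m' : mu (q *: m + m') = q *: mu m + mu m'.
    by rewrite /mu EB (linearP f) (linearP b) scalerDr; abel.
  move=> q m m'; rewrite /H muP (linearP a) (linearP H1) (linearP f) (linearP g).
  by rewrite !scalerDr; abel.
exists (mk_linear HL) => m; rewrite -[LHS]/(D (H m) + H (D m)) /H.
have h1 : D (f (a m)) = x *: a m - f (D (a m)) by rewrite -fE addrK.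
have h2 : D (g (mu m)) = y *: mu m - g (mu (D m)) by rewrite -Dmu -gE addrK.
have h3 : f (D (a m)) = y *: f (E m) + f (a (D m)).
  by rewrite -(linearZ_LR f) yE -(linearD f) /U subrK.
have h4 : D (H1 m) + H1 (D m) = m - n m by rewrite /n; abel.
rewrite !(linearD D) h1 h2 h3 /mu scalerDr.
have -> : forall z, D (H1 m) + (x *: a m - (y *: f (E m) + f (a (D m)))) +
  (y *: f (E m) + y *: b m - z) + (H1 (D m) + f (a (D m)) + z)
  = (D (H1 m) + H1 (D m)) + (x *: a m + y *: b m) by move=> z; abel.
by rewrite h4 -nE subrK.
Qed.

End Nakayama.

(** * Mapping cones *)

Section Cone.
Variables (B : comPzRingType) (Z P : lmodType B).
Variables (dZ : {linear Z -> Z}) (dP : {linear P -> P}) (g : {linear Z -> P}).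

Definition cone_fun (t : Z * P) : Z * P := (- dZ t.1, g t.1 + dP t.2).
Lemma cone_linear : linear cone_fun.
Proof.
move=> a [z p] [z' p'].
rewrite -[LHS]/(- dZ (a *: z + z'), g (a *: z + z') + dP (a *: p + p')).
rewrite -[RHS]/(a *: (- dZ z) - dZ z', a *: (g z + dP p) + (g z' + dP p')).
rewrite (linearP dZ) (linearP g) (linearP dP) opprD scalerN scalerDr.
by congr pair; abel.
Qed.
Definition cone : {linear (Z * P)%type -> (Z * P)%type} := mk_linear cone_linear.

Lemma coneE z p : cone (z, p) = (- dZ z, g z + dP p). Proof. by []. Qed.

Variables (g' : {linear P -> Z}) (h : {linear Z -> Z}) (kk : {linear P -> P}).
Hypothesis gd : forall z, g (dZ z) = dP (g z).
Hypothesis g'd : forall p, g' (dP p) = dZ (g' p).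
Hypothesis hh : forall z, g' (g z) - z = dZ (h z) + h (dZ z).
Hypothesis kh : forall p, g (g' p) - p = dP (kk p) + kk (dP p).

(* The homotopy [kk] is first corrected by [(g h - kk g) g'], after which
   [g h - kk g] becomes a boundary. *)
Lemma cone_contraction :
  exists H : {linear (Z * P)%type -> (Z * P)%type},
    forall t, cone (H t) + H (cone t) = t.
Proof.
pose u z := g (h z) - kk (g z).
pose W (t : Z * P) := h t.1 + g' t.2.
have ud z : dP (u z) + u (dZ z) = 0.
  rewrite /u (linearB dP) -(gd (h z)) (gd z).
  have -> : dP (kk (g z)) = g (g' (g z)) - g z - kk (dP (g z)).
    by rewrite kh; abel.
  have -> : g (dZ (h z)) = g (g' (g z)) - g z - g (h (dZ z)).
    by rewrite -(linearB g) hh (linearD g); abel.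
  by abel.
have uL : linear u.
  by move=> a z z'; rewrite /u !(linearP h, linearP g, linearP kk) scalerBr; abel.
have WL : linear W.
  move=> a [z p] [z' p'].
  rewrite -[LHS]/(h (a *: z + z') + g' (a *: p + p')).
  by rewrite (linearP h) (linearP g') /W scalerDr; abel.
pose H t := (W t, - kk t.2 - u (W t)).
have HL : linear H.
  move=> a t t'; rewrite -[RHS]/(a *: W t + W t',
    a *: (- kk t.2 - u (W t)) + (- kk t'.2 - u (W t'))).
  rewrite /H WL uL -[(a *: t + t').2]/(a *: t.2 + t'.2) (linearP kk).
  by rewrite (scalerBr a (- kk t.2)) (scalerN a (kk t.2)); congr pair; abel.
exists (mk_linear HL) => -[z p].
rewrite -[LHS]/(cone (H (z, p)) + H (cone (z, p))).
have W2 : W (cone (z, p)) = z + dZ (W (z, p)).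
  rewrite coneE /W -[(_, _).1]/(- dZ z) -[(_, _).2]/(g z + dP p).
  rewrite -[(z, p).1]/z -[(z, p).2]/p (linearN h) (linearD g') g'd (linearD dZ).
  by have := hh z; move/eqP; rewrite subr_eq => /eqP ->; abel.
rewrite /H W2.
set W1 := W (z, p).
have uD a b : u (a + b) = u a + u b.
  by rewrite -[u]/(mk_linear uL : _ -> _) linearD.
rewrite -[LHS]/(- dZ W1 + (z + dZ W1),
  g W1 + dP (- kk p - u W1) + (- kk (g z + dP p) - u (z + dZ W1))).
congr pair; first by abel.
rewrite (uD z) (linearB dP (- kk p)) (linearN dP (kk p)) (linearD kk (g z)).
have -> : dP (u W1) = - u (dZ W1).
  by apply/eqP; rewrite -addr_eq0 ud.
have -> : g W1 = g (h z) + g (g' p) by rewrite /W1 /W (linearD g).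
have := kh p; move/eqP; rewrite subr_eq => /eqP ->.
by rewrite /u; abel.
Qed.

End Cone.

Section HomotopyEquivalence.
Variables (k : fieldType) (Q : comPzRingType) (rho : {rmorphism k -> Q}) (v : Q).

(** The block [Y -> Z] of [H] is a homotopy inverse of [g], and the diagonal blocks, the one on [Y]
    with a sign, are the homotopies. As [H] need not be homogeneous, the even part of the inverse
    and the odd parts of the homotopies are taken. *)
Lemma H0_iso_of_contraction (Z Y : mfact v) (g : mf_hom rho Z Y)
    (H : {linear (mf_tot Z * mf_tot Y)%type -> (mf_tot Z * mf_tot Y)%type}) :
  mf_part false g = g -> mf_dhom g = 0 ->
  (forall t, cone (mf_d Z) (mf_d Y) g (H t) + H (cone (mf_d Z) (mf_d Y) g t) = t) ->
  @H0_iso k (MFinf rho v) Z Y.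
Proof.
move=> g_even g_closed Hc.
have g1L : linear (fun p => (H (0, p)).1).
  move=> a p p'; have -> : (0, a *: p + p') = a *: (0, p) + (0, p') :> mf_tot Z * mf_tot Y.
    by rewrite -[RHS]/(a *: 0 + 0, a *: p + p') scaler0 addr0.
  by rewrite linearP.
have h1L : linear (fun z => (H (z, 0)).1).
  move=> a p p'; have -> : (a *: p + p', 0) = a *: (p, 0) + (p', 0) :> mf_tot Z * mf_tot Y.
    by rewrite -[RHS]/(a *: p + p', a *: 0 + 0) scaler0 addr0.
  by rewrite linearP.
have h2L : linear (fun p => - (H (0, p)).2).
  move=> a p p'; have -> : (0, a *: p + p') = a *: (0, p) + (0, p') :> mf_tot Z * mf_tot Y.
    by rewrite -[RHS]/(a *: 0 + 0, a *: p + p') scaler0 addr0.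
  by rewrite linearP -[(_ + _).2]/(a *: (H (0, p)).2 + (H (0, p')).2) scalerN opprD.
pose g1 : mf_hom rho Y Z := mk_linear g1L.
pose h1 : mf_hom rho Z Z := mk_linear h1L.
pose h2 : mf_hom rho Y Y := mk_linear h2L.
have Hsplit z p : H (z, p) = (h1 z + g1 p, (H (z, 0)).2 - h2 p).
  have -> : (z, p) = (z, 0) + (0, p) by rewrite -[RHS]/(z + 0, 0 + p) addr0 add0r.
  rewrite (linearD H) -[RHS]/((H (z, 0)).1 + (H (0, p)).1,
    (H (z, 0)).2 - - (H (0, p)).2) opprK.
  by case: (H (z, 0)) => ? ?; case: (H (0, p)).
have gd z : g (mf_d Z z) = mf_d Y (g z).
  have := mf_dhom_homog z g_even; rewrite g_closed scale1r -[LHS]/0.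
  by move/eqP; rewrite eq_sym subr_eq0 => /eqP.
have c0 p : cone (mf_d Z) (mf_d Y) g (0, p) = (0, mf_d Y p).
  by rewrite coneE (linear0 (mf_d Z)) (linear0 g) oppr0 add0r.
have cz z : cone (mf_d Z) (mf_d Y) g (z, 0) = (- mf_d Z z, g z).
  by rewrite coneE (linear0 (mf_d Y)) addr0.
have H0p p : H (0, p) = (g1 p, - h2 p).
  by rewrite -[RHS]/((H (0, p)).1, - - (H (0, p)).2) opprK; case: (H _).
have Hz0 z : H (z, 0) = (h1 z, (H (z, 0)).2).
  by rewrite -[RHS]/((H (z, 0)).1, (H (z, 0)).2); case: (H _).
have e1 p : g1 (mf_d Y p) = mf_d Z (g1 p).
  have := congr1 fst (Hc (0, p)); rewrite c0 !H0p coneE.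
  rewrite -[LHS]/(- mf_d Z (g1 p) + g1 (mf_d Y p)) -[RHS]/(0 : mf_tot Z).
  by move/eqP; rewrite addrC subr_eq0 => /eqP.
have e2 p : g (g1 p) - p = mf_d Y (h2 p) + h2 (mf_d Y p).
  have := congr1 snd (Hc (0, p)); rewrite c0 !H0p coneE.
  rewrite -[LHS]/(g (g1 p) + mf_d Y (- h2 p) + - h2 (mf_d Y p)).
  rewrite -[RHS]/p => {2}<-.
  by rewrite (linearN (mf_d Y)); abel.
have e3 z : g1 (g z) - z = mf_d Z (h1 z) + h1 (mf_d Z z).
  have := congr1 fst (Hc (z, 0)); rewrite cz Hz0 (Hsplit _ (g z)) coneE.
  rewrite -[LHS]/(- mf_d Z (h1 z) + (h1 (- mf_d Z z) + g1 (g z))).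
  rewrite -[RHS]/z => {2}<-.
  by rewrite (linearN h1); abel.
have g_even' j z : mf_pr Y j (g (mf_pr Z j z)) = g (mf_pr Z j z).
  by rewrite -{2}g_even mf_part_pr addFb.
have gprc j z : mf_pr Y j (g (mf_pr Z j z)) = mf_pr Y j (g z).
  rewrite -{2}(mf_pr_sum z) (linearD g) (linearD (mf_pr Y j)).
  rewrite -[g (mf_pr Z false z)]g_even' -[g (mf_pr Z true z)]g_even'.
  by case: j; rewrite !mf_pr_idem ?add0r ?addr0.
have gpr j z : g (mf_pr Z j z) = mf_pr Y j (g (mf_pr Z j z)).
  by rewrite -{1}g_even mf_part_pr addFb.
pose g0 := mf_part false g1.
have g0_even : mf_part false g0 = g0 by rewrite mf_part_idem.
have odd (U : mfact v) (f : mf_hom rho U U) : mf_part true (mf_part true f) = mf_part true f.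
  by rewrite mf_part_idem.
have dodd (U : mfact v) (f : mf_hom rho U U) j p :
  mf_dhom (mf_part true f) (mf_pr U j p)
  = mf_pr U j (mf_d U (f (mf_pr U j p)) + f (mf_d U (mf_pr U j p))).
  rewrite (mf_dhom_homog _ (odd U f)) expr1 scaleN1r opprK mf_d_pr !mf_part_pr.
  rewrite mf_d_pr !addTb negbK (linearD (mf_pr U j)).
  by rewrite -mf_d_pr.
exists g, g0; split=> //.
- split=> //; apply: linear_ext => p.
  rewrite -[LHS]/(mf_dhom g0 p) (mf_dhom_homog _ g0_even) scale1r.
  rewrite -[RHS]/(0 : mf_tot Z) -(mf_pr_sum p).
  have s j q : mf_d Z (g0 (mf_pr Y j q)) = g0 (mf_d Y (mf_pr Y j q)).
    rewrite mf_d_pr !mf_part_pr mf_d_pr !addFb -e1 mf_d_pr.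
    by [].
  by rewrite (linearD g0) (linearD (mf_d Z)) (linearD (mf_d Y)) (linearD g0) !s subrr.
- exists (mf_part true h1); first exact: odd.
  apply: mf_hom_ext => j p; rewrite -[RHS]/(mf_dhom _ _) dodd -e3.
  rewrite -[LHS]/(g0 (g (mf_pr Z j p)) - mf_pr Z j p) (linearB (mf_pr Z j)) mf_pr_id.
  by rewrite gpr /g0 mf_part_pr addFb -gpr.
exists (mf_part true h2); first exact: odd.
apply: mf_hom_ext => j p; rewrite -[RHS]/(mf_dhom _ _) dodd -e2.
rewrite -[LHS]/(g (g0 (mf_pr Y j p)) - mf_pr Y j p) (linearB (mf_pr Y j)) mf_pr_id.
by rewrite /g0 mf_part_pr addFb gpr gprc.
Qed.

End HomotopyEquivalence.

(** * Comparing stabilizations with extended factorizations *)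

Section Comparison.
Variables (k : fieldType) (B Q : comPzRingType) (A : xalg B Q).
Variables (rhoQ : {rmorphism k -> Q}) (w : B) (v : Q).
Hypothesis vE : v = xc A w + xx A * xy A.
Local Notation c := (xc A).
Local Notation x := (xx A).
Local Notation y := (xy A).
Local Notation st X := (st_obj vE X).

Variables (V0 V1 : lmodType B).
Local Notation M0 := (tens_xmod A V0).
Local Notation M1 := (tens_xmod A V1).
Variables (p0 : projective (tens c V0)) (p1 : projective (tens c V1)).
Variables (d01 : {linear tens c V0 -> tens c V1}).
Variables (d10 : {linear tens c V1 -> tens c V0}).
Hypothesis d2_0 : forall u, d10 (d01 u) = v *: u.
Hypothesis d2_1 : forall u, d01 (d10 u) = v *: u.
Definition ext_mfact : mfact v := MFact p0 p1 d2_0 d2_1.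
Local Notation Y := ext_mfact.
Definition ext_xmod : xmod A := prod_xmod M0 M1.
Local Notation MY := ext_xmod.
Local Notation N' := (mf_tot Y).
Local Notation P := (V0 * V1)%type.
Local Notation d := (mf_d Y).
Local Notation G := (mf_sg Y).
Local Notation i := (xi MY : P -> N').
Local Notation e := (xe MY : N' -> P).
Local Notation dx := (mdx MY : N' -> N').

Lemma v_scaleE (M : lmodType Q) (m : M) : v *: m = c w *: m + x *: (y *: m).
Proof. by rewrite vE scalerDl scalerA. Qed.

Lemma base_d_linear : linear (fun p : P => e (d (i p))).
Proof.
move=> a p q.
rewrite (raddfD (xi MY)) xiZ (linearP d) (raddfD (xe MY)) xeZ xev_c.
by [].
Qed.
Definition base_d : {linear P -> P} := mk_linear base_d_linear.

Lemma base_dE p : base_d p = e (d (i p)). Proof. by []. Qed.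

Lemma xe_lin (f : {linear N' -> N'}) m : e (f m) = e (f (i (e m))).
Proof.
rewrite {1}[m](@mdecomp _ _ _ MY) (linearD f) (linearD f) !(linearZ_LR f).
by rewrite !(raddfD (xe MY)) e_x e_y !addr0.
Qed.

Lemma xe_d m : e (d m) = base_d (e m).
Proof. exact: xe_lin. Qed.

Lemma dx_sg m : dx (G m) = G (dx m).
Proof.
case: m => a b; rewrite -[LHS]/(mdx M0 a, mdx M1 (- b)).
by rewrite (raddfN (mdx M1)).
Qed.
Lemma dx_pr j m : dx (mf_pr Y j m) = mf_pr Y j (dx m).
Proof.
case: m => a b; case: j.
  by rewrite -[LHS]/(mdx M0 0, mdx M1 b) raddf0.
by rewrite -[LHS]/(mdx M0 a, mdx M1 0) raddf0.
Qed.

Variables (X : mfact w).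
Local Notation T := (mf_tot X).
Local Notation D := (mf_d X).
Local Notation g' := (mf_sg X).
Local Notation J1 t := (slot1 vE X (ti c t)).
Local Notation Je t := (slote vE X (ti c t)).
Variable b : {additive T -> N'}.
Hypothesis bZ : semilinear c b.
Hypothesis b_odd : forall j t, b (mf_pr X j t) = mf_pr Y (~~ j) (b t).
Hypothesis b_closed : forall t, ex MY (d (b t) - b (D t)) = 0.

(* [x, e |-> t] closedness forces the image of [t] to be [x^-1 (d b - b d)]. *)
Definition cmp1 (t : T) : N' := G (dx (d (b t) - b (D t))).

Lemma cmp1B : zmod_morphism cmp1.
Proof.
move=> t t'; rewrite /cmp1 (linearB D) !(raddfB b) (linearB d).
rewrite -(linearB G); congr (G _); rewrite -[RHS](raddfB (mdx MY)).
by congr (mdx MY _); abel.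
Qed.
Definition cmp1_add : {additive T -> N'} := mk_additive cmp1B.

Lemma cmp1D t t' : cmp1 (t + t') = cmp1 t + cmp1 t'.
Proof. exact: (raddfD cmp1_add). Qed.

Lemma cmp1Z : semilinear c cmp1.
Proof.
move=> r t; rewrite /cmp1 (linearZ_LR D) !bZ (linearZ_LR d) -scalerBr.
by rewrite (@mdxc _ _ _ MY) (linearZ_LR G).
Qed.

Lemma cmp1_x t : x *: G (cmp1 t) = d (b t) - b (D t).
Proof.
rewrite /cmp1 mf_sgK; apply/esym/eqP; rewrite -subr_eq0; apply/eqP.
exact: b_closed.
Qed.

Lemma b_sg t : b (g' t) = - G (b t).
Proof.
rewrite mf_sgE (raddfB b) !b_odd mf_sgE; abel.
Qed.

Lemma cmp1_pr j t : cmp1 (mf_pr X j t) = mf_pr Y j (cmp1 t).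
Proof.
rewrite /cmp1 mf_d_pr !b_odd mf_d_pr negbK -(linearB (mf_pr Y j)) dx_pr.
by rewrite !mf_sgE (linearB (mf_pr Y j)) !mf_pr_idem; case: j; rewrite ?subr0 ?sub0r ?linearN.
Qed.

Lemma cmp1_sg t : cmp1 (g' t) = G (cmp1 t).
Proof.
by rewrite mf_sgE -[LHS]/(cmp1_add _) (raddfB cmp1_add) mf_sgE -!cmp1_pr.
Qed.

(** Closedness at [J1] comes for free from closedness at [Je]: after multiplication by [x] it
    follows from [d^2 = w + xy] and [D^2 = w], and [x] is injective. *)
Lemma cmp1_d t : d (cmp1 t) = cmp1 (D t) - y *: G (b t).
Proof.
rewrite -[LHS](mf_sgK (X := Y)) -[RHS](mf_sgK (X := Y)); congr (G _).
apply: (@x_inj _ _ _ MY).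
have e1 : G (d (cmp1 t)) = - d (G (cmp1 t)) by rewrite mf_d_sg opprK.
rewrite e1 (linearB G) (linearZ_LR G) mf_sgK scalerBr scalerN.
rewrite -(linearZ_LR d) !cmp1_x (linearB d) mf_dd mf_dd bZ.
by rewrite v_scaleE; abel.
Qed.

Lemma cmp_exists : exists f : {linear mf_tot (st X) -> N'},
  (forall t, f (J1 t) = cmp1 t) /\ (forall t, f (Je t) = b t).
Proof.
have [f fE] := st_ext vE (a := cmp1_add) (b := b) cmp1Z bZ.
by exists f; split=> t; have [] := fE t.
Qed.

Definition cmp : mf_hom rhoQ (st X) Y := sval (cid cmp_exists).
Lemma cmp_J1 t : cmp (J1 t) = cmp1 t.
Proof. by rewrite /cmp; case: cid => f []. Qed.
Lemma cmp_Je t : cmp (Je t) = b t.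
Proof. by rewrite /cmp; case: cid => f []. Qed.

Lemma J1_pr j t : mf_pr (st X) j (J1 t) = J1 (mf_pr X j t).
Proof.
rewrite !slot1E !tmap_i !mf_pr_idem.
by case: j; rewrite ?raddf0.
Qed.
Lemma Je_pr j t : mf_pr (st X) j (Je t) = Je (mf_pr X (~~ j) t).
Proof.
rewrite !sloteE !tmap_i !mf_pr_idem.
by case: j; rewrite ?raddf0.
Qed.

Lemma cmp_even : mf_part false cmp = cmp.
Proof.
apply: linear_ext; apply: (st_uniq (vE := vE)) => t.
  rewrite mf_partE !J1_pr !cmp_J1 !cmp1_pr !mf_pr_idem !eqxx.
  exact: mf_pr_sum.
rewrite mf_partE !Je_pr !cmp_Je !b_odd !mf_pr_idem.
exact: mf_pr_sum.
Qed.

Lemma cmp_closed : mf_dhom cmp = 0.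
Proof.
apply: linear_ext; apply: (st_uniq (vE := vE)) => t.
  rewrite mf_dhom_sg J1_d (linearD (mf_sg (st X))) (linearZ_LR (mf_sg (st X))).
  rewrite Je_sg mf_sgK J1_sg scalerN (linearB cmp) (linearZ_LR cmp) !cmp_J1 cmp_Je.
  rewrite cmp1_sg (linearB G) mf_sgK (linearZ_LR G) cmp1_d.
  by rewrite -[RHS]/(0 : N'); abel.
rewrite mf_dhom_sg Je_d (linearD (mf_sg (st X))) (linearZ_LR (mf_sg (st X))).
rewrite Je_sg J1_sg mf_sgK (linearD cmp) (linearN cmp) (linearZ_LR cmp).
rewrite cmp_J1 !cmp_Je b_sg opprK (linearD G) mf_sgK (linearZ_LR G) cmp1_x.
by rewrite -[RHS]/(0 : N'); abel.
Qed.

Definition base_cmp_fun (t : T * T) : P := e (cmp1 t.1) + e (b t.2).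
Lemma base_cmp_linear : linear base_cmp_fun.
Proof.
move=> a t t'; rewrite /base_cmp_fun.
rewrite -[(a *: t + t').1]/(a *: t.1 + t'.1) -[(a *: t + t').2]/(a *: t.2 + t'.2).
rewrite cmp1D (raddfD b) cmp1Z bZ.
by rewrite !(raddfD (xe MY)) !xeZ xev_c scalerDr; abel.
Qed.
Definition base_cmp : {linear (T * T)%type -> P} := mk_linear base_cmp_linear.
Lemma base_cmpE t1 te : base_cmp (t1, te) = e (cmp1 t1) + e (b te).
Proof. by []. Qed.

Definition DD_fun (t : T * T) : T * T := (D t.1, D t.2).
Lemma DD_linear : linear DD_fun.
Proof.
move=> a t t'; rewrite -[RHS]/(a *: D t.1 + D t'.1, a *: D t.2 + D t'.2).
by rewrite -!(linearP D).
Qed.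
Definition DD : {linear (T * T)%type -> (T * T)%type} := mk_linear DD_linear.

Lemma base_cmp_d t : base_cmp (DD t) = base_d (base_cmp t).
Proof.
case: t => t1 te; rewrite -[DD _]/(D t1, D te) !base_cmpE (linearD base_d) -!xe_d.
rewrite cmp1_d (raddfB (xe MY)) e_y subr0; congr (_ + _).
have := congr1 (xe MY) (cmp1_x te); rewrite e_x (raddfB (xe MY)).
by move/eqP; rewrite eq_sym subr_eq0 => /eqP.
Qed.

Variables (h1 : {linear P -> (T * T)%type}).
Variables (h2 : {linear (T * T)%type -> (T * T)%type}) (h3 : {linear P -> P}).
Hypothesis h1_d : forall p, h1 (base_d p) = DD (h1 p).
Hypothesis h2_d : forall t, h1 (base_cmp t) - t = DD (h2 t) + h2 (DD t).
Hypothesis h3_d : forall p, base_cmp (h1 p) - p = base_d (h3 p) + h3 (base_d p).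

(** Modulo [(x, y)] the cone of [cmp] is the cone of [base_cmp], which [h1], [h2] and [h3] contract;
    the contraction lifts to the cone of [cmp]. *)
Lemma H0_iso_stabilization : @H0_iso k (MFinf rhoQ v) (st X) Y.
Proof.
have [H0 hH0] := cone_contraction base_cmp_d h1_d h2_d h3_d.
pose M := prod_xmod (st_xmod A X) MY.
pose Dc := cone (mf_d (st X)) d cmp.
have cmpd n : cmp (mf_d (st X) n) = d (cmp n).
  have := mf_dhom_homog n cmp_even; rewrite cmp_closed scale1r -[LHS]/(0 : N').
  by move/eqP; rewrite eq_sym subr_eq0 => /eqP.
have DcDc m : Dc (Dc m) = v *: m.
  case: m => n m; rewrite /Dc !coneE (linearN (mf_d (st X))) opprK mf_dd.
  rewrite (linearN cmp) cmpd (linearD d) mf_dd addKr.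
  by [].
have vx : xpx A v = y.
  by rewrite vE raddfD xpxc add0r xpxM xpx_x xpx_y mul1r mulr0 addr0.
have vy : xpy A v = x.
  by rewrite vE raddfD xpyc add0r xpyM xpy_x xpy_y mul0r mulr1 add0r.
have e0 (t : (T * T) * P) : xe M (Dc (xi M t)) = cone DD base_d base_cmp t.
  case: t => [[t1 te] p]; pose S := st_xmod A X.
  have -> : xi M (t1, te, p) = (J1 t1 + Je te, i p) by rewrite -st_xiE.
  have dS : mf_d (st X) (J1 t1 + Je te) = xi S (D t1, D te)
      + y *: Je (g' t1) + x *: J1 (g' te).
    rewrite (linearD (mf_d (st X)) (J1 t1)) J1_d Je_d.
    by rewrite -[xi S _]/(xi (st_xmod A X) (D t1, D te)) (st_xiE vE); abel.
  have eS : xe S (- mf_d (st X) (J1 t1 + Je te)) = - DD (t1, te).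
    by rewrite raddfN dS !(raddfD (xe S)) xei e_x e_y !addr0.
  have eY : e (cmp (J1 t1 + Je te) + d (i p)) = base_cmp (t1, te) + base_d p.
    by rewrite (raddfD (xe MY)) (linearD cmp) cmp_J1 cmp_Je (raddfD (xe MY)).
  by rewrite /Dc !coneE -eS -eY.
have eH t : xe M (Dc (xi M (H0 t))) + H0 (xe M (Dc (xi M t))) = t.
  by rewrite !e0 hH0.
have [H hH] := @contraction_lift _ _ A M Dc v DcDc H0 vx vy eH.
exact: H0_iso_of_contraction cmp_even cmp_closed hH.
Qed.

End Comparison.

(** * Change of components *)

Section HomsByParity.
Variables (k : fieldType) (Q : comPzRingType) (rho : {rmorphism k -> Q}) (v : Q).
Variables X Y : mfact v.

Section Even.
Variables (f0 : {linear mf0 X -> mf0 Y}) (f1 : {linear mf1 X -> mf1 Y}).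
Definition even_fun (p : mf_tot X) : mf_tot Y := (f0 p.1, f1 p.2).
Lemma even_linear : linear even_fun.
Proof. by move=> a p q; congr pair; rewrite /= linearP. Qed.
Definition even_hom : mf_hom rho X Y := mk_linear even_linear.
Lemma even_hom_homog : mf_part false even_hom = even_hom.
Proof.
apply: mf_hom_ext => j [p q]; rewrite mf_part_pr.
by case: j; congr pair; rewrite /= ?linear0.
Qed.
Hypothesis h01 : forall p, f1 (mf_d01 X p) = mf_d01 Y (f0 p).
Hypothesis h10 : forall p, f0 (mf_d10 X p) = mf_d10 Y (f1 p).
Lemma even_hom_closed : mf_dhom even_hom = 0.
Proof.
apply: linear_ext => -[p q]; rewrite (mf_dhom_homog _ even_hom_homog).
rewrite -[LHS]/(mf_d10 Y (f1 q) - 1 *: f0 (mf_d10 X q),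
  mf_d01 Y (f0 p) - 1 *: f1 (mf_d01 X p)).
by rewrite h01 h10 !scale1r !subrr.
Qed.
End Even.

Section Odd.
Variables (f0 : {linear mf0 X -> mf1 Y}) (f1 : {linear mf1 X -> mf0 Y}).
Definition odd_fun (p : mf_tot X) : mf_tot Y := (f1 p.2, f0 p.1).
Lemma odd_linear : linear odd_fun.
Proof. by move=> a p q; congr pair; rewrite /= linearP. Qed.
Definition odd_hom : mf_hom rho X Y := mk_linear odd_linear.
Lemma odd_hom_homog : mf_part true odd_hom = odd_hom.
Proof.
apply: mf_hom_ext => j [p q]; rewrite mf_part_pr.
by case: j; congr pair; rewrite /= ?linear0.
Qed.
Lemma odd_hom_d p q : mf_dhom odd_hom (p, q)
  = (mf_d10 Y (f0 p) + f1 (mf_d01 X p), mf_d01 Y (f1 q) + f0 (mf_d10 X q)).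
Proof.
rewrite (mf_dhom_homog _ odd_hom_homog) expr1 scaleN1r opprK.
by [].
Qed.
End Odd.
End HomsByParity.

Section Transport.
Variables (k : fieldType) (Q : comPzRingType) (rho : {rmorphism k -> Q}) (v : Q).
Variables (Y : mfact v) (C L0 L1 : lmodType Q).
Variables (F0 : {linear (mf0 Y * C)%type -> L0}) (F0' : {linear L0 -> (mf0 Y * C)%type}).
Variables (F1 : {linear (mf1 Y * C)%type -> L1}) (F1' : {linear L1 -> (mf1 Y * C)%type}).
Hypotheses (F0K : cancel F0 F0') (F0'K : cancel F0' F0).
Hypotheses (F1K : cancel F1 F1') (F1'K : cancel F1' F1).
Variables (pL0 : projective L0) (pL1 : projective L1).

Let d01_fun (l : L0) : L1 := F1 (mf_d01 Y (F0' l).1, (F0' l).2).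
Let d10_fun (l : L1) : L0 := F0 (mf_d10 Y (F1' l).1, v *: (F1' l).2).

Lemma transport_d01_linear : linear d01_fun.
Proof.
move=> a l l'; rewrite /d01_fun (linearP F0') -(linearP F1); congr (F1 _).
by congr pair; rewrite -(linearP (mf_d01 Y)).
Qed.
Lemma transport_d10_linear : linear d10_fun.
Proof.
move=> a l l'; rewrite /d10_fun (linearP F1') -(linearP F0); congr (F0 _).
congr pair; first by rewrite -(linearP (mf_d10 Y)).
rewrite -[LHS]/(v *: (a *: (F1' l).2 + (F1' l').2)).
rewrite -[RHS]/(a *: (v *: (F1' l).2) + v *: (F1' l').2) scalerDr !scalerA.
by rewrite mulrC.
Qed.
Let d01 : {linear L0 -> L1} := mk_linear transport_d01_linear.
Let d10 : {linear L1 -> L0} := mk_linear transport_d10_linear.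

Lemma transport_d2_0 l : d10 (d01 l) = v *: l.
Proof.
rewrite -[LHS]/(F0 (mf_d10 Y (F1' (F1 (mf_d01 Y (F0' l).1, (F0' l).2))).1,
  v *: (F1' (F1 (mf_d01 Y (F0' l).1, (F0' l).2))).2)) F1K.
rewrite -[LHS]/(F0 (mf_d10 Y (mf_d01 Y (F0' l).1), v *: (F0' l).2)) mf_d2_0.
rewrite -[X in F0 X]/(v *: ((F0' l).1, (F0' l).2)) -surjective_pairing.
by rewrite (linearZ_LR F0) F0'K.
Qed.
Lemma transport_d2_1 l : d01 (d10 l) = v *: l.
Proof.
rewrite -[LHS]/(F1 (mf_d01 Y (F0' (F0 (mf_d10 Y (F1' l).1, v *: (F1' l).2))).1,
  (F0' (F0 (mf_d10 Y (F1' l).1, v *: (F1' l).2))).2)) F0K.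
rewrite -[LHS]/(F1 (mf_d01 Y (mf_d10 Y (F1' l).1), v *: (F1' l).2)) mf_d2_1.
rewrite -[X in F1 X]/(v *: ((F1' l).1, (F1' l).2)) -surjective_pairing.
by rewrite (linearZ_LR F1) F1'K.
Qed.

(* [Y] is replaced by its sum with the contractible factorization on [C]. *)
Lemma transport_H0_iso : exists (d01' : {linear L0 -> L1}) (d10' : {linear L1 -> L0})
    (h0 : forall l, d10' (d01' l) = v *: l) (h1 : forall l, d01' (d10' l) = v *: l),
  @H0_iso k (MFinf rho v) (MFact pL0 pL1 h0 h1) Y.
Proof.
exists d01, d10, transport_d2_0, transport_d2_1.
set Z := MFact _ _ _ _.
have f0L : linear (fun l => (F0' l).1) by move=> a l l'; rewrite linearP.
have f1L : linear (fun l => (F1' l).1) by move=> a l l'; rewrite linearP.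
have g0L : linear (fun m => F0 (m, 0)).
  move=> a l l'; rewrite -linearP; congr (F0 _).
  by rewrite -[RHS]/(a *: l + l', a *: 0 + 0) scaler0 addr0.
have g1L : linear (fun m => F1 (m, 0)).
  move=> a l l'; rewrite -linearP; congr (F1 _).
  by rewrite -[RHS]/(a *: l + l', a *: 0 + 0) scaler0 addr0.
have h1L : linear (fun l => F0 (0, - (F1' l).2)).
  move=> a l l'; rewrite (linearP F1') -(linearP F0); congr (F0 _).
  rewrite -[RHS]/(a *: 0 + 0, a *: - (F1' l).2 + - (F1' l').2) scaler0 addr0.
  by rewrite scalerN -opprD.
pose f : mf_hom rho Z Y := even_hom rho (X := Z) (Y := Y) (mk_linear f0L) (mk_linear f1L).
pose g : mf_hom rho Y Z := even_hom rho (X := Y) (Y := Z) (mk_linear g0L) (mk_linear g1L).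
pose h : mf_hom rho Z Z := odd_hom rho (X := Z) (Y := Z) \0 (mk_linear h1L).
exists f, g; split.
- split; first exact: even_hom_homog.
  apply: even_hom_closed => l.
    rewrite -[LHS]/(F1' (F1 (mf_d01 Y (F0' l).1, (F0' l).2))).1 F1K.
    by [].
  rewrite -[LHS]/(F0' (F0 (mf_d10 Y (F1' l).1, v *: (F1' l).2))).1 F0K.
  by [].
- split; first exact: even_hom_homog.
  apply: even_hom_closed => l.
    rewrite -[RHS]/(F1 (mf_d01 Y (F0' (F0 (l, 0))).1, (F0' (F0 (l, 0))).2)) F0K.
    by [].
  rewrite -[RHS]/(F0 (mf_d10 Y (F1' (F1 (l, 0))).1, v *: (F1' (F1 (l, 0))).2)).
  by rewrite F1K -[(_, _).2]/(0 : C) scaler0.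
- exists h; first exact: odd_hom_homog.
  apply: linear_ext => -[p q]; rewrite -[RHS]/(mf_dhom h (p, q)) odd_hom_d.
  rewrite -[LHS]/(F0 ((F0' p).1, 0) - p, F1 ((F1' q).1, 0) - q).
  rewrite -[RHS]/(d10 0 + F0 (0, - (F1' (d01 p)).2),
    d01 (F0 (0, - (F1' q).2)) + 0) linear0 add0r addr0.
  rewrite -[F1' (d01 p)]/(F1' (F1 _)) F1K.
  rewrite -[d01 (F0 (0, - (F1' q).2))]/(F1 (mf_d01 Y (F0' (F0 (0, - (F1' q).2))).1,
    (F0' (F0 (0, - (F1' q).2))).2)) F0K.
  rewrite -[(0, - (F1' q).2).1]/(0 : mf0 Y) -[(0, - (F1' q).2).2]/(- (F1' q).2) linear0.
  congr pair.
    rewrite -{2}[p]F0'K -(linearB F0); congr (F0 _).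
    by case: (F0' p) => a b; congr pair; rewrite /= ?subrr ?sub0r.
  rewrite -{2}[q]F1'K -(linearB F1); congr (F1 _).
  by case: (F1' q) => a b; congr pair; rewrite /= ?subrr ?sub0r.
exists 0; first exact: (raddf0 (mf_part_lin rho Y Y true)).
apply: linear_ext => -[p q]; rewrite (raddf0 (cx_d (mf_hom rho Y Y))).
rewrite -[RHS]/(0 : mf_tot Y).
rewrite -[LHS]/((F0' (F0 (p, 0))).1 - p, (F1' (F1 (q, 0))).1 - q) F0K F1K.
by rewrite !subrr.
Qed.

End Transport.

(** * Infinite rank: the Eilenberg swindle *)

Notation free R S := (pmod (free_presentation R S)).

Section Swindle.
Variables (B Q : comPzRingType) (c : {rmorphism B -> Q}) (S : Type).
Local Notation V := (free B (S * nat)).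
Local Notation L := (tens c V).
Local Notation gen s n := (ti c (fgen B (s, n) : V) : L).

Lemma swindle_ext (N : lmodType Q) (h : S -> nat -> N) :
  {f : {linear L -> N} | forall s n, f (gen s n) = h s n}.
Proof.
pose g0 := @free_lift B (S * nat) (restr c N) (fun p => h p.1 p.2).
have gB : zmod_morphism (g0 : V -> N) by exact: (raddfB g0).
have gZ : semilinear c (mk_additive gB) by exact: (@semilinear_restr _ _ c V N g0).
have [f fE] := tens_extend gZ; exists f => s n.
by rewrite fE -[LHS]/(g0 (fgen B (s, n))) free_liftE.
Qed.

Lemma swindle_uniq (N : lmodType Q) (f g : {linear L -> N}) :
  (forall s n, f (gen s n) = g (gen s n)) -> f =1 g.
Proof.
move=> e; apply: tens_lext => u.
have fL (h : {linear L -> N}) : linear (h \o ti c : V -> restr c N).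
  move=> a t t'; rewrite -[LHS]/(h (ti c (a *: t + t'))).
  by rewrite -[RHS]/(c a *: h (ti c t) + h (ti c t')) raddfD tiZ linearP.
have := @free_ext B (S * nat) (restr c N) (mk_linear (fL f)) (mk_linear (fL g)).
by apply=> -[s n]; exact: e.
Qed.

Variables (P : lmodType Q) (pP : projective P) (h : S -> P).
Hypothesis h_surj : forall y, exists s, h s = y.

(** The free module [W] on [S] splits as [P] plus a complement, and [L] is a sum of countably many
    copies of [W]. [La] moves each summand [P] one copy up, which makes room for one more [P] in
    copy [0]; [Ps] moves them back. *)
Lemma swindle : exists (F : {linear (P * L)%type -> L}) (F' : {linear L -> (P * L)%type}),
  cancel F F' /\ cancel F' F.
Proof.
pose W := free Q S; pose p : {linear W -> P} := free_lift h.
have psurj y : exists z, p z = y.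
  by have [s <-] := h_surj y; exists (fgen Q s); rewrite free_liftE.
have [sc scE] := @pP W P p (idfun : {linear P -> P}) psurj.
have psc m : p (sc m) = m by exact: (scE m).
have [inn innE] : exists inn : nat -> {linear W -> L},
    forall n s, inn n (fgen Q s) = gen s n.
  by exists (fun n => free_lift (fun s => gen s n)) => n s; rewrite free_liftE.
have [La LaE] := swindle_ext (fun s n =>
  inn n (fgen Q s - sc (p (fgen Q s))) + inn n.+1 (sc (p (fgen Q s)))).
have [Ps PsE] := swindle_ext (N := (P * L)%type) (fun s n =>
  if n is n'.+1 then
    (0, inn n (fgen Q s - sc (p (fgen Q s))) + inn n' (sc (p (fgen Q s))))
  else (p (fgen Q s), inn 0%N (fgen Q s - sc (p (fgen Q s))))).
have La_in n m : La (inn n m) = inn n (m - sc (p m)) + inn n.+1 (sc (p m)).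
  have := @free_ext Q S L (La \o inn n)
    ((inn n \o (idfun \- (sc \o p))) \+ (inn n.+1 \o (sc \o p))).
  apply=> s; rewrite -[LHS]/(La (inn n (fgen Q s))) innE LaE.
  by [].
have Ps_in0 m : Ps (inn 0%N m) = (p m, inn 0%N (m - sc (p m))).
  have fL : linear (fun m => (p m, inn 0%N (m - sc (p m))) : P * L).
    move=> a t t'; congr pair; first by rewrite linearP.
    rewrite -[RHS]/(a *: inn 0%N (t - sc (p t)) + inn 0%N (t' - sc (p t'))).
    rewrite -(linearP (inn 0%N)) (linearP p) (linearP sc) scalerBr; congr (inn _ _).
    by abel.
  have := @free_ext Q S (P * L)%type (Ps \o inn 0%N) (mk_linear fL).
  by apply=> s; rewrite -[LHS]/(Ps (inn 0%N (fgen Q s))) innE PsE.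
have Ps_inS n m : Ps (inn n.+1 m) = (0, inn n.+1 (m - sc (p m)) + inn n (sc (p m))).
  have fL : linear (fun m => (0, inn n.+1 (m - sc (p m)) + inn n (sc (p m))) : P * L).
    move=> a t t'; rewrite -[RHS]/(a *: 0 + 0,
      a *: (inn n.+1 (t - sc (p t)) + inn n (sc (p t)))
      + (inn n.+1 (t' - sc (p t')) + inn n (sc (p t')))).
    congr pair; first by rewrite scaler0 addr0.
    rewrite (linearP p) (linearP sc) (linearP (inn n)) scalerDr.
    rewrite -(linearZ_LR (inn n.+1)) addrACA -(linearD (inn n.+1)) scalerBr.
    by congr (inn _ _ + _); abel.
  have := @free_ext Q S (P * L)%type (Ps \o inn n.+1) (mk_linear fL).
  by apply=> s; rewrite -[LHS]/(Ps (inn n.+1 (fgen Q s))) innE PsE.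
have FL : linear (fun t : P * L => inn 0%N (sc t.1) + La t.2).
  move=> a t t'; rewrite -[(a *: t + t').1]/(a *: t.1 + t'.1).
  rewrite -[(a *: t + t').2]/(a *: t.2 + t'.2) (linearP sc) (linearP (inn _)).
  by rewrite (linearP La) scalerDr; abel.
pose F : {linear (P * L)%type -> L} := mk_linear FL.
have FE m l : F (m, l) = inn 0%N (sc m) + La l by [].
have pm m : p (m - sc (p m)) = 0 by rewrite (linearB p) psc subrr.
have FPs l : F (Ps l) = l.
  apply: (swindle_uniq (f := F \o Ps) (g := idfun)) => s n.
  rewrite -[LHS]/(F (Ps (gen s n))) PsE -[RHS]/(gen s n) -innE; set m := fgen Q s.
  case: n => [|n]; rewrite FE.
    rewrite La_in pm (linear0 sc) (linear0 (inn 1%N)) subr0 addr0 -(linearD (inn 0%N)).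
    by congr (inn _ _); abel.
  rewrite (linear0 sc) (linear0 (inn 0%N)) add0r (linearD La) !La_in pm psc.
  rewrite !(linear0 sc) (linear0 (inn n.+2)) subr0 addr0 subrr.
  rewrite (linear0 (inn n)) add0r -(linearD (inn n.+1)).
  by congr (inn _ _); abel.
have PsF t : Ps (F t) = t.
  case: t => m l; rewrite FE (linearD Ps) Ps_in0 psc subrr (linear0 (inn 0%N)).
  have -> : Ps (La l) = (0, l).
    have iL : linear (fun l : L => (0, l) : P * L).
      move=> a u u'; rewrite -[RHS]/(a *: 0 + 0, a *: u + u').
      by rewrite scaler0 addr0.
    apply: (swindle_uniq (f := Ps \o La) (g := mk_linear iL)) => s n.
    rewrite -[LHS]/(Ps (La (gen s n))) LaE -[RHS]/(0 : P, gen s n) -innE.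
    set q := fgen Q s; rewrite (linearD Ps) Ps_inS psc subrr (linear0 (inn n.+1)).
    rewrite add0r; case: n => [|n].
      rewrite Ps_in0 pm (linear0 sc) subr0 -[LHS]/(0 + 0,
        inn 0%N (q - sc (p q)) + inn 0%N (sc (p q))) addr0 -(linearD (inn 0%N)).
      by rewrite subrK.
    rewrite Ps_inS pm (linear0 sc) subr0 (linear0 (inn n)) addr0.
    rewrite -[LHS]/(0 + 0, inn n.+1 (q - sc (p q)) + inn n.+1 (sc (p q))) addr0.
    by rewrite -(linearD (inn n.+1)) subrK.
  by rewrite -[LHS]/(m + 0, 0 + l) addr0 add0r.
by exists F, Ps.
Qed.

End Swindle.

(** * Reduction of a factorization modulo x *)

Section ReductionHomotopy.
Variables (B : comPzRingType) (T P : lmodType B) (w : B).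
Variables (D al et yN gm : {linear T -> T}) (s : {linear P -> T}) (ev : {linear T -> P}).
Hypothesis DD : forall t, D (D t) = w *: t.
Hypothesis Dal : forall t, D (al t) + al (D t) = yN t.
Hypothesis etyN : forall t, et (yN t) = t.
Hypothesis ets : forall p, et (s p) = 0.
Hypothesis evs : forall p, ev (s p) = p.
Hypothesis sev : forall t, s (ev t) = t - yN (et t).
Hypothesis DyN : forall t, D (yN t) = yN (D t).
Hypothesis gmD : forall t, gm (D t) = - D (gm t).
Hypothesis gmal : forall t, gm (al t) = - al (gm t).
Hypothesis gmyN : forall t, gm (yN t) = yN (gm t).
Hypothesis gmK : forall t, gm (gm t) = t.

Definition red_cmp (t : T * T) : P := ev (gm (al t.1) + t.2).
Definition red_d (p : P) : P := ev (D (s p)).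

(** As [y] is injective on [T], its quotient [P] is equivalent to the cone of [y]. The map [al]
    contracts [y], so this cone splits into [T] and a shift of [T]. [h1] and [h2] write this
    splitting out; one composite is strictly the identity, so only one homotopy occurs. *)
Lemma red_homotopy : exists (h1 : {linear P -> (T * T)%type})
    (h2 : {linear (T * T)%type -> (T * T)%type}),
  [/\ forall p, h1 (red_d p) = (D (h1 p).1, D (h1 p).2),
      forall t, h1 (red_cmp t) - t = (D (h2 t).1, D (h2 t).2) + h2 (D t.1, D t.2)
    & forall p, red_cmp (h1 p) = p].
Proof.
have alD t : al (D t) = yN t - D (al t) by rewrite -Dal; abel.
have Dg t : D (gm t) = - gm (D t) by rewrite gmD opprK.
have ag t : al (gm t) = - gm (al t) by rewrite gmal opprK.
have etDyN t : et (D (yN t)) = D t by rewrite DyN etyN.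
pose wf (t : T * T) := t.2 + gm (al t.1).
have h1L : linear (fun p => (- gm (et (D (s p))), s p - al (et (D (s p))))).
  move=> a p q; rewrite (linearP s) (linearP D) (linearP et) (linearP gm) (linearP al).
  rewrite -[RHS]/(a *: - gm (et (D (s p))) - gm (et (D (s q))),
    a *: (s p - al (et (D (s p)))) + (s q - al (et (D (s q))))).
  by rewrite scalerN scalerBr opprD; congr pair; abel.
have h2L : linear (fun t => (- gm (et (wf t)), - al (et (wf t)))).
  move=> a t t'; have -> : wf (a *: t + t') = a *: wf t + wf t'.
    rewrite /wf -[(a *: t + t').1]/(a *: t.1 + t'.1).
    rewrite -[(a *: t + t').2]/(a *: t.2 + t'.2) (linearP al) (linearP gm).
    by rewrite scalerDr; abel.
  rewrite (linearP et) (linearP gm) (linearP al).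
  rewrite -[RHS]/(a *: - gm (et (wf t)) - gm (et (wf t')),
    a *: - al (et (wf t)) - al (et (wf t'))).
  by rewrite !scalerN !opprD.
exists (mk_linear h1L), (mk_linear h2L).
have h1E p : mk_linear h1L p = (- gm (et (D (s p))), s p - al (et (D (s p)))) by [].
have h2E t : mk_linear h2L t = (- gm (et (wf t)), - al (et (wf t))) by [].
split=> [p|[t1 te]|p].
- rewrite !h1E /red_d sev -[(_, _).1]/(- gm (et (D (s p)))).
  rewrite -[(_, _).2]/(s p - al (et (D (s p)))).
  set z := et (D (s p)).
  have -> : et (D (D (s p) - yN z)) = - D z.
    by rewrite (linearB D) DD (linearB et) (linearZ_LR et) ets scaler0 etDyN sub0r.
  rewrite (linearN gm) (linearN al) (linearN D) (linearB D) Dg !opprK alD.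
  by congr pair; abel.
- have rc : red_cmp (t1, te) = ev (wf (t1, te)) by rewrite /red_cmp /wf addrC.
  have wD : wf (D t1, D te) = D (wf (t1, te)) + gm (yN t1).
    rewrite -[LHS]/(D te + gm (al (D t1))) -[wf (t1, te)]/(te + gm (al t1)).
    by rewrite (linearD D) alD (linearB gm) Dg; abel.
  rewrite h1E !h2E rc wD.
  have uE : wf (t1, te) = te + gm (al t1) by [].
  set u := wf (t1, te) in uE *; rewrite sev.
  have -> : et (D (u - yN (et u))) = et (D u) - D (et u).
    by rewrite (linearB D) (linearB et) etDyN.
  rewrite -[LHS]/(- gm (et (D u) - D (et u)) - t1,
    u - yN (et u) - al (et (D u) - D (et u)) - te).
  rewrite -[RHS]/(D (- gm (et u)) - gm (et (D u + gm (yN t1))),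
    D (- al (et u)) - al (et (D u + gm (yN t1)))).
  rewrite gmyN (linearD et (D u)) etyN !(linearN D).
  rewrite (linearB gm (et (D u))) (linearB al (et (D u))).
  rewrite (linearD gm (et (D u))) gmK (linearD al (et (D u))) ag.
  have teE : te = u - gm (al t1) by rewrite uE addrK.
  by rewrite Dg alD opprK [in LHS]teE; congr pair; abel.
rewrite h1E /red_cmp -[(_, _).1]/(- gm (et (D (s p)))).
rewrite -[(_, _).2]/(s p - al (et (D (s p)))) (linearN al) (linearN gm) ag.
rewrite (linearN gm) gmK !opprK.
rewrite addrCA subrr addr0.
exact: evs.
Qed.
End ReductionHomotopy.

Lemma top_semilinear (B Q Q' : comPzRingType) (c : {rmorphism B -> Q})
    (c' : {rmorphism B -> Q'}) (V : lmodType B) (S : {additive Q -> Q'})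
    (SZ : forall q r, S (q * c r) = S q * c' r) r (m : tens c V) :
  @top B Q Q' c c' V S SZ (c r *: m) = c' r *: top SZ m.
Proof.
elim/tens_span: m => [|q u m IH]; first by rewrite !(scaler0, raddf0).
rewrite scalerDr !(raddfD (top SZ)) scalerDr IH; congr (_ + _).
rewrite pgenZ -/(tin c (c r * q) u) -/(tin c q u) !top_in mulrC SZ mulrC.
by rewrite [LHS]tinE -scalerA -tinE.
Qed.

Lemma top_comp_eq (B Q Q' : comPzRingType) (c : {rmorphism B -> Q})
    (c' : {rmorphism B -> Q'}) (V : lmodType B)
    (S : {additive Q -> Q'}) (R : {additive Q' -> Q}) SZ RZ :
  (forall q, R (S q) = q) ->
  forall m : tens c V, @top _ _ _ c' c V R RZ (@top _ _ _ c c' V S SZ m) = m.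
Proof.
move=> RS m; apply: (tens_ext (f := top RZ \o top SZ) (g := idfun)) => q u.
by rewrite -[LHS]/(top RZ (top SZ (tin c q u))) !top_in RS.
Qed.

(* [X = (Y/xY)[1]] over [B]: the ring [A'] plays the role of [Q/xQ]. *)
Section ReductionModX.
Variables (k : fieldType) (B Q : comPzRingType) (A : xalg B Q).
Variables (rhoQ : {rmorphism k -> Q}) (w : B) (v : Q).
Hypothesis vE : v = xc A w + xx A * xy A.
Local Notation c := (xc A).
Local Notation x := (xx A).
Local Notation y := (xy A).
Variables (A' : comPzRingType) (cA : {rmorphism B -> A'}).
Variables (jA : {additive A' -> Q}) (rA : {additive Q -> A'}).
Hypothesis jAc : forall p r, jA (p * cA r) = jA p * c r.
Hypothesis rAc : forall q r, rA (q * c r) = rA q * cA r.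
Hypothesis rAj : forall p, rA (jA p) = p.
Hypothesis jAr : forall q, jA (rA q) = q - x * xdx A q.
Variable V : lmodType B.
Hypothesis pN : projective (restr cA (tens cA V)).
Local Notation MV := (tens_xmod A V).
Local Notation L := (tens c V).
Local Notation N := (restr cA (tens cA V)).
Variables (p0 p1 : projective L) (d01 d10 : {linear L -> L}).
Hypothesis d2_0 : forall u, d10 (d01 u) = v *: u.
Hypothesis d2_1 : forall u, d01 (d10 u) = v *: u.
Local Notation Y := (ext_mfact p0 p1 d2_0 d2_1).
Local Notation MY := (ext_xmod A V V).

Definition jN : {additive N -> L} := top jAc.
Definition rN : {additive L -> N} := top rAc.

Lemma jN_Z r n : jN (r *: n) = c r *: jN n.
Proof. exact: top_semilinear. Qed.
Lemma rN_Z r m : rN (c r *: m) = r *: rN m.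
Proof. exact: top_semilinear. Qed.
Lemma rN_jN n : rN (jN n) = n.
Proof. exact: top_comp_eq. Qed.
Lemma jN_rN m : jN (rN m) = ex MV m.
Proof.
apply: (tens_ext (f := (top jAc : {additive tens cA V -> tens c V}) \o top rAc)
                 (g := ex MV)) => q u.
rewrite -[LHS]/(top jAc (top rAc (tin c q u))) !top_in jAr exE.
rewrite -[mdx MV _]/(top (xdxc A) (tin c q u)) top_in.
rewrite [in RHS](tinE c (xdx A q)) scalerA -tinE -scaleN1r pgenZ mulN1r.
by rewrite -/(tin c (- (x * xdx A q)) u) -tinD.
Qed.
Lemma rN_x m : rN (x *: m) = 0.
Proof. by rewrite -[LHS]rN_jN jN_rN ex_x raddf0. Qed.

Definition red_fun (f : {linear L -> L}) (n : N) : N := rN (f (jN n)).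
Lemma red_linear f : linear (red_fun f).
Proof.
move=> a m n; rewrite /red_fun (raddfD jN) jN_Z (linearP f) (raddfD rN) rN_Z.
by [].
Qed.
Definition red f : {linear N -> N} := mk_linear (@red_linear f).

Lemma red_d2 (f g : {linear L -> L}) : (forall u, f (g u) = v *: u) ->
  forall n, red f (red g n) = w *: n.
Proof.
move=> fg n; rewrite -[LHS]/(rN (f (jN (rN (g (jN n)))))) jN_rN exE (linearB f).
rewrite (linearZ_LR f) raddfB rN_x subr0 fg (v_scaleE vE) raddfD rN_x addr0.
by rewrite rN_Z rN_jN.
Qed.

(** The exchanged order of [d2_1] and [d2_0] is the shift, taken without a sign. It makes [bX], the
    inclusion of [Y/xY] back into [Y], an odd map, as the comparison requires of the image of
    [X e]. *)
Definition red_mfact : mfact w := MFact pN pN (red_d2 d2_1) (red_d2 d2_0).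
Local Notation X := red_mfact.
Local Notation T := (mf_tot X).
Local Notation NY := (mf_tot Y).
Local Notation P := (V * V)%type.
Local Notation d := (mf_d Y).
Local Notation G := (mf_sg Y).
Local Notation e := (xe MY : NY -> P).
Local Notation i := (xi MY : P -> NY).
Local Notation dx := (mdx MY : NY -> NY).
Local Notation dy := (mdy MY : NY -> NY).
Local Notation exY := (ex MY : NY -> NY).

Definition bX_fun (t : T) : NY := (jN t.2, jN t.1).
Lemma bX_B : zmod_morphism bX_fun.
Proof.
move=> s t; rewrite -[RHS]/(jN s.2 - jN t.2, jN s.1 - jN t.1).
by rewrite -!(raddfB jN).
Qed.
Definition bX : {additive T -> NY} := mk_additive bX_B.
Definition rX_fun (m : NY) : T := (rN m.2, rN m.1).
Lemma rX_B : zmod_morphism rX_fun.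
Proof.
move=> s t; rewrite -[RHS]/(rN s.2 - rN t.2, rN s.1 - rN t.1).
by rewrite -!(raddfB rN).
Qed.
Definition rX : {additive NY -> T} := mk_additive rX_B.

Lemma bXE t : bX t = (jN t.2, jN t.1). Proof. by []. Qed.
Lemma rXE m : rX m = (rN m.2, rN m.1). Proof. by []. Qed.
Lemma bX_Z : semilinear c bX.
Proof. by move=> r t; rewrite bXE !jN_Z. Qed.
Lemma rX_Z r m : rX (c r *: m) = r *: rX m.
Proof. by rewrite rXE !rN_Z. Qed.
Lemma rb t : rX (bX t) = t.
Proof. by rewrite rXE !rN_jN; case: t. Qed.
Lemma br m : bX (rX m) = exY m.
Proof. by rewrite bXE !jN_rN; case: m. Qed.
Lemma r_x m : rX (x *: m) = 0.
Proof. by rewrite rXE !rN_x. Qed.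
Lemma r_ex m : rX (exY m) = rX m.
Proof. by rewrite exE raddfB r_x subr0. Qed.
Lemma ex_b t : exY (bX t) = bX t.
Proof. by rewrite -br rb. Qed.
Lemma dx_b t : dx (bX t) = 0.
Proof. by rewrite -ex_b dx_ex. Qed.

Lemma mf_d_red t : mf_d X t = rX (d (bX t)).
Proof. by []. Qed.

Lemma sg_x m : G (x *: m) = x *: G m. Proof. by rewrite linearZ_LR. Qed.
Lemma ex_sg m : exY (G m) = G (exY m).
Proof. by rewrite !exE dx_sg (linearB G) sg_x. Qed.

Lemma rd_ex m : rX (d (exY m)) = rX (d m).
Proof. by rewrite exE (linearB d) (linearZ_LR d) raddfB r_x subr0. Qed.
Lemma rdxd_ex m : rX (dx (d (exY m))) = rX (dx (d m)) - rX (d (dx m)).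
Proof.
by rewrite exE (linearB d) (linearZ_LR d) (raddfB (mdx MY)) mdx_x raddfB.
Qed.

Lemma red_end (f : NY -> NY) : zmod_morphism f ->
  (forall r m, f (c r *: m) = c r *: f m) ->
  {g : {linear T -> T} | forall t, g t = rX (f (bX t))}.
Proof.
move=> fB fZ; have gL : linear (fun t => rX (f (bX t))).
  have fD m n : f (m + n) = f m + f n by exact: (raddfD (mk_additive fB)).
  by move=> a s t; rewrite (raddfD bX) bX_Z fD fZ (raddfD rX) rX_Z.
by exists (mk_linear gL).
Qed.

Lemma H0_iso_red : @H0_iso k (MFinf rhoQ v) (st_obj vE X) Y.
Proof.
have [D DE] : {g : {linear T -> T} | forall t, g t = rX (d (bX t))}.
  by exists (mf_d X).
have [al alE] : {g : {linear T -> T} | forall t, g t = rX (dx (d (bX t)))}.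
  apply: (@red_end (fun m => dx (d m))) => [m n|r m].
    by rewrite (linearB d) (raddfB (mdx MY)).
  by rewrite (linearZ_LR d) mdxc.
have [et etE] : {g : {linear T -> T} | forall t, g t = rX (dy (bX t))}.
  apply: (@red_end dy) => [m n|r m]; first exact: raddfB.
  exact: (@mdyc _ _ _ MY).
have [yN yNE] : {g : {linear T -> T} | forall t, g t = rX (y *: bX t)}.
  apply: (@red_end (fun m => y *: m)) => [m n|r m]; first exact: scalerBr.
  by rewrite !scalerA mulrC.
have [gm gmE] : {g : {linear T -> T} | forall t, g t = rX (G (bX t))}.
  by apply: (@red_end G) => [m n|r m]; rewrite ?linearB ?linearZ_LR.
have [s sE] : {s : {linear P -> T} | forall p, s p = rX (i p)}.
  have sL : linear (fun p : P => rX (i p)).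
    by move=> a p q; rewrite (raddfD (xi MY)) xiZ (raddfD rX) rX_Z.
  by exists (mk_linear sL).
have [ev evE] : {ev : {linear T -> P} | forall t, ev t = e (bX t)}.
  have evL : linear (fun t => e (bX t)).
    by move=> a t u; rewrite (raddfD bX) bX_Z (raddfD (xe MY)) xeZ xev_c.
  by exists (mk_linear evL).
have exy m : exY (y *: m) = y *: exY m by exact: (@ex_y _ _ _ MY m).
have edy t : exY (dy (bX t)) = dy (bX t) by rewrite -ex_b ex_dy_ex.
have esg t : exY (G (bX t)) = G (bX t) by rewrite ex_sg ex_b.
have dg m : d (G m) = - G (d m) by exact: mf_d_sg.
have [| | | | | | | | | | |h1 [h2 [h1d h2d h3d]]] :=
    @red_homotopy B T P w D al et yN gm s ev.
- by move=> t; rewrite !DE br rd_ex mf_dd (v_scaleE vE) raddfD r_x addr0 rX_Z rb.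
- move=> t; rewrite !DE !alE yNE !br rd_ex rdxd_ex mf_dd (v_scaleE vE).
  rewrite (raddfD (mdx MY)) mdxc dx_b scaler0 add0r mdx_x; abel.
- by move=> t; rewrite etE yNE br exy ex_b (@mdy_y _ _ _ MY) rb.
- by move=> p; rewrite etE sE br (@ex_i _ _ _ MY) mdy_i raddf0.
- by move=> p; rewrite evE sE br e_ex xei.
- move=> t; rewrite sE evE yNE etE br edy -{2}[t]rb -(raddfB rX); congr (rX _).
  by rewrite -{2}ex_b ex_decomp ex_b addrK.
- move=> t; rewrite !DE !yNE !br rd_ex -exy r_ex (linearZ_LR d).
  by [].
- by move=> t; rewrite !gmE !DE !br rd_ex -ex_sg r_ex dg raddfN opprK.
- move=> t; rewrite !gmE !alE !br -ex_sg r_ex rdxd_ex dx_sg dx_b.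
  rewrite (linear0 G) (linear0 d) raddf0 subr0 dg !(raddfN (mdx MY)) dx_sg.
  by rewrite raddfN opprK.
- move=> t; rewrite !gmE !yNE !br exy esg ex_b (linearZ_LR G).
  by [].
- by move=> t; rewrite !gmE br esg mf_sgK rb.
have bodd j t : bX (mf_pr X j t) = mf_pr Y (~~ j) (bX t).
  case: t => t0 t1; case: j.
    by rewrite -[LHS]/(jN t1, jN 0) (raddf0 jN).
  by rewrite -[LHS]/(jN 0, jN t0) (raddf0 jN).
have bcl t : ex MY (d (bX t) - bX (mf_d X t)) = 0.
  by rewrite mf_d_red br (raddfB (ex MY)) ex_ex subrr.
have cE t : base_cmp (p0 := p0) (p1 := p1) (d2_0 := d2_0) (d2_1 := d2_1) bX_Z t = red_cmp al gm ev t.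
  case: t => t1 te; rewrite base_cmpE /red_cmp evE (raddfD bX) (raddfD (xe MY)).
  congr (_ + _); rewrite gmE alE !br /cmp1 mf_d_red br.
  by rewrite (raddfB (mdx MY)) dx_ex subr0 e_ex -ex_sg e_ex.
have dE p : base_d p0 p1 d2_0 d2_1 p = red_d D s ev p.
  by rewrite base_dE /red_d evE DE sE !br e_ex (@ex_i _ _ _ MY).
have DX t : mf_d X t = D t by rewrite DE.
apply: (H0_iso_stabilization rhoQ vE (b := bX) (bZ := bX_Z) bodd bcl
  (h1 := h1) (h2 := h2) (h3 := \0)).
- by move=> p; rewrite dE h1d -[RHS]/(mf_d X (h1 p).1, mf_d X (h1 p).2) !DX.
- move=> t; rewrite cE h2d -[RHS]/((mf_d X (h2 t).1, mf_d X (h2 t).2)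
    + h2 (mf_d X t.1, mf_d X t.2)).
  by rewrite !DX.
move=> p; rewrite cE h3d subrr -[X in _ = X]/(base_d p0 p1 d2_0 d2_1 0 + 0).
by rewrite linear0 addr0.
Qed.

End ReductionModX.

(** * The polynomial ring in two variables *)

Section PolyTensorProjective.
Variables (R : comNzRingType) (V : lmodType R).
Local Notation cp := (polyC : {rmorphism R -> {poly R}}).
Local Notation N := (restr cp (tens cp V)).

Lemma sum_coef_widen (M : lmodType R) (g : nat -> {linear V -> M}) (p : {poly R}) u n :
  (size p <= n)%N -> \sum_(i < size p) p`_i *: g i u = \sum_(i < n) p`_i *: g i u.
Proof.
move=> pn; rewrite (big_ord_widen n (fun i => p`_i *: g i u) pn) big_mkcond.
apply: eq_bigr => i _; case: ifP => // /negbT; rewrite -leqNgt => h.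
by rewrite nth_default ?scale0r.
Qed.

(** Over [R] the module is the direct sum of the copies ['X^n (x) V]. A lift is chosen on each copy
    and extended by summing over coefficients. *)
Lemma poly_tens_projective : projective V -> projective (restr cp (tens cp V)).
Proof.
move=> pV M L p f ps.
have fL n : linear (fun u => f (tin cp 'X^n u : N)).
  move=> a s t; rewrite -(linearP f); congr (f _).
  rewrite -[LHS]/(mk_additive (tin_additive cp (V := V) 'X^n) (a *: s + t)) raddfD.
  congr (_ + _); rewrite -[LHS]/(tin cp 'X^n (a *: s)) -tin_balanced mulrC.
  by rewrite [LHS]tinE -scalerA -tinE.
have [g gE] : exists g : nat -> {linear V -> M},
    forall n u, p (g n u) = f (tin cp 'X^n u).
  have /choice[g gE] n : exists h : {linear V -> M},
      forall u, p (h u) = f (tin cp 'X^n u).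
    by have [h hE] := pV M L p (mk_linear (fL n)) ps; exists h => u; exact: (hE u).
  by exists g.
pose phi (q : {poly R}) u := \sum_(i < size q) q`_i *: g i u.
have phiE n (q : {poly R}) u : (size q <= n)%N -> phi q u = \sum_(i < n) q`_i *: g i u.
  exact: sum_coef_widen.
have bal : balanced cp phi.
  split=> [u q q'|q u u'|q r u].
  - pose n := maxn (size q) (maxn (size q') (size (q - q'))).
    rewrite (phiE n) ?(phiE n q) ?(phiE n q') ?leq_max ?leqnn ?orbT // -sumrB.
    by apply: eq_bigr => i _; rewrite coefB scalerBl.
  - by rewrite -sumrB; apply: eq_bigr => i _; rewrite linearB scalerBr.
  pose n := maxn (size q) (size (q * r%:P)).
  rewrite (phiE n) ?(phiE n q) ?leq_max ?leqnn ?orbT //; apply: eq_bigr => i _.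
  by rewrite coefMC linearZ_LR scalerA.
have [h hE] := tlift_exists bal.
have hL : linear (h : N -> M).
  move=> a u u'; rewrite raddfD; congr (_ + _).
  elim/tens_span: u => [|q t u IH]; first by rewrite !(scaler0, raddf0).
  rewrite -[a *: _]/(cp a *: (tin cp q t + u)) (scalerDr (cp a)) (raddfD h).
  rewrite (raddfD h (tin cp q t)) (scalerDr a (h (tin cp q t))).
  rewrite -[h (cp a *: u)]/(h (a *: (u : N))) IH; congr (_ + _).
  rewrite pgenZ -/(tin cp (cp a * q) t) -/(tin cp q t) !hE /phi.
  pose n := maxn (size q) (size (cp a * q)).
  rewrite -/(phi _ _) -/(phi _ _) (phiE n) ?(phiE n q) ?leq_max ?leqnn ?orbT //.
  rewrite scaler_sumr; apply: eq_bigr => i _.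
  by rewrite coefCM scalerA.
exists (mk_linear hL) => u; rewrite -[LHS]/(p (h u)).
move: u; apply: (tens_ext (f := p \o h) (g := f : {additive tens cp V -> L})) => q t.
rewrite -[LHS]/(p (h (tin cp q t))) hE /phi linear_sum.
have -> : tin cp q t = \sum_(i < size q) q`_i *: (tin cp 'X^i t : N) :> N.
  rewrite {1}[tin cp q t]tinE -[q in LHS]coefK poly_def scaler_suml.
  apply: eq_bigr => i _; rewrite -[RHS]/(cp q`_i *: tin cp 'X^i t).
  by rewrite [tin cp 'X^i t]tinE scalerA -mul_polyC.
rewrite -[RHS]/(f (\sum_(i < size q) q`_i *: (tin cp 'X^i t : N))) linear_sum.
by apply: eq_bigr => i _; rewrite !linearZ_LR gE.
Qed.

End PolyTensorProjective.

Section PolyExtension.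
Variables (k : fieldType) (R : comAlgType k).
Local Notation Q := (polyxy R).

Lemma drop1B (S : comNzRingType) : zmod_morphism (@drop_poly S 1).
Proof. by move=> p q; rewrite linearB. Qed.
Lemma derivB (S : comNzRingType) : zmod_morphism (@deriv S).
Proof. by move=> p q; rewrite linearB. Qed.
Definition drop1 (S : comNzRingType) : {additive {poly S} -> {poly S}} :=
  mk_additive (@drop1B S).
Definition dpoly (S : comNzRingType) : {additive {poly S} -> {poly S}} :=
  mk_additive (@derivB S).

Lemma coef_drop1 (S : comNzRingType) (p : {poly S}) i : (drop1 S p)`_i = p`_i.+1.
Proof. by rewrite -[drop1 S p]/(drop_poly 1 p) coef_drop_poly addn1. Qed.
Lemma dpolyM (S : comNzRingType) (p q : {poly S}) :
  dpoly S (p * q) = dpoly S p * q + p * dpoly S q.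
Proof. exact: derivM. Qed.

(** [x] is the inner variable, so its operators act on coefficients, while those of the outer
    variable [y] act on the polynomial itself. *)
Definition pxy_dx : {additive Q -> Q} := map_poly (drop1 R).
Definition pxy_dy : {additive Q -> Q} := drop1 {poly R}.
Definition pxy_px : {additive Q -> Q} := map_poly (dpoly R).
Definition pxy_py : {additive Q -> Q} := dpoly {poly R}.
Definition pxy_ev : {rmorphism Q -> R} :=
  horner_eval (0 : R) \o horner_eval (0 : {poly R}).

Lemma coef_dx (q : Q) i : (pxy_dx q)`_i = drop1 R q`_i.
Proof. exact: coef_map. Qed.
Lemma coef_px (q : Q) i : (pxy_px q)`_i = dpoly R q`_i.
Proof. exact: coef_map. Qed.

Lemma drop1X (S : comNzRingType) (p : {poly S}) : drop1 S ('X * p) = p.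
Proof. by apply/polyP => i; rewrite coef_drop1 coefXM. Qed.
Lemma drop1C (S : comNzRingType) (c : S) : drop1 S c%:P = 0.
Proof. by apply/polyP => i; rewrite coef_drop1 coefC coef0. Qed.
Lemma drop1MC (S : comNzRingType) (p : {poly S}) (c : S) :
  drop1 S (p * c%:P) = drop1 S p * c%:P.
Proof. by apply/polyP => i; rewrite coefMC !coef_drop1 coefMC. Qed.
Lemma drop1_dec (S : comNzRingType) (p : {poly S}) :
  p = p.[0]%:P + 'X * drop1 S p.
Proof.
apply/polyP => i; rewrite coefD coefC coefXM coef_drop1 horner_coef0.
by case: i => [|i]; rewrite ?addr0 ?add0r.
Qed.

Lemma pxy_pxM (p q : Q) : pxy_px (p * q) = pxy_px p * q + p * pxy_px q.
Proof.
apply/polyP => i; rewrite coef_px coefD !coefM raddf_sum -big_split /=.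
by apply: eq_bigr => j _; rewrite !coef_px dpolyM.
Qed.

(** Identifies [R[y]] with the part of [R[x,y]] free of [x], which is what reduction modulo [x] asks
    of its auxiliary ring. *)
Lemma pxy_jr (q : Q) : map_poly polyC (map_poly (horner_eval (0 : R)) q)
  = q - 'X%:P * pxy_dx q.
Proof.
apply/polyP => i; rewrite coef_map coef_map coefB coefCM coef_dx.
by rewrite {2}[q`_i]drop1_dec addrK.
Qed.

(** Transparent, so that [knorrer_potential w] and [in_polyxy R] have the form needed for
    stabilization by conversion, with proof [erefl]. *)
Definition polyxy_xalg : xalg R (polyxy R).
Proof.
refine (@XAlg R Q (to_polyxy R) 'X%:P 'X pxy_ev pxy_dx pxy_dy pxy_px pxy_py
  _ _ _ _ _ _ _ _ _ _ _ _ pxy_pxM (@dpolyM _) _ _ _ _ _ _).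
- by move=> r; rewrite /= /horner_eval !hornerC.
- by rewrite /= /horner_eval hornerC hornerX.
- by rewrite /= /horner_eval hornerX horner0.
- move=> q r; apply/polyP => i; rewrite coefMC !coef_dx coefMC.
  exact: drop1MC.
- by move=> q r; exact: drop1MC.
- by move=> q; apply/polyP => i; rewrite coef_dx coefCM drop1X.
- move=> q; apply/polyP => i; rewrite coef_dx !coefXM coef_dx.
  by case: (i == 0)%N => //; rewrite raddf0.
- transitivity (pxy_dx (1%:P%:P)); first by rewrite !polyC1.
  apply/polyP => i; rewrite coef_dx coefC coef0; case: i => [|i]; last exact: raddf0.
  exact: drop1C.
- move=> q; apply/polyP => i; rewrite coefCM !coef_drop1 coefCM.
  by [].
- by move=> q; exact: drop1X.
- exact: drop1C.
- move=> q; rewrite -pxy_jr -[pxy_dy _]/(drop1 _ _).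
  rewrite -[LHS](subrK ('X%:P * pxy_dx q)) -pxy_jr; set p := map_poly polyC _.
  rewrite {1}[p]drop1_dec [RHS]addrAC; congr (_ + _ + _).
  by rewrite /p !horner_coef0 !coef_map /= /horner_eval !horner_coef0.
- by move=> r; apply/polyP => i; rewrite coef_px coefC coef0; case: i => [|i];
    rewrite ?raddf0 // -[LHS]/(deriv r%:P) derivC.
- by move=> r; exact: derivC.
- apply/polyP => i; rewrite coef_px coefC coef1; case: i => [|i]; last by rewrite raddf0.
  exact: derivX.
- apply/polyP => i; rewrite coef_px coefX coef0; case: (i == 1)%N; last by rewrite raddf0.
  exact: derivC.
- exact: derivC.
- exact: derivX.
Defined.

End PolyExtension.

(** * Composition of equivalences in a dg category *)

Section DGCategories.
Variable k : fieldType.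
Section Composition.
Variables (A : dgcat k).
Notation cmp := (@dg_comp k A _ _ _).

Lemma dg_compDl (x y z : A) (g g' : dg_hom y z) (f : dg_hom x y) :
  cmp (g + g') f = cmp g f + cmp g' f.
Proof. exact: (linearD (mk_linear (dg_comp_linl f))). Qed.
Lemma dg_compNl (x y z : A) (g : dg_hom y z) (f : dg_hom x y) :
  cmp (- g) f = - cmp g f.
Proof. exact: (linearN (mk_linear (dg_comp_linl f))). Qed.
Lemma dg_comp0l (x y z : A) (f : dg_hom x y) : cmp (0 : dg_hom y z) f = 0.
Proof. exact: (linear0 (mk_linear (dg_comp_linl f))). Qed.
Lemma dg_compDr (x y z : A) (g : dg_hom y z) (f f' : dg_hom x y) :
  cmp g (f + f') = cmp g f + cmp g f'.
Proof. exact: (linearD (mk_linear (dg_comp_linr g))). Qed.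
Lemma dg_compNr (x y z : A) (g : dg_hom y z) (f : dg_hom x y) :
  cmp g (- f) = - cmp g f.
Proof. exact: (linearN (mk_linear (dg_comp_linr g))). Qed.
Lemma dg_comp0r (x y z : A) (g : dg_hom y z) : cmp g (0 : dg_hom x y) = 0.
Proof. exact: (linear0 (mk_linear (dg_comp_linr g))). Qed.

Lemma dg_comp_closed (x y z : A) (g : dg_hom y z) (f : dg_hom x y) :
  homog false g /\ cx_d _ g = 0 -> homog false f /\ cx_d _ f = 0 ->
  homog false (cmp g f) /\ cx_d _ (cmp g f) = 0.
Proof.
case=> g0 dg [f0 df]; split; first exact: (dg_comp_homog g0 f0).
by rewrite (dg_leibniz _ g0) dg df scale1r dg_comp0l dg_comp0r addr0.
Qed.

(** From [g g' f' f - 1 = g (g' f' - 1) f + (g f - 1)], the homotopy is [g h' f + h]. *)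
Lemma dg_comp_homotopy (x y z : A) (f : dg_hom x y) (g : dg_hom y x)
    (f' : dg_hom y z) (g' : dg_hom z y) :
  homog false f /\ cx_d _ f = 0 -> homog false g /\ cx_d _ g = 0 ->
  (exists2 h, homog true h & cmp g f - dg_id x = cx_d _ h) ->
  (exists2 h, homog true h & cmp g' f' - dg_id y = cx_d _ h) ->
  exists2 h, homog true h & cmp (cmp g g') (cmp f' f) - dg_id x = cx_d _ h.
Proof.
case=> f0 df [g0 dg] [h h1 hE] [h' h'1 h'E].
exists (cmp (cmp g h') f + h).
  rewrite /homog linearD [X in _ + X]h1; congr (_ + _).
  exact: (dg_comp_homog (dg_comp_homog g0 h'1) f0).
rewrite linearD -hE (dg_leibniz _ (dg_comp_homog g0 h'1)) df dg_comp0r scaler0.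
rewrite addr0 (dg_leibniz _ g0) dg dg_comp0l add0r scale1r -h'E.
rewrite dg_compDr dg_compNr dg_comp1r dg_compDl dg_compNl !dg_compA.
by rewrite addrA subrK.
Qed.

Lemma H0_iso_trans (x y z : A) : H0_iso x y -> H0_iso y z -> H0_iso x z.
Proof.
move=> [f [g [fc gc fg gf]]] [f' [g' [fc' gc' fg' gf']]].
exists (cmp f' f), (cmp g g'); split; try exact: dg_comp_closed.
  exact: dg_comp_homotopy.
exact: dg_comp_homotopy.
Qed.
End Composition.

Lemma weakly_equivalent_of_quasi_equiv (A B : dgcat k) (F : dgfun A B) :
  quasi_equiv F -> weakly_equivalent A B.
Proof.
by move=> qF; exists (HoFun F), (HoInv qF); split; [exact: HoInv_l|exact: HoInv_r].
Qed.

End DGCategories.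

Section PolynomialEquivalence.
Variables (k : fieldType) (R : comAlgType k) (w : R).
Local Notation A := (polyxy_xalg R).
Local Notation rho := (in_alg R : {rmorphism k -> R}).
Local Notation v := (knorrer_potential w).

Lemma polyxy_stab_quasi_equiv :
  quasi_equiv (@stabilization k R (polyxy R) A rho (in_polyxy R)
    (fun=> erefl) w v erefl).
Proof.
split=> [X Y|Y]; first exact: st_hom_quasi_iso.
(* One index set surjecting onto both components: the contractible summand added by
   [transport_H0_iso] is the same on both sides, and [H0_iso_red] wants both components extended
   from the same [V]. *)
pose S := (mf_tot Y : Type); pose V := free R (S * nat).
have s0 (m : mf0 Y) : exists s : S, (s : mf_tot Y).1 = m by exists (m, 0).
have s1 (m : mf1 Y) : exists s : S, (s : mf_tot Y).2 = m by exists (0, m).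
have [F0 [F0' [F0K F0'K]]] := swindle (to_polyxy R) (@mf_proj0 _ v Y) s0.
have [F1 [F1' [F1K F1'K]]] := swindle (to_polyxy R) (@mf_proj1 _ v Y) s1.
have pV : projective V by exact: free_projective.
have pL : projective (tens (to_polyxy R) V) by exact: tens_projective.
have [d01 [d10 [h0 [h1 isoY]]]] :=
  transport_H0_iso (in_polyxy R) F0K F0'K F1K F1'K pL pL.
pose jA : {additive {poly R} -> polyxy R} := map_poly polyC.
pose rA : {additive polyxy R -> {poly R}} := map_poly (horner_eval (0 : R)).
have pN := poly_tens_projective pV.
have jAc p r : jA (p * r%:P) = jA p * to_polyxy R r.
  rewrite -[LHS]/(map_poly polyC (p * r%:P)) rmorphM.
  by congr (_ * _); exact: map_polyC.
have rAc q r : rA (q * to_polyxy R r) = rA q * r%:P.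
  rewrite -[LHS]/(map_poly (horner_eval (0 : R)) (q * to_polyxy R r)) rmorphM.
  congr (_ * _); rewrite -[LHS]/(map_poly (horner_eval (0 : R)) r%:P%:P) map_polyC.
  by rewrite /= /horner_eval hornerC.
have rAj p : rA (jA p) = p.
  rewrite -[LHS]/(map_poly (horner_eval (0 : R)) (map_poly polyC p)).
  by apply/polyP => i; rewrite !coef_map /= /horner_eval hornerC.
exists (red_mfact (A := A) (v := v) (w := w) erefl jAc rAc rAj (@pxy_jr k R) pN h0 h1).
apply: H0_iso_trans isoY.
exact: H0_iso_red.
Qed.

End PolynomialEquivalence.

(** * Maps between completions *)

Section IdealPowers.
Variables (Q : comPzRingType) (I : set Q).
Hypothesis idI : is_ideal I.
Local Notation J := (ideal_exp I).

Lemma ideal_gen_in (S : set Q) a : S a -> ideal_gen S a.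
Proof. by move=> Sa K _; apply. Qed.

Lemma ideal_exp_mul n a b : I a -> J n b -> J n.+1 (a * b).
Proof. by move=> Ia Jb; apply: ideal_gen_in; exists a, b. Qed.

Lemma ideal_exp_sub n a : J n.+1 a -> J n a.
Proof.
elim: n a => [//|n IH] a; apply; first exact: ideal_expP.
move=> c [p [q [Ip Jq ->]]]; apply: ideal_exp_mul => //; exact: IH.
Qed.

Lemma ideal_exp_sub_add n d a : J (n + d)%N a -> J n a.
Proof. by elim: d => [|d IH]; rewrite ?addn0 // addnS => /ideal_exp_sub. Qed.

Lemma ideal_exp1 a : J 1 a -> I a.
Proof.
apply=> // c [p [q [Ip _ ->]]]; rewrite mulrC.
by case: idI => _ _; apply.
Qed.

End IdealPowers.

Section IdealMaps.
Variables (Q Q' : comPzRingType) (I : set Q) (I' : set Q').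

Lemma ideal_exp_rmorph (f : {rmorphism Q -> Q'}) :
  (forall a, I a -> I' (f a)) ->
  forall n a, ideal_exp I n a -> ideal_exp I' n (f a).
Proof.
move=> fI; elim=> [//|n IH] a h; apply: (h (fun p => ideal_exp I' n.+1 (f p))).
  have [h0 hD hM] := ideal_expP I' n.+1.
  split=> [|p q|r p]; rewrite ?rmorph0 // ?rmorphD ?rmorphM.
    exact: hD.
  exact: hM.
move=> c [p [q [Ip Jq ->]]]; rewrite rmorphM.
by apply: ideal_exp_mul; [exact: fI | exact: IH].
Qed.
End IdealMaps.

(** The twisted Leibniz rule lets [T] consume one factor of a product and leaves the others in [I].
    Derivatives are the case [E = id]; for division by a variable, [E] sets that variable to [0]. *)
Lemma ideal_exp_deriv (Q : comPzRingType) (I : set Q) (T : {additive Q -> Q}) (E : Q -> Q) :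
  (forall a b, T (a * b) = T a * b + E a * T b) -> (forall a, I a -> I (E a)) ->
  forall n a, ideal_exp I n.+1 a -> ideal_exp I n (T a).
Proof.
move=> TM EI; elim=> [//|n IH] a.
(* Membership of [a] itself is carried along because [T (r * p)] contains [T r * p]; without it the
   condition would not cut out an ideal. *)
suff : ideal_exp I n.+2 a -> ideal_exp I n.+2 a /\ ideal_exp I n.+1 (T a).
  by move=> h /h[].
move=> h; apply: (h (fun p => ideal_exp I n.+2 p /\ ideal_exp I n.+1 (T p))).
  have [h0 hD hM] := ideal_expP I n.+1; have [k0 kD kM] := ideal_expP I n.+2.
  split=> [|p q [p1 p2] [q1 q2]|r p [p1 p2]]; first by rewrite raddf0.
    by rewrite raddfD; split; [exact: kD | exact: hD].
  rewrite TM; split; first exact: kM.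
  by apply: hD; apply: hM => //; exact: ideal_exp_sub.
move=> c [p [q [Ip Jq ->]]]; rewrite TM; have [h0 hD hM] := ideal_expP I n.+1.
split; first exact: ideal_exp_mul.
apply: hD; first exact: hM.
by apply: ideal_exp_mul; [exact: EI | exact: IH].
Qed.

Section Filtration.
Variables (Q : comPzRingType) (I : set Q).
Local Notation C := (completion I).
Local Notation pi := (\pi_(completion I)%qT).
Local Notation J := (ideal_exp I).
Local Notation io := (to_completion I).

(** The kernel of the projection to [Q/I^n]; by [Fil_pi] any representative may be used. *)
Definition Fil n (z : C) : Prop := J n (repr z n).

Lemma Fil_pi n (a : compat I) : Fil n (pi a) <-> J n (a n).
Proof.
have h := repr_pi a n; split=> [h'|h'].
  by have := expD h' (expN h); rewrite opprB addrCA subrr addr0.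
by have := expD h h'; rewrite subrK.
Qed.

Lemma cpl_repr (z : C) : exists a : compat I, z = pi a.
Proof. by exists (repr z); rewrite reprK. Qed.

Lemma Fil0 n : Fil n 0.
Proof. by apply/Fil_pi; exact: exp0. Qed.
Lemma FilD n z z' : Fil n z -> Fil n z' -> Fil n (z + z').
Proof.
have [a ->] := cpl_repr z; have [b ->] := cpl_repr z'.
rewrite -[pi a + pi b]/(cpl_add _ _) cpl_addE => /Fil_pi h /Fil_pi h'.
by apply/Fil_pi; exact: expD.
Qed.
Lemma FilM n z z' : Fil n z' -> Fil n (z * z').
Proof.
have [a ->] := cpl_repr z; have [b ->] := cpl_repr z'.
rewrite -[pi a * pi b]/(cpl_mul _ _) cpl_mulE => /Fil_pi h.
by apply/Fil_pi; exact: expM.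
Qed.
Lemma FilN n z : Fil n z -> Fil n (- z).
Proof. by rewrite -mulN1r; exact: FilM. Qed.
Lemma FilB n z z' : Fil n z -> Fil n z' -> Fil n (z - z').
Proof. by move=> h h'; apply: FilD => //; exact: FilN. Qed.

Lemma Fil_sep z : (forall n, Fil n z) -> z = 0.
Proof.
have [a ->] := cpl_repr z => h; apply: pi_eq => n.
by rewrite /= subr0; apply/Fil_pi.
Qed.

Lemma Fil_io n a : Fil n (io a) <-> J n a.
Proof. exact: Fil_pi. Qed.

Lemma Fil_dense n z : exists a, Fil n (z - io a).
Proof.
have [a ->] := cpl_repr z; exists (a n).
rewrite -[pi a - _]/(cpl_add _ (cpl_opp (cpl_const I (a n)))) /cpl_const.
by rewrite cpl_oppE cpl_addE; apply/Fil_pi; rewrite /= subrr; exact: exp0.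
Qed.

End Filtration.

Section Continuity.
Variables (Q1 Q2 Q3 : comPzRingType) (I1 : set Q1) (I2 : set Q2) (I3 : set Q3).
Local Notation C1 := (completion I1).
Local Notation C2 := (completion I2).
Local Notation C3 := (completion I3).

(** Uniform continuity with a fixed loss of degree [d], a form stable under sums and composition. *)
Definition cont (Q Q' : comPzRingType) (I : set Q) (I' : set Q')
    (F : completion I -> completion I') : Prop :=
  exists d, forall n z z', Fil (n + d)%N (z - z') -> Fil n (F z - F z').

Lemma cont_id : cont (fun z : C1 => z).
Proof. by exists 0%N => n z z'; rewrite addn0. Qed.
Lemma cont_cst (b : C2) : cont (fun z : C1 => b).
Proof. by exists 0%N => n z z' _; rewrite subrr; exact: Fil0. Qed.

Lemma Fil_sub n d (z : C1) : Fil (n + d)%N z -> Fil n z.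
Proof.
have [a ->] := cpl_repr z => /Fil_pi h; apply/Fil_pi.
elim: d h => [|d IH]; rewrite ?addn0 // addnS => /ideal_exp_sub h; apply: IH.
by have := expD (expN (compatP a (n + d))) h; rewrite opprB subrK.
Qed.

Lemma cont_add (F G : C1 -> C2) : cont F -> cont G -> cont (fun z => F z + G z).
Proof.
move=> [d hF] [d' hG]; exists (d + d')%N => n z z' h.
rewrite opprD addrACA; apply: FilD.
  by apply: hF; move: h; rewrite addnA; exact: Fil_sub.
by apply: hG; move: h; rewrite [(d + d')%N]addnC addnA; exact: Fil_sub.
Qed.
Lemma cont_mul (a : C2) (F : C1 -> C2) : cont F -> cont (fun z => a * F z).
Proof.
by move=> [d hF]; exists d => n z z' /hF h; rewrite -mulrBr; exact: FilM.
Qed.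
Lemma cont_opp (F : C1 -> C2) : cont F -> cont (fun z => - F z).
Proof.
by move=> [d hF]; exists d => n z z' /hF h; rewrite -opprD; exact: FilN.
Qed.
Lemma cont_mulr (a : C2) (F : C1 -> C2) : cont F -> cont (fun z => F z * a).
Proof.
by move=> [d hF]; exists d => n z z' /hF h; rewrite -mulrBl mulrC; exact: FilM.
Qed.
Lemma cont_comp (G : C2 -> C3) (F : C1 -> C2) : cont G -> cont F -> cont (fun z => G (F z)).
Proof.
move=> [d hG] [d' hF]; exists (d + d')%N => n z z' h.
by apply/hG/hF; rewrite -addnA.
Qed.

(** The image of [Q1] is dense and the filtration is separated; this is how identities pass to the
    completion. *)
Lemma cont_eq (F G : C1 -> C2) : cont F -> cont G ->
  (forall a, F (to_completion I1 a) = G (to_completion I1 a)) -> F =1 G.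
Proof.
move=> cF cG e z; apply/eqP; rewrite -subr_eq0; apply/eqP/Fil_sep => n.
have [d h] := cont_add cF (cont_opp cG).
have [a ha] := Fil_dense (n + d) z.
by have := h n _ _ ha; rewrite e subrr subr0.
Qed.

End Continuity.

Section CompletionMap.
Variables (Q Q' : comPzRingType) (I : set Q) (I' : set Q').
Local Notation pi := (\pi_(completion I)%qT).
Local Notation pi' := (\pi_(completion I')%qT).

Section Additive.
Variable T : {additive Q -> Q'}.
Hypothesis TI : forall n a, ideal_exp I n.+1 a -> ideal_exp I' n (T a).

(** The image sequence is [n |-> T (a n.+1)]: the shift of index pays for the degree that [T]
    loses. *)
Lemma cmap_compatP (a : compat I) n : ideal_exp I' n (T (a n.+2) - T (a n.+1)).
Proof. by rewrite -raddfB; apply/TI/compatP. Qed.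
Definition cmap_fun (z : completion I) : completion I' :=
  pi' (Compat (cmap_compatP (repr z))).

Lemma cmap_pi (a : compat I) : cmap_fun (pi a) = pi' (Compat (cmap_compatP a)).
Proof. by apply: pi_eq => n; rewrite /= -raddfB; apply: TI; exact: repr_pi. Qed.

Lemma cmapB : zmod_morphism cmap_fun.
Proof.
move=> z z'; have [a ->] := cpl_repr z; have [b ->] := cpl_repr z'.
rewrite -[pi a - pi b]/(cpl_add _ (cpl_opp _)) cpl_oppE cpl_addE !cmap_pi.
rewrite -[RHS]/(cpl_add _ (cpl_opp _)) cpl_oppE cpl_addE.
by apply: pi_ext => n /=; rewrite raddfB.
Qed.
Definition cmap : {additive completion I -> completion I'} := mk_additive cmapB.

Lemma cmap_io a : cmap (to_completion I a) = to_completion I' (T a).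
Proof. by rewrite -[LHS]/(cmap_fun (pi _)) cmap_pi; exact: pi_ext. Qed.

Lemma cont_cmap : cont cmap.
Proof.
exists 1%N => n z z' h; rewrite -(raddfB cmap).
have [a aE] := cpl_repr (z - z'); rewrite aE in h *.
rewrite -[cmap _]/(cmap_fun _) cmap_pi; apply/Fil_pi/TI.
by move/Fil_pi: h; rewrite addn1.
Qed.

End Additive.

Section RMorphism.
Variable f : {rmorphism Q -> Q'}.
Hypothesis fI : forall n a, ideal_exp I n.+1 a -> ideal_exp I' n (f a).
Lemma cmap_monoid : monoid_morphism (cmap_fun (T := f) fI).
Proof.
split=> [|z z']; first by rewrite -[RHS](rmorph1 (to_completion I')) -(rmorph1 f) -(cmap_io fI) rmorph1.
have [a ->] := cpl_repr z; have [b ->] := cpl_repr z'.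
rewrite -[pi a * pi b]/(cpl_mul _ _) cpl_mulE !cmap_pi.
rewrite -[RHS]/(cpl_mul _ _) cpl_mulE.
by apply: pi_ext => n /=; rewrite rmorphM.
Qed.
Definition cmap_rmorph : {rmorphism completion I -> completion I'} :=
  HB.pack (cmap_fun (T := f) fI)
    (GRing.isZmodMorphism.Build _ _ (cmap_fun (T := f) fI) (cmapB fI))
    (GRing.isMonoidMorphism.Build _ _ (cmap_fun (T := f) fI) cmap_monoid).
Lemma cmap_rmorph_io a : cmap_rmorph (to_completion I a) = to_completion I' (f a).
Proof. exact: (cmap_io fI). Qed.
Lemma cont_cmap_rmorph : cont cmap_rmorph.
Proof. exact: (cont_cmap fI). Qed.
End RMorphism.
End CompletionMap.

(** * The completed polynomial extension *)

Section PolyTwistedDerivations.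
Variables (k : fieldType) (R : comAlgType k).
Local Notation Q := (polyxy R).
Local Notation dx := (pxy_dx R).
Local Notation dy := (pxy_dy R).

(** Leibniz rule twisted by evaluation at [0]; it makes division by the variable continuous for the
    adic topology. *)
Lemma drop1M (S : comNzRingType) (p q : {poly S}) :
  drop1 S (p * q) = drop1 S p * q + p.[0]%:P * drop1 S q.
Proof.
rewrite {1}[p]drop1_dec {1}[q]drop1_dec mulrDl mulrDr (raddfD (drop1 S)).
rewrite -[_ * _ * (_ + _)]mulrA drop1X -drop1_dec -rmorphM /= (raddfD (drop1 S)).
by rewrite drop1C add0r mulrCA drop1X addrC.
Qed.

Lemma pxy_dyM (p q : Q) :
  dy (p * q) = dy p * q + (p - 'X * dy p) * dy q.
Proof.
rewrite -[dy (p * q)]/(drop1 _ _) drop1M; congr (_ + _ * _).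
by rewrite {2}[p]drop1_dec addrK.
Qed.

Lemma pxy_dxM (p q : Q) :
  dx (p * q) = dx p * q + (p - 'X%:P * dx p) * dx q.
Proof.
apply/polyP => i; rewrite coef_dx coefD !coefM raddf_sum -big_split /=.
apply: eq_bigr => j _; rewrite -pxy_jr !coef_dx drop1M; congr (_ + _ * _).
by rewrite coef_map coef_map.
Qed.

End PolyTwistedDerivations.

Section CompletedExtension.
Variables (k : fieldType) (R : comAlgType k) (s : prime_idealr R).
Local Notation m := ((fun a => a \in s) : set R).
Local Notation mxy := (ideal_sxy s).
Local Notation P := (polyxy_xalg R).

Lemma prime_is_ideal : is_ideal m.
Proof.
split=> [|a b|r a]; [exact: rpred0 | exact: rpredD | exact: idealMr].
Qed.
Lemma mxy_x : mxy 'X%:P.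
Proof. by apply: ideal_gen_in; right; left. Qed.
Lemma mxy_y : mxy 'X.
Proof. by apply: ideal_gen_in; right; right. Qed.
Lemma mxy_c a : a \in s -> mxy (to_polyxy R a).
Proof. by move=> sa; apply: ideal_gen_in; left; exists a. Qed.
Lemma mxy_ideal : is_ideal mxy.
Proof. exact: ideal_genP. Qed.
Lemma mxy_ev p : mxy p -> xev P p \in s.
Proof.
move=> h; apply: (h (fun p => xev P p \in s)).
  have [h0 hD hM] := prime_is_ideal.
  by split=> [|a b|r a]; rewrite ?rmorph0 // ?rmorphD ?rmorphM; [exact: hD|exact: hM].
move=> q [[a sa ->]|[->|->]]; first by rewrite (xev_c P).
  by rewrite (xev_x P) rpred0.
by rewrite (xev_y P) rpred0.
Qed.

(** A morphism preserving the ideals loses no degree. One is given away so that [cmap_rmorph], which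
    shifts the index, applies. *)
Lemma exp_c n a : ideal_exp m n.+1 a -> ideal_exp mxy n (xc P a).
Proof.
move=> h; apply: (ideal_exp_rmorph (I := m)) => [b|]; first exact: mxy_c.
exact: ideal_exp_sub.
Qed.
Lemma exp_ev n p : ideal_exp mxy n.+1 p -> ideal_exp m n (xev P p).
Proof.
move=> h; apply: (ideal_exp_rmorph (I := mxy)) => [b|]; first exact: mxy_ev.
exact: ideal_exp_sub.
Qed.
Lemma mxy_sub a b : mxy a -> mxy b -> forall q, mxy (a - b * q).
Proof.
case: mxy_ideal => _ hD hM ha hb q; apply: hD => //; rewrite -mulrN mulrC.
exact: hM.
Qed.
Lemma exp_dx n p : ideal_exp mxy n.+1 p -> ideal_exp mxy n (xdx P p).
Proof.
apply: (ideal_exp_deriv (@pxy_dxM k R)) => a ha.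
exact: mxy_sub mxy_x _.
Qed.
Lemma exp_dy n p : ideal_exp mxy n.+1 p -> ideal_exp mxy n (xdy P p).
Proof.
apply: (ideal_exp_deriv (@pxy_dyM k R)) => a ha.
exact: mxy_sub mxy_y _.
Qed.
Lemma exp_px n p : ideal_exp mxy n.+1 p -> ideal_exp mxy n (xpx P p).
Proof. exact: (ideal_exp_deriv (xpxM P)). Qed.
Lemma exp_py n p : ideal_exp mxy n.+1 p -> ideal_exp mxy n (xpy P p).
Proof. exact: (ideal_exp_deriv (xpyM P)). Qed.

Local Notation C := (completion m).
Local Notation CQ := (completion mxy).
Local Notation io := (to_completion m).
Local Notation ioQ := (to_completion mxy).
Local Notation cc := (cmap_rmorph exp_c).
Local Notation cev := (cmap_rmorph exp_ev).
Local Notation cdx := (cmap exp_dx).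
Local Notation cdy := (cmap exp_dy).
Local Notation cpx := (cmap exp_px).
Local Notation cpy := (cmap exp_py).
Local Notation X := (ioQ (xx P)).
Local Notation Y := (ioQ (xy P)).

Let ioE := (cmap_rmorph_io exp_c, cmap_rmorph_io exp_ev, cmap_io exp_dx,
  cmap_io exp_dy, cmap_io exp_px, cmap_io exp_py).

Ltac cont_tac := repeat first
  [ exact: cont_id | exact: cont_cst | exact: cont_cmap | exact: cont_cmap_rmorph
  | apply: cont_add | apply: cont_opp | apply: cont_mul | apply: cont_mulr
  | apply: (cont_comp (cont_cmap_rmorph _)) | apply: (cont_comp (cont_cmap _)) ].

(** Every axiom is an identity between maps continuous in each variable, so it is checked on the
    dense image, one variable at a time, where it is the axiom for polynomials. *)
Definition completed_xalg : xalg C CQ.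
Proof.
refine (@XAlg C CQ cc X Y cev cdx cdy cpx cpy
  _ _ _ _ _ _ _ _ _ _ _ _ _ _ _ _ _ _ _ _).
- by apply: cont_eq => [||a]; cont_tac; rewrite !ioE (xev_c P).
- by rewrite ioE (xev_x P) rmorph0.
- by rewrite ioE (xev_y P) rmorph0.
- move=> q r; move: q; apply: cont_eq => [||a]; cont_tac.
  move: r; apply: cont_eq => [||r]; cont_tac.
  by rewrite !ioE -!rmorphM !ioE (xdxc P).
- move=> q r; move: q; apply: cont_eq => [||a]; cont_tac.
  move: r; apply: cont_eq => [||r]; cont_tac.
  by rewrite !ioE -!rmorphM !ioE (xdyc P).
- by apply: cont_eq => [||a]; cont_tac; rewrite -rmorphM !ioE (xdx_x P).
- by apply: cont_eq => [||a]; cont_tac; rewrite -rmorphM !ioE -rmorphM (xdx_y P).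
- by rewrite -(rmorph1 ioQ) ioE (xdx_1 P) rmorph0.
- by apply: cont_eq => [||a]; cont_tac; rewrite -rmorphM !ioE -rmorphM (xdy_x P).
- by apply: cont_eq => [||a]; cont_tac; rewrite -rmorphM !ioE (xdy_y P).
- by rewrite -(rmorph1 ioQ) ioE (xdy_1 P) rmorph0.
- apply: cont_eq => [||a]; cont_tac.
  rewrite !ioE -!rmorphM -rmorphB !ioE -!rmorphM -!rmorphD; congr (ioQ _).
  exact: (xdecomp P).
- move=> p q; move: p; apply: cont_eq => [||p]; cont_tac.
  move: q; apply: cont_eq => [||q]; cont_tac.
  by rewrite !ioE -!rmorphM !ioE -rmorphD (xpxM P).
- move=> p q; move: p; apply: cont_eq => [||p]; cont_tac.
  move: q; apply: cont_eq => [||q]; cont_tac.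
  by rewrite !ioE -!rmorphM !ioE -rmorphD (xpyM P).
- by apply: cont_eq => [||a]; cont_tac; rewrite !ioE (xpxc P) rmorph0.
- by apply: cont_eq => [||a]; cont_tac; rewrite !ioE (xpyc P) rmorph0.
- by rewrite ioE (xpx_x P) rmorph1.
- by rewrite ioE (xpx_y P) rmorph0.
- by rewrite ioE (xpy_x P) rmorph0.
- by rewrite ioE (xpy_y P) rmorph1.
Defined.

Lemma completed_xcE a : xc completed_xalg (io a) = ioQ (to_polyxy R a).
Proof. exact: cmap_rmorph_io. Qed.

Lemma completed_potentialE w : ioQ (knorrer_potential w)
  = xc completed_xalg (io w) + xx completed_xalg * xy completed_xalg.
Proof. by rewrite completed_xcE rmorphD rmorphM. Qed.

End CompletedExtension.

(** * Complete local rings with coefficient field *)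

(** The filtration [cl_F] is part of the data: on a completion it consists of the kernels to the
    quotients [Q/I^n], whose comparison with powers of the maximal ideal would take a separate
    argument. The section [cl_r] is the coefficient field. *)
Record clocal (k : fieldType) (A : comPzRingType) := CLocal {
  cl_k : {rmorphism A -> k};
  cl_r : {rmorphism k -> A};
  cl_F : nat -> A -> Prop;
  cl_kr : forall a, cl_k (cl_r a) = a;
  cl_D : forall n a b, cl_F n a -> cl_F n b -> cl_F n (a + b);
  cl_M : forall n a b, cl_F n b -> cl_F n (a * b);
  cl_0 : forall a, cl_F 0 a;
  cl_sub : forall n a, cl_F n.+1 a -> cl_F n a;
  cl_ker : forall a, cl_k a = 0 -> cl_F 1 a;
  cl_mul : forall n a b, cl_F 1 a -> cl_F n b -> cl_F n.+1 (a * b);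
  cl_sep : forall a, (forall n, cl_F n a) -> a = 0;
  cl_lim : forall u : nat -> A, (forall n, cl_F n (u n.+1 - u n)) ->
    exists a, forall n, cl_F n (a - u n) }.

Section CompletionLocal.
Variables (k : fieldType) (Q : comPzRingType) (I : set Q).
Hypothesis idI : is_ideal I.
Variables (ka : {rmorphism Q -> k}) (r : {rmorphism k -> Q}).
Hypothesis kaP : forall a, ka a = 0 <-> I a.
Hypothesis kar : forall c, ka (r c) = c.
Local Notation C := (completion I).
Local Notation pi := (\pi_(completion I)%qT).
Local Notation J := (ideal_exp I).
Local Notation io := (to_completion I).

Definition cpl_res (z : C) : k := ka (repr z 1%N).
Lemma cpl_res_pi a : cpl_res (pi a) = ka (a 1%N).
Proof.
apply/eqP; rewrite -subr_eq0 -rmorphB; apply/eqP/kaP.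
exact: (ideal_exp1 idI (repr_pi a 1)).
Qed.
Lemma cpl_res_zmod : zmod_morphism cpl_res.
Proof.
move=> z z'; have [a ->] := cpl_repr z; have [b ->] := cpl_repr z'.
rewrite -[pi a - pi b]/(cpl_add _ (cpl_opp _)) cpl_oppE cpl_addE !cpl_res_pi.
exact: rmorphB.
Qed.
Lemma cpl_res_monoid : monoid_morphism cpl_res.
Proof.
split=> [|z z']; first by rewrite -[1 in LHS]/(pi _) cpl_res_pi; exact: rmorph1.
have [a ->] := cpl_repr z; have [b ->] := cpl_repr z'.
rewrite -[pi a * pi b]/(cpl_mul _ _) cpl_mulE !cpl_res_pi.
exact: rmorphM.
Qed.
Definition cpl_res_rmorph : {rmorphism C -> k} :=
  HB.pack cpl_res (GRing.isZmodMorphism.Build _ _ cpl_res cpl_res_zmod)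
    (GRing.isMonoidMorphism.Build _ _ cpl_res cpl_res_monoid).

Lemma exp_1 a : I a -> J 1 a.
Proof. by move=> Ia; rewrite -[a]mulr1; exact: ideal_exp_mul. Qed.

Lemma compat_sub (a : compat I) n d : J n (a (n + d)%N - a n).
Proof.
elim: d => [|d IH]; first by rewrite addn0 subrr; exact: exp0.
rewrite addnS -[a _.+1](subrK (a (n + d)%N)) -addrA; apply: expD => //.
by apply: (@ideal_exp_sub_add _ _ n d); exact: compatP.
Qed.

Lemma Fil_mul n (z z' : C) : Fil 1 z -> Fil n z' -> Fil n.+1 (z * z').
Proof.
have [a ->] := cpl_repr z; have [b ->] := cpl_repr z' => /Fil_pi ha /Fil_pi hb.
rewrite -[pi a * pi b]/(cpl_mul _ _) cpl_mulE; apply/Fil_pi => /=.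
apply: ideal_exp_mul.
  apply: (ideal_exp1 idI); rewrite -[a _](subrK (a 1%N)); apply: expD => //.
  exact: (compat_sub a 1 n).
rewrite -[b _](subrK (b n)); apply: expD => //.
by rewrite -addn1; exact: compat_sub.
Qed.

(** Approximating [u n] modulo [Fil n] by an element of [Q] gives a compatible sequence, which
    presents the limit. *)
Lemma Fil_lim (u : nat -> C) : (forall n, Fil n (u n.+1 - u n)) ->
  exists a, forall n, Fil n (a - u n).
Proof.
move=> hu; have /choice[a aE] n := Fil_dense n (u n).
have aC n : J n (a n.+1 - a n).
  apply/Fil_io; rewrite rmorphB.
  have -> : io (a n.+1) - io (a n)
      = (u n.+1 - u n) - (u n.+1 - io (a n.+1)) + (u n - io (a n)) by abel.
  apply: FilD; last exact: aE; apply: FilB; first exact: hu.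
  by apply: (@Fil_sub _ _ n 1); rewrite addn1; exact: aE.
exists (pi (Compat aC)) => n.
have -> : pi (Compat aC) - u n = (pi (Compat aC) - io (a n)) - (u n - io (a n)) by abel.
apply: FilB; last exact: aE.
rewrite -[io _]/(pi _) -[pi _ - _]/(cpl_add _ (cpl_opp _)) cpl_oppE cpl_addE.
by apply/Fil_pi; rewrite /= subrr; exact: exp0.
Qed.

Definition completion_clocal : clocal k C.
Proof.
refine (@CLocal k C cpl_res_rmorph (io \o r) (@Fil Q I)
  _ (@FilD Q I) (@FilM Q I) _ _ _ Fil_mul (@Fil_sep Q I) Fil_lim).
- by move=> a; rewrite -[LHS]/(cpl_res (pi _)) cpl_res_pi; exact: kar.
- by move=> z; rewrite /Fil.
- by move=> n z; rewrite -addn1; exact: Fil_sub.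
- move=> z; have [a ->] := cpl_repr z => h; apply/Fil_pi.
  have ia : I (a 1%N) by apply/kaP; rewrite -cpl_res_pi.
  exact: exp_1.
Defined.
End CompletionLocal.

(** * Lifting idempotents along a complete filtration *)

Section IdempotentLifting.
Variables (M : pzRingType) (F : nat -> M -> Prop).
Hypothesis FD : forall n a b, F n a -> F n b -> F n (a + b).
Hypothesis FMl : forall n a b, F n b -> F n (a * b).
Hypothesis FMr : forall n a b, F n a -> F n (a * b).
Hypothesis F0 : forall a, F 0%N a.
Hypothesis FS : forall n a, F n.+1 a -> F n a.
Hypothesis Fmul : forall n a b, F 1%N a -> F n b -> F n.+1 (a * b).
Hypothesis Fsep : forall a, (forall n, F n a) -> a = 0.
Hypothesis Flim : forall u : nat -> M, (forall n, F n (u n.+1 - u n)) ->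
    exists a, forall n, F n (a - u n).

Lemma filN n a : F n a -> F n (- a).
Proof. by rewrite -mulN1r; exact: FMl. Qed.
Lemma filB n a b : F n a -> F n b -> F n (a - b).
Proof. by move=> h h'; apply: FD => //; exact: filN. Qed.

Lemma idempotent_eq0 e : e * e = e -> F 1%N e -> e = 0.
Proof.
move=> ee e1; apply: Fsep; elim=> [|n IH]; first exact: F0.
by rewrite -ee; exact: Fmul.
Qed.

(** [e' = 3e^2 - 2e^3] is the Newton step for [t^2 - t]: as [(2e - 1)^2 = 1 + 4u], the derivative
    [2e - 1] is its own inverse up to [u]. The new defect is [u^2 (4u - 3)]. *)
Lemma newton_idempotent (e : M) : let u := e * e - e in
  let e' := e + u * (1 - e - e) in
  e' * e' - e' = u * u * (u + u + u + u - 1 - 1 - 1).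
Proof.
move=> u; have uE : u = e * e - e by [].
clearbody u => e'; pose t := 1 - e - e; have tE : t = 1 - e - e by [].
have e'E : e' = e + u * t by []; clearbody t e'.
have ee : e * e = u + e by rewrite uE subrK.
have ue : u * e = e * u by rewrite uE mulrBl mulrBr mulrA.
have te : t * e = e * t by rewrite tE !(mulrBl, mulrBr) mul1r mulr1.
have tu : t * u = u * t by rewrite tE !(mulrBl, mulrBr) mul1r mulr1 ue.
have tt : t * t = 1 + u + u + u + u.
  by rewrite tE uE !(mulrBl, mulrBr) !mul1r !mulr1; abel.
have -> : e' * e' - e' = u + (e * (u * t) + e * (u * t)) + u * (u * (t * t)) - u * t.
  rewrite e'E mulrDl !mulrDr -[u * t * e]mulrA te [u * (e * t)]mulrA ue.
  rewrite -[u * t * (u * t)]mulrA [t * (u * t)]mulrA tu -!mulrA ee; abel.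
have -> : e * (u * t) + e * (u * t) = u * t - u * (t * t).
  rewrite [e * _]mulrA -ue -mulrA -te -mulrDr -mulrBr; congr (_ * _).
  have -> : t - t * t = t * (1 - t) by rewrite mulrBr mulr1.
  by rewrite -mulrDr; congr (_ * _); rewrite tE; abel.
rewrite tt !mulrDr !mulrN !mulr1 -!mulrA; abel.
Qed.

(** The idempotent is kept in the form [e0] plus a multiple of its defect. In this form it still
    commutes with whatever commutes with [e0], and the correction is null wherever the defect is. *)
Lemma idempotent_lift (e0 : M) : F 1%N (e0 * e0 - e0) ->
  exists Y, (forall f, GRing.comm f e0 -> GRing.comm f Y) /\
    let e := e0 + (e0 * e0 - e0) * Y in e * e = e.
Proof.
set u0 := e0 * e0 - e0 => hu0.
pose ef (p : M * M) := e0 + u0 * p.1.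
(* Newton iteration with [u0] factored out: [p.1] is the accumulated coefficient of [u0], and
   [u0 * p.2] is the current defect. *)
pose step (p : M * M) := (p.1 + p.2 * (1 - ef p - ef p),
  p.2 * (u0 * p.2) * (u0 * p.2 + u0 * p.2 + u0 * p.2 + u0 * p.2 - 1 - 1 - 1)).
pose seq n := iter n step (0, 1).
have seqS n : seq n.+1 = step (seq n) by [].
have commB f a b : GRing.comm (R := M) f a -> GRing.comm f b -> GRing.comm f (a - b).
  by move=> ha hb; apply: commrD => //; apply: commrN.
have u0c f : GRing.comm f e0 -> GRing.comm f u0.
  by move=> h; apply: commB => //; apply: commrM.
have seqc f n : GRing.comm f e0 -> GRing.comm f (seq n).1 /\ GRing.comm f (seq n).2.
  move=> h; elim: n => [|n [h1 h2]]; first by split; [exact: commr0|exact: commr1].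
  have he : GRing.comm f (ef (seq n)).
    by apply: commrD => //; apply: commrM => //; exact: u0c.
  have hu : GRing.comm f (u0 * (seq n).2) by apply: commrM => //; exact: u0c.
  have h11 : GRing.comm f 1 by exact: commr1.
  rewrite seqS; split.
    by apply: commrD => //; apply: commrM => //; do 2 (apply: (commB) => //).
  apply: commrM; first by apply: commrM.
  by do 3 (apply: (commB) => //); do 3 (apply: commrD => //).
have inv n : ef (seq n) * ef (seq n) - ef (seq n) = u0 * (seq n).2.
  elim: n => [|n IH].
    by rewrite /ef -[(seq 0%N).1]/(0 : M) -[(seq 0%N).2]/(1 : M) mulr0 addr0 mulr1.
  have e'E : ef (seq n.+1) = ef (seq n)
      + (ef (seq n) * ef (seq n) - ef (seq n)) * (1 - ef (seq n) - ef (seq n)).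
    by rewrite IH seqS {1}/ef -[(step _).1]/(_ + _) mulrDr addrA mulrA.
  rewrite e'E newton_idempotent IH seqS -[(step _).2]/(_ * _ * _).
  by rewrite !mulrA.
have uF n : F n.+1 (u0 * (seq n).2).
  elim: n => [|n IH]; first by rewrite mulr1.
  rewrite seqS -[(step _).2]/(_ * _ * _) !mulrA; apply: FMr.
  rewrite -mulrA; apply: Fmul => //; exact: FMr.
have UF n : F n (seq n).2.
  case: n => [|n]; first exact: F0.
  by rewrite seqS -[(step _).2]/(_ * _ * _); apply/FMr/FMl/uF.
have [|Y hY] := Flim (u := fun n => (seq n).1).
  move=> n; rewrite seqS -[(step _).1]/(_ + _) addrAC subrr add0r.
  by apply/FMr/UF.
exists Y; split=> [f hf|e].
  apply/eqP; rewrite -subr_eq0; apply/eqP/Fsep => n.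
  have [hn _] := seqc f n hf.
  have -> : f * Y - Y * f = f * (Y - (seq n).1) - (Y - (seq n).1) * f.
    rewrite mulrBr mulrBl hn; abel.
  by apply: filB; [apply: FMl|apply: FMr].
apply/eqP; rewrite -subr_eq0; apply/eqP/Fsep => n.
pose d := u0 * (Y - (seq n).1); have dF : F n d by apply: FMl.
have eE : e = ef (seq n) + d by rewrite /e /d /ef mulrBr; abel.
have -> : e * e - e = (ef (seq n) * ef (seq n) - ef (seq n))
   + (ef (seq n) * d + d * (ef (seq n) + d) - d).
  by rewrite eE mulrDl mulrDr; abel.
rewrite inv; apply: FD; first exact/FS/uF.
apply: filB => //; apply: FD; [exact: FMl | exact: FMr].
Qed.

End IdempotentLifting.

(** * Idempotent matrices over a complete local ring *)

(** Fitting's lemma by polynomials: a Bezout relation between ['X^m] and the cofactor [q] gives [p],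
    with [p(E)] the identity where [E] is invertible and [0] where it is nilpotent. The required [g]
    is the quotient of [p - 'X] by ['X^2 - 'X]. *)
Lemma idempotent_polynomial (k : fieldType) n (E : 'M[k]_n.+1) :
  exists g : {poly k}, let e := E + (E * E - E) * horner_mx E g in e * e = e.
Proof.
(* The factors ['X] and ['X - 1] force [p(0) = 0] and [p(1) = 1] whatever the eigenvalues are, so
   that ['X^2 - 'X] divides [p - 'X]. *)
pose f := 'X * ('X - 1) * char_poly E : {poly k}.
have f0 : f != 0.
  rewrite !mulf_neq0 ?polyX_eq0 ?polyXsubC_eq0 //.
  by apply: monic_neq0; exact: char_poly_monic.
have [m [q]] := multiplicity_XsubC f 0; rewrite f0 subr0 => q0 fE.
have cop : coprimep ('X^m) q.
  rewrite coprimep_sym; apply: coprimep_expr.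
  by rewrite coprimepX.
have [[u v] /= uv] := Bezout_eq1_coprimepP _ _ cop.
have [p pdef] : exists p, p = u * 'X^m by exists (u * 'X^m).
have m0 : (0 < m)%N.
  rewrite lt0n; apply/eqP => m0; move: (congr1 (horner^~ 0) fE).
  rewrite m0 expr0 mulr1 /f !hornerM hornerX !mul0r => h; move: q0.
  by rewrite rootE -h eqxx.
have q1 : q.[1] = 0.
  move: (congr1 (horner^~ 1) fE); rewrite /f !hornerM hornerXn expr1n mulr1.
  by rewrite hornerD hornerN hornerX hornerC subrr mulr0 mul0r.
have pE : 1 - p = v * q by rewrite -uv pdef addrAC subrr add0r.
have p1 : p.[1] = 1.
  have := congr1 (horner^~ 1) pE; rewrite hornerD hornerN hornerC hornerM q1 mulr0.
  by move/eqP; rewrite subr_eq0 => /eqP.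
have p0 : p.[0] = 0 by rewrite pdef hornerM hornerXn expr0n eqn0Ngt m0 mulr0.
have /factor_theorem[h hE] : root (p - 'X) 0 by rewrite rootE hornerD hornerN hornerX p0 subrr.
have /factor_theorem[g gE] : root h 1.
  have := congr1 (horner^~ 1) hE; rewrite hornerD hornerN hornerX p1 subrr hornerM hornerD hornerN hornerX hornerC subr0 mulr1 => h1.
  by rewrite rootE -h1.
have pX : p = 'X + ('X * 'X - 'X) * g.
  rewrite -[p](subrK 'X) hE gE addrC; congr (_ + _); rewrite subr0 -mulrA mulrC.
  by congr (_ * _); rewrite mulrBl mul1r.
exists g => /=.
have -> : E + (E * E - E) * horner_mx E g = horner_mx E p.
  have hX := horner_mx_X E.
  by rewrite pX rmorphD rmorphM rmorphB rmorphM -[X in _ = X + (X * X - X) * _]/(horner_mx E 'X) hX.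
rewrite -rmorphM; apply/eqP; rewrite -subr_eq0 -rmorphB; apply/eqP.
have -> : p * p - p = - (u * v * 'X * ('X - 1)) * char_poly E.
  transitivity (- (u * 'X^m * (1 - p))); first by rewrite -pdef mulrBr mulr1 opprB.
  rewrite pE mulNr; congr (- _); transitivity (u * v * f); last by rewrite /f !mulrA.
  by rewrite fE -!mulrA; congr (u * _); rewrite mulrCA [_ * q]mulrC.
by rewrite rmorphM /= Cayley_Hamilton mulr0.
Qed.

(** The defect of the corrected element is again a multiple of [D = E^2 - E], so the corrections
    made over the residue field and by Newton iteration combine into a single one. *)
Lemma idempotent_defect (M : pzRingType) (E G D : M) :
  G * E = E * G -> D = E * E - E ->
  (E + D * G) * (E + D * G) - (E + D * G) = D * (1 + (E + E - 1) * G + D * (G * G)).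
Proof.
move=> EG DD; have EE : E * E = D + E by rewrite DD subrK.
have DE : D * E = E * D by rewrite DD mulrBr mulrBl mulrA.
have GD : G * D = D * G.
  by rewrite DD mulrBr mulrBl mulrA EG -mulrA EG mulrA.
have -> : (E + D * G) * (E + D * G)
    = D + E + (D * (E * G) + D * (E * G)) + D * (D * (G * G)).
  rewrite mulrDl !mulrDr EE -[D * G * E]mulrA EG [E * (D * G)]mulrA -DE.
  by rewrite -[D * G * (D * G)]mulrA [G * (D * G)]mulrA GD -!mulrA; abel.
rewrite mulrBl mulrDl mul1r !mulrDr mulrN mulr1; abel.
Qed.

Section CompleteLocalMatrices.
Variables (k : fieldType) (A : comPzRingType) (L : clocal k A).
Local Notation ka := (cl_k L).
Local Notation r := (cl_r L).
Local Notation F := (cl_F L).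

Lemma cl_zero n : F n 0.
Proof.
elim: n => [|n IH]; first exact: cl_0.
by rewrite -[0](mul0r 0); apply: cl_mul => //; apply: cl_ker; exact: rmorph0.
Qed.

Lemma cl_sum n (I : Type) (s : seq I) (f : I -> A) : (forall i, F n (f i)) -> F n (\sum_(i <- s) f i).
Proof.
move=> h; elim: s => [|i s IH]; first by rewrite big_nil; exact: cl_zero.
by rewrite big_cons; apply: cl_D.
Qed.

(** After scaling the residue to [1], the inverse is a geometric series, convergent by
    completeness. *)
Lemma cl_unit a : ka a != 0 -> exists t, t * a = 1.
Proof.
move=> ka0; pose a' := r (ka a)^-1 * a; pose u := 1 - a'.
have u1 : F 1 u.
  by apply: cl_ker; rewrite /u rmorphB rmorph1 rmorphM cl_kr mulVf // subrr.
have uX n : F n (u ^+ n).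
  by elim: n => [|n IH]; [exact: cl_0 | rewrite exprS; exact: cl_mul].
have [|t ht] := @cl_lim _ _ L (fun n => \sum_(i < n) u ^+ i).
  by move=> n; rewrite big_ord_recr /= addrAC subrr add0r.
exists (t * r (ka a)^-1); rewrite -mulrA -/a'.
apply/eqP; rewrite -subr_eq0; apply/eqP/(@cl_sep _ _ L) => n.
have geo m : (\sum_(i < m) u ^+ i) * a' = 1 - u ^+ m.
  elim: m => [|m IH]; first by rewrite big_ord0 mul0r subrr.
  rewrite big_ord_recr /= mulrDl IH; have -> : a' = 1 - u by rewrite /u opprB addrCA subrr addr0.
  by rewrite mulrBr mulr1 -exprSr; abel.
have -> : t * a' - 1 = a' * (t - \sum_(i < n) u ^+ i) + (-1) * u ^+ n.
  rewrite mulrBr [a' * \sum_(_ < _) _]mulrC geo mulN1r [a' * t]mulrC; abel.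
by apply: cl_D; apply: cl_M.
Qed.

Definition Fmx m n j (M : 'M[A]_(m, n)) : Prop := forall a b, F j (M a b).

Lemma Fmx_mull m n p j (M : 'M[A]_(m, n)) (N : 'M_(n, p)) : Fmx j N -> Fmx j (M *m N).
Proof. by move=> h a b; rewrite mxE; apply: cl_sum => i; apply: cl_M. Qed.
Lemma Fmx_mulr m n p j (M : 'M[A]_(m, n)) (N : 'M_(n, p)) : Fmx j M -> Fmx j (M *m N).
Proof. by move=> h a b; rewrite mxE; apply: cl_sum => i; rewrite mulrC; apply: cl_M. Qed.
Lemma Fmx_add m n j (M N : 'M[A]_(m, n)) : Fmx j M -> Fmx j N -> Fmx j (M + N).
Proof. by move=> h h' a b; rewrite mxE; apply: cl_D. Qed.
Lemma Fmx_mul m n p j (M : 'M[A]_(m, n)) (N : 'M_(n, p)) :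
  Fmx 1 M -> Fmx j N -> Fmx j.+1 (M *m N).
Proof. by move=> h h' a b; rewrite mxE; apply: cl_sum => i; apply: cl_mul. Qed.
Lemma Fmx_sep m n (M : 'M[A]_(m, n)) : (forall j, Fmx j M) -> M = 0.
Proof. by move=> h; apply/matrixP => a b; rewrite mxE; apply: (@cl_sep _ _ L) => j; apply: h. Qed.
Lemma Fmx_ker m n (M : 'M[A]_(m, n)) : map_mx ka M = 0 -> Fmx 1 M.
Proof.
by move=> h a b; apply: cl_ker; have := congr1 (fun N : 'M_(m, n) => N a b) h; rewrite !mxE.
Qed.
Lemma Fmx_lim m n (u : nat -> 'M[A]_(m, n)) : (forall j, Fmx j (u j.+1 - u j)) ->
  exists M, forall j, Fmx j (M - u j).
Proof.
move=> h; have hab (p : 'I_m * 'I_n) : exists a, forall j, F j (a - u j p.1 p.2).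
  by apply: (@cl_lim _ _ L) => j; have := h j p.1 p.2; rewrite !mxE.
have /choice[f fE] := hab; exists (\matrix_(a, b) f (a, b)) => j a b.
by rewrite !mxE; exact: (fE (a, b) j).
Qed.

(** The rank factorization of the residue of [E] is lifted and cut down by [E]. The product [G] of
    the lifts reduces to the identity, so its determinant is a unit and its inverse normalizes the
    lifts. *)
Lemma mx_idempotent_split n (E : 'M[A]_n) : E *m E = E ->
  exists r (U : 'M_(n, r)) (V : 'M_(r, n)), U *m V = E /\ V *m U = 1%:M.
Proof.
move=> EE; pose e := map_mx ka E; pose C := col_base e; pose W := row_base e.
have ee : e *m e = e by rewrite -map_mxM EE.
have CW : C *m W = e by exact: mulmx_base.
have WC : W *m C = 1%:M.
  apply: (row_full_inj (col_base_full e)); rewrite mulmx1 mulmxA.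
  apply: (row_free_inj (row_base_free e)).
  by rewrite -/C -/W -mulmxA CW.
pose U0 := E *m map_mx r C; pose V0 := map_mx r W *m E; pose G := V0 *m U0.
have mapr m p (N : 'M[k]_(m, p)) : map_mx ka (map_mx r N) = N.
  by apply/matrixP => a b; rewrite !mxE cl_kr.
have eC : e *m C = C.
  have : C *m W *m C = C by rewrite -mulmxA WC mulmx1.
  by rewrite CW.
have We : W *m e = W.
  have : W *m (C *m W) = W by rewrite mulmxA WC mul1mx.
  by rewrite CW.
have kU : map_mx ka U0 = C by rewrite map_mxM mapr.
have kV : map_mx ka V0 = W by rewrite map_mxM mapr.
have kG : map_mx ka G = 1%:M by rewrite map_mxM kU kV.
have [t tG] : exists t, t * \det G = 1.
  by apply: cl_unit; rewrite -det_map_mx kG det1 oner_eq0.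
pose H := t *: \adj G.
have GH : G *m H = 1%:M by rewrite -scalemxAr mul_mx_adj scale_scalar_mx tG.
have HG : H *m G = 1%:M by rewrite -scalemxAl mul_adj_mx scale_scalar_mx tG.
pose U := U0 *m H; have EU : E *m U = U by rewrite /U /U0 !mulmxA EE.
have VE : V0 *m E = V0 by rewrite /V0 -mulmxA EE.
have VU : V0 *m U = 1%:M by rewrite /U mulmxA.
exists _, U, V0; split=> //; apply/eqP; rewrite eq_sym -subr_eq0; apply/eqP.
have kH : map_mx ka H = 1%:M.
  by have := congr1 (map_mx ka) HG; rewrite map_mxM kG mulmx1 map_mx1.
have kUV : map_mx ka (E - U *m V0) = 0.
  by rewrite map_mxB -/e map_mxM kV /U map_mxM kU kH mulmx1 CW subrr.
(* [U *m V0] is an idempotent absorbed by [E] on both sides, so the difference is idempotent too;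
   being [0] modulo the maximal ideal, it vanishes. *)
apply: (@idempotent_eq0 _ (@Fmx n n)) => [M|j M N|M||].
- by move=> a b; exact: cl_0.
- exact: Fmx_mul.
- exact: Fmx_sep.
- rewrite -[_ * _]/(_ *m _) mulmxBl !mulmxBr EE mulmxA EU -[U *m V0 *m E]mulmxA VE.
  by rewrite -[U *m V0 *m (U *m V0)]mulmxA [V0 *m _]mulmxA VU mul1mx subrr subr0.
exact: Fmx_ker.
Qed.

(** [Z] is a limit of polynomials in [E], hence its commutation property. The correction is a
    multiple of [E^2 - E], so it is nullhomotopic when [E] is idempotent up to homotopy. *)
Lemma mx_fitting n (E : 'M[A]_n) : exists Z : 'M_n,
  (forall f : 'M_n, f *m E = E *m f -> f *m Z = Z *m f) /\
  let e := E + (E *m E - E) *m Z in e *m e = e.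
Proof.
case: n E => [|n] E.
  by exists 0; split=> [f _|e]; apply/matrixP => -[].
have [g gE] := idempotent_polynomial (map_mx ka E).
(* The polynomial [g] is lifted through the coefficient field and evaluated at [E], so that [e0] is
   idempotent modulo the maximal ideal. *)
pose G := \sum_(i < size g) r g`_i *: E ^+ i.
have kG : map_mx ka G = horner_mx (map_mx ka E) g.
  rewrite map_mx_sum -[in RHS](coefK g) poly_def rmorph_sum; apply: eq_bigr => i _.
  have hi : horner_mx (map_mx ka E) 'X^i = map_mx ka E ^+ i.
    by rewrite rmorphXn; congr (_ ^+ i); exact: horner_mx_X.
  have hgi : horner_mx (map_mx ka E) (g`_i *: 'X^i) = ((g`_i)%:M : 'M_n.+1) * map_mx ka E ^+ i.
    rewrite -mul_polyC rmorphM; congr (_ * _); last exact: hi.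
    exact: horner_mx_C.
  apply: etrans (esym hgi).
  rewrite map_mxZ cl_kr -[RHS]/(_ *m _) mul_scalar_mx; congr (_ *: _).
  exact: (rmorphXn (map_mx ka : {rmorphism 'M_n.+1 -> 'M_n.+1})).
have Gc f : GRing.comm f E -> GRing.comm f G.
  move=> h; apply: commr_sum => i _; have := commrX i h.
  rewrite /GRing.comm -[LHS]/(f *m _) -[RHS]/(_ *m f) => hi.
  rewrite -[LHS]/(f *m (_ *: _)) -[RHS]/((_ *: _) *m f) -scalemxAr -scalemxAl.
  by rewrite hi.
pose e0 : 'M[A]_n.+1 := E + (E * E - E) * G.
have e0c (f : 'M[A]_n.+1) : GRing.comm f E -> GRing.comm f e0.
  move=> h; apply: commrD => //; apply: commrM; last exact: Gc.
  by apply: commrD; [apply: commrM | apply: commrN].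
have he0 : Fmx 1 (e0 * e0 - e0).
  apply: Fmx_ker; apply/eqP; rewrite map_mxB subr_eq0; apply/eqP.
  rewrite map_mxM /e0 map_mxD map_mxM map_mxB map_mxM kG.
  exact: gE.
have [| | | | | | | |Y [Yc YE]] := @idempotent_lift _ (@Fmx n.+1 n.+1) _ _ _ _ _ _ _ _ e0 he0.
- exact: Fmx_add.
- by move=> j a b; exact: Fmx_mull.
- by move=> j a b; exact: Fmx_mulr.
- by move=> a i j; exact: cl_0.
- by move=> j a h i l; apply: cl_sub; exact: h.
- by move=> j a b; exact: Fmx_mul.
- exact: Fmx_sep.
- exact: Fmx_lim.
pose W := 1 + (E + E - 1) * G + (E * E - E) * (G * G).
have uE : e0 * e0 - e0 = (E * E - E) * W.
  by apply: idempotent_defect => //; apply/esym/(Gc E).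
(* With [e0 = E + (E^2 - E) G] and [e0^2 - e0 = (E^2 - E) W], the lift [e0 + (e0^2 - e0) Y] is [E]
   corrected by this coefficient. *)
exists (G + W * Y); split=> [f fE|e].
  have fG := Gc f fE; apply: commrD => //; apply: commrM; last exact/Yc/e0c.
  apply: commrD; last by apply: commrM; [apply: commrD; [apply: commrM|apply: commrN]|apply: commrM].
  apply: commrD; first exact: commr1.
  apply: commrM => //; apply: commrD; first by apply: commrD.
  by apply: commrN; exact: commr1.
have -> : e = e0 + (e0 * e0 - e0) * Y.
  rewrite -[e]/(E + (E * E - E) * (G + W * Y)).
  by rewrite uE -mulrA /e0 -addrA -mulrDr.
exact: YE.
Qed.

End CompleteLocalMatrices.

(** * Finite free modules and homotopy idempotents *)

Section FiniteFree.
Variables (k : fieldType) (A : comPzRingType) (L : clocal k A).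

Lemma fin_gen_surjection (P : lmodType A) : fin_gen P ->
  exists n (p : {linear 'rV[A]_n -> P}), forall y, exists x, p x = y.
Proof.
case=> n [e he].
have pL : linear (fun u : 'rV[A]_n => \sum_i u 0 i *: e i).
  move=> a u u'; rewrite scaler_sumr -big_split; apply: eq_bigr => i _ /=.
  by rewrite !mxE scalerDl scalerA.
exists n, (mk_linear pL) => y; have [c ->] := he y.
exists (\row_i c i); rewrite -[LHS]/(\sum_i (\row_i c i) 0 i *: e i).
by apply: eq_bigr => i _; rewrite mxE.
Qed.

Lemma fin_gen_free (P : lmodType A) : projective P -> fin_gen P ->
  exists n (f : {linear P -> 'rV[A]_n}) (g : {linear 'rV[A]_n -> P}),
    cancel f g /\ cancel g f.
Proof.
move=> pP /fin_gen_surjection[n [p psurj]].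
have [s sE] := @pP _ P p (idfun : {linear P -> P}) psurj.
have ps y : p (s y) = y by exact: sE.
pose E := lin1_mx (s \o p).
have EE u : u *m E = s (p u) by exact: (mul_rV_lin1 (s \o p : {linear _ -> _})).
have [|r [U [V [UV VU]]]] := @mx_idempotent_split k A L n E.
  by apply/row_matrixP => i; rewrite row_mul !rowE !EE ps.
have fL : linear (fun y => s y *m U).
  by move=> a y y'; rewrite (linearP s) mulmxDl scalemxAl.
have gL : linear (fun u : 'rV_r => p (u *m V)).
  by move=> a u u'; rewrite mulmxDl -scalemxAl (linearP p).
exists r, (mk_linear fL), (mk_linear gL); split=> y.
  rewrite -[LHS]/(p (s y *m U *m V)) -mulmxA UV EE !ps.
  by [].
rewrite -[LHS]/(s (p (y *m V)) *m U) -EE -UV -!mulmxA VU mulmx1 VU.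
by rewrite mulmx1.
Qed.

Lemma linear_fitting (P : lmodType A) n (f : {linear P -> 'rV[A]_n})
    (g : {linear 'rV[A]_n -> P}) (E : {linear P -> P}) :
  cancel f g -> cancel g f ->
  exists Z : {linear P -> P},
    (forall h : {linear P -> P}, (forall p, h (E p) = E (h p)) ->
       forall p, h (Z p) = Z (h p)) /\
    forall e : P -> P, (forall p, e p = E p + (E (E (Z p)) - E (Z p))) ->
       forall p, e (e p) = e p.
Proof.
move=> fK gK; pose mat (h : {linear P -> P}) := lin1_mx (f \o h \o g).
have matE (h : {linear P -> P}) u : u *m mat h = f (h (g u)).
  exact: (mul_rV_lin1 (f \o h \o g : {linear _ -> _})).
have [Z [Zc Ze]] := mx_fitting L (mat E).
have zL : linear (fun p => g (f p *m Z)).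
  by move=> a p q; rewrite (linearP f) mulmxDl -scalemxAl (linearP g).
have EZ : mat E *m Z = Z *m mat E by apply: Zc.
exists (mk_linear zL); split=> [h hE p|e eE p].
  have hEm : mat h *m mat E = mat E *m mat h.
    apply/row_matrixP => i; rewrite !row_mul !rowE.
    by rewrite !matE !fK hE.
  have := Zc _ hEm => /(congr1 (mulmx (f p))); rewrite !mulmxA matE.
  rewrite -[mk_linear zL p]/(g (f p *m Z)) -[mk_linear zL (h p)]/(g (f (h p) *m Z)).
  rewrite fK => ->; rewrite matE !fK.
  by [].
have fe q : f (e q) = f q *m (mat E + (mat E *m mat E - mat E) *m Z).
  rewrite eE (linearD f) (linearB f) mulmxDr matE fK; congr (_ + _).
  rewrite -[mk_linear zL q]/(g (f q *m Z)) mulmxBl mulmxBr -!mulmxA EZ.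
  rewrite [mat E *m (Z *m mat E)]mulmxA EZ -!mulmxA.
  by rewrite !mulmxA !matE !fK.
by rewrite -[LHS]fK !fe -mulmxA Ze -fe fK.
Qed.

End FiniteFree.

Lemma tens_rV (B Q : comPzRingType) (c : {rmorphism B -> Q}) n :
  exists (f : {linear tens c 'rV[B]_n -> 'rV[Q]_n}) (g : {linear 'rV[Q]_n -> tens c 'rV[B]_n}),
    cancel f g /\ cancel g f.
Proof.
have mB : zmod_morphism (map_mx c : 'rV[B]_n -> 'rV[Q]_n).
  by move=> u v; rewrite map_mxB.
have mZ : semilinear c (mk_additive mB) by move=> a u; rewrite -[LHS]/(map_mx c _) map_mxZ.
have [f fE] := tens_extend mZ.
pose b i : tens c 'rV[B]_n := ti c (delta_mx 0 i : 'rV[B]_n).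
have gL : linear (fun u : 'rV[Q]_n => \sum_i u 0 i *: b i).
  move=> a u u'; rewrite scaler_sumr -big_split; apply: eq_bigr => i _ /=.
  by rewrite !mxE scalerDl scalerA.
pose g : {linear 'rV[Q]_n -> tens c 'rV[B]_n} := mk_linear gL.
exists f, g; split.
  apply: (tens_lext (f := g \o f) (g := idfun)) => u.
  rewrite -[LHS]/(g (f (ti c u))) fE -[LHS]/(\sum_i (map_mx c u) 0 i *: b i).
  rewrite -[RHS]/(ti c u) {2}[u]row_sum_delta raddf_sum; apply: eq_bigr => i _.
  by rewrite mxE /b -tiZ.
move=> u; rewrite -[g u]/(\sum_i u 0 i *: b i) linear_sum.
rewrite [RHS]row_sum_delta; apply: eq_bigr => i _.
rewrite linearZ_LR fE -[mk_additive mB _]/(map_mx c _); congr (_ *: _).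
by rewrite map_delta_mx.
Qed.

(** * Chain maps up to homotopy *)

Section HomotopyAlgebra.
Variables (B : comPzRingType) (P : lmodType B) (D : {linear P -> P}).
Implicit Types f g h : {linear P -> P}.

Definition chain f := forall p, f (D p) = D (f p).
Definition htpic f g := exists h, forall p, f p - g p = D (h p) + h (D p).

Lemma htpic_eq f g : f =1 g -> htpic f g.
Proof.
move=> e; exists \0 => p; rewrite e subrr -[RHS]/(D 0 + 0) linear0 addr0.
by [].
Qed.
Lemma htpic_sym f g : htpic f g -> htpic g f.
Proof.
case=> h hE; exists (\- h) => p; rewrite -opprB hE opprD -[RHS]/(D (- h p) - h (D p)).
by rewrite linearN.
Qed.
Lemma htpic_trans f g f' : htpic f g -> htpic g f' -> htpic f f'.
Proof.
case=> h hE [h' h'E]; exists (h \+ h') => p.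
rewrite -[RHS]/(D (h p + h' p) + (h (D p) + h' (D p))) (linearD D).
by rewrite addrACA -hE -h'E addrA subrK.
Qed.
Lemma htpic_add f g f' g' : htpic f g -> htpic f' g' -> htpic (f \+ f') (g \+ g').
Proof.
case=> h hE [h' h'E]; exists (h \+ h') => p.
rewrite -[RHS]/(D (h p + h' p) + (h (D p) + h' (D p))) (linearD D).
by rewrite addrACA -hE -h'E -[LHS]/(f p + f' p - (g p + g' p)) opprD addrACA.
Qed.
Lemma htpic_compl f g g' : chain f -> htpic g g' -> htpic (f \o g) (f \o g').
Proof.
move=> cf [h hE]; exists (f \o h) => p.
by rewrite -[LHS]/(f (g p) - f (g' p)) -(linearB f) hE (linearD f) cf.
Qed.
Lemma htpic_compr f g g' : chain f -> htpic g g' -> htpic (g \o f) (g' \o f).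
Proof.
move=> cf [h hE]; exists (h \o f) => p.
rewrite -[LHS]/(g (f p) - g' (f p)) hE.
by rewrite -[RHS]/(D (h (f p)) + h (f (D p))) cf.
Qed.

Lemma chain_comp f g : chain f -> chain g -> chain (f \o g).
Proof. by move=> cf cg p; rewrite -[LHS]/(f (g (D p))) cg cf. Qed.
Lemma chain_id : chain idfun. Proof. by []. Qed.

(** Sandwiching [f f' + f' f ~ 1] between [f] and [f'] gives [f^2 f'^2 + (f f')^2 ~ f f'], and the
    first term is nullhomotopic. *)
Lemma htpic_idempotent f f' : chain f -> chain f' ->
  htpic ((f \o f') \+ (f' \o f)) idfun -> htpic (f \o f) \0 ->
  htpic (f \o f' \o (f \o f')) (f \o f').
Proof.
move=> cf cf' h1 [h2 h2E].
have c2 := chain_comp cf cf.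
have [h hE] := htpic_compl cf (htpic_compr cf' h1).
exists (h \- (h2 \o f' \o f')) => p.
rewrite -[RHS]/(D (h p - h2 (f' (f' p))) + (h (D p) - h2 (f' (f' (D p))))) linearB.
have := hE p; rewrite -[LHS]/(f (f (f' (f' p)) + f' (f (f' p))) - f (f' p)) (linearD f).
have := h2E (f' (f' p)); rewrite -[LHS]/(f (f (f' (f' p))) - 0) subr0 !cf' => e2 e1.
rewrite -[LHS]/(f (f' (f (f' p))) - f (f' p)).
have -> : f (f' (f (f' p))) - f (f' p)
  = f (f (f' (f' p))) + f (f' (f (f' p))) - f (f' p) - f (f (f' (f' p))) by abel.
by rewrite e1 e2; abel.
Qed.

Lemma htpic0 f g : chain f -> chain g -> htpic g \0 ->
  forall f', chain f' -> htpic (f \o g \o f') \0.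
Proof.
move=> cf cg g0 f' cf'; apply: htpic_trans (htpic_compr cf' (htpic_compl cf g0)) _.
by apply: htpic_eq => p; rewrite -[LHS]/(f 0) linear0.
Qed.

(** Replacing [ep] by [f f'] reduces the first claim to idempotency of [f f'] and of [f' f] up to
    homotopy, and the second to [f'^2 ~ 0]. *)
Lemma htpic_split f f' ep : chain f -> chain f' -> chain ep -> htpic ep (f \o f') ->
  htpic ((f \o f') \+ (f' \o f)) idfun -> htpic (f \o f) \0 -> htpic (f' \o f') \0 ->
  htpic ((f \o f' \o ep) \+ (f' \o ep \o f)) idfun /\ htpic (ep \o f' \o ep) \0.
Proof.
move=> cf cf' cep epE h1 h2 h3; split; last first.
  have c1 : chain (f' \o ep) by exact: chain_comp.
  apply: htpic_trans (htpic_compr c1 epE) _.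
  apply: htpic_trans (htpic0 cf (chain_comp cf' cf') h3 cep).
  exact: htpic_eq.
have h1' : htpic ((f' \o f) \+ (f \o f')) idfun.
  by apply: htpic_trans h1; apply: htpic_eq => p; exact: addrC.
apply: htpic_trans (h1); apply: htpic_add.
  apply: htpic_trans (htpic_compl (chain_comp cf cf') epE) _.
  exact: htpic_idempotent.
apply: htpic_trans (htpic_compr cf (htpic_compl cf' epE)) _.
apply: htpic_trans (htpic_idempotent cf' cf h1' h3).
exact: htpic_eq.
Qed.

End HomotopyAlgebra.

Lemma linear_split (k : fieldType) (A : comPzRingType) (L : clocal k A) n
    (E : {linear 'rV[A]_n -> 'rV[A]_n}) : (forall u, E (E u) = E u) ->
  exists m (p : {linear 'rV[A]_n -> 'rV[A]_m}) (j : {linear 'rV[A]_m -> 'rV[A]_n}),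
    (forall u, p (j u) = u) /\ (forall u, j (p u) = E u).
Proof.
move=> EE; have mE u : u *m lin1_mx E = E u by exact: mul_rV_lin1.
have [|m [U [V [UV VU]]]] := @mx_idempotent_split k A L n (lin1_mx E).
  by apply/row_matrixP => i; rewrite row_mul !rowE !mE EE.
have mL a b (M : 'M[A]_(a, b)) : linear (fun u : 'rV[A]_a => u *m M).
  by move=> r u u'; rewrite mulmxDl scalemxAl.
exists m, (mk_linear (mL _ _ U)), (mk_linear (mL _ _ V)); split=> u.
  by rewrite -[LHS]/(u *m V *m U) -mulmxA VU mulmx1.
by rewrite -[LHS]/(u *m U *m V) -mulmxA UV mE.
Qed.

Lemma rV_projective (A : comPzRingType) n : projective 'rV[A]_n.
Proof.
move=> M N p f ps.
have /choice[h hE] (i : 'I_n) : exists m, p m = f (delta_mx 0 i) by exact: ps.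
have gL : linear (fun u : 'rV[A]_n => \sum_i u 0 i *: h i).
  move=> a u u'; rewrite scaler_sumr -big_split; apply: eq_bigr => i _ /=.
  by rewrite !mxE scalerDl scalerA.
exists (mk_linear gL) => u; rewrite -[LHS]/(p (\sum_i u 0 i *: h i)) [in RHS](row_sum_delta u).
rewrite !linear_sum; apply: eq_bigr => i _.
by rewrite !linearZ_LR hE.
Qed.

Lemma rV_fin_gen (A : comPzRingType) n : fin_gen 'rV[A]_n.
Proof.
exists n, (fun i => delta_mx 0 i) => u; exists (fun i => u 0 i).
exact: row_sum_delta.
Qed.

Lemma mfact_of_odd (A : comPzRingType) (w : A) (W0 W1 : lmodType A)
    (pW0 : projective W0) (pW1 : projective W1)
    (D : {linear (W0 * W1)%type -> (W0 * W1)%type}) :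
  (forall a, (D (a, 0)).1 = 0) -> (forall b, (D (0, b)).2 = 0) ->
  (forall t, D (D t) = w *: t) ->
  exists (d01 : {linear W0 -> W1}) (d10 : {linear W1 -> W0})
    (h0 : forall a, d10 (d01 a) = w *: a) (h1 : forall b, d01 (d10 b) = w *: b),
    forall t, mf_d (MFact pW0 pW1 h0 h1) t = D t.
Proof.
move=> D0 D1 DD.
have L01 : linear (fun a => (D (a, 0)).2).
  move=> r a b; have -> : (r *: a + b, 0) = r *: (a, 0) + (b, 0) :> W0 * W1.
    by rewrite -[RHS]/(r *: a + b, r *: 0 + 0) scaler0 addr0.
  by rewrite (linearP D).
have L10 : linear (fun b => (D (0, b)).1).
  move=> r a b; have -> : (0, r *: a + b) = r *: (0, a) + (0, b) :> W0 * W1.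
    by rewrite -[RHS]/(r *: 0 + 0, r *: a + b) scaler0 addr0.
  by rewrite (linearP D).
have e0 a : (0, (D (a, 0)).2) = D (a, 0) by move: (D0 a); case: (D _) => x y /= ->.
have e1 b : ((D (0, b)).1, 0) = D (0, b) by move: (D1 b); case: (D _) => x y /= ->.
have h0 a : mk_linear L10 (mk_linear L01 a) = w *: a.
  by rewrite -[LHS]/(D (0, (D (a, 0)).2)).1 e0 DD.
have h1 b : mk_linear L01 (mk_linear L10 b) = w *: b.
  by rewrite -[LHS]/(D ((D (0, b)).1, 0)).2 e1 DD.
exists (mk_linear L01), (mk_linear L10), h0, h1 => -[a b].
have -> : (a, b) = (a, 0) + (0, b) :> W0 * W1 by rewrite -[RHS]/(a + 0, 0 + b) addr0 add0r.
rewrite (linearD D) -e0 -e1 -[LHS]/((D (0, 0 + b)).1, (D (a + 0, 0)).2) addr0 add0r.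
by rewrite -[RHS]/(0 + (D (0, b)).1, (D (a, 0)).2 + 0) addr0 add0r.
Qed.

(** * Operators on the base of an extended factorization *)

Section BaseOperators.
Variables (B Q : comPzRingType) (A : xalg B Q).
Variables (w : B) (v : Q).
Hypothesis vE : v = xc A w + xx A * xy A.
Local Notation c := (xc A).
Local Notation x := (xx A).
Local Notation y := (xy A).
Variables (V0 V1 : lmodType B).
Variables (p0 : projective (tens c V0)) (p1 : projective (tens c V1)).
Variables (d01 : {linear tens c V0 -> tens c V1}).
Variables (d10 : {linear tens c V1 -> tens c V0}).
Hypothesis d2_0 : forall u, d10 (d01 u) = v *: u.
Hypothesis d2_1 : forall u, d01 (d10 u) = v *: u.
Local Notation Y := (ext_mfact p0 p1 d2_0 d2_1).
Local Notation MY := (ext_xmod A V0 V1).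
Local Notation N' := (mf_tot Y).
Local Notation P := (V0 * V1)%type.
Local Notation d := (mf_d Y).
Local Notation D0 := (base_d p0 p1 d2_0 d2_1).
Local Notation i := (xi MY : P -> N').
Local Notation e := (xe MY : N' -> P).
Local Notation dx := (mdx MY : N' -> N').
Local Notation dy := (mdy MY : N' -> N').
Local Notation exY := (ex MY : N' -> N').

(** Division by [y] after setting [x = 0]. Hence [e (dye m)] is the coefficient of [y] in [m], as
    [e (dx m)] is that of [x]. *)
Definition dye (m : N') : N' := dy (exY m).
Lemma dyeB : zmod_morphism dye.
Proof. by move=> m n; rewrite /dye (raddfB (ex MY)) (raddfB (mdy MY)). Qed.
Lemma dyeD m n : dye (m + n) = dye m + dye n.
Proof. by rewrite /dye (raddfD (ex MY)) (raddfD (mdy MY)). Qed.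
Lemma dye0 : dye 0 = 0.
Proof. by rewrite /dye (raddf0 (ex MY)) (raddf0 (mdy MY)). Qed.
Lemma dye_c r m : dye (c r *: m) = c r *: dye m.
Proof. by rewrite /dye (@ex_c _ _ _ MY) (@mdyc _ _ _ MY). Qed.

Lemma base_decomp m : m = i (e m) + x *: dx m + y *: dye m.
Proof. exact: (@mdecomp _ _ _ MY). Qed.
Lemma d_base_decomp m : d m = d (i (e m)) + x *: d (dx m) + y *: d (dye m).
Proof.
by rewrite {1}[m]base_decomp (linearD d) (linearD d) !(linearZ_LR d).
Qed.
Lemma ed m : e (d m) = D0 (e m). Proof. exact: xe_d. Qed.

Lemma dx_d m : dx (d m) = dx (d (i (e m))) + d (dx m) + y *: dx (d (dye m)).
Proof.
rewrite {1}d_base_decomp !(raddfD (mdx MY)); congr (_ + _ + _).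
  exact: (@mdx_x _ _ _ MY).
exact: (@mdx_y _ _ _ MY).
Qed.
Lemma dye_x m : dye (x *: m) = 0.
Proof. by rewrite /dye (@ex_x _ _ _ MY) raddf0. Qed.
Lemma dye_y m : dye (y *: m) = exY m.
Proof. by rewrite /dye (@ex_y _ _ _ MY) (@mdy_y _ _ _ MY). Qed.
Lemma dye_d m : dye (d m) = dye (d (i (e m))) + exY (d (dye m)).
Proof. by rewrite {1}d_base_decomp !dyeD dye_x addr0 dye_y. Qed.
Lemma dx_dye m : dx (dye m) = 0.
Proof. exact: (@dx_dy_ex _ _ _ MY). Qed.
Lemma dye_ex m : dye (exY m) = dye m.
Proof. by rewrite /dye (@ex_ex _ _ _ MY). Qed.
Lemma e_yZ m : e (y *: m) = 0.
Proof. exact: (@e_y _ _ _ MY). Qed.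

Lemma e_add m n : e (m + n) = e m + e n.
Proof. exact: raddfD. Qed.
Lemma e0 : e 0 = 0.
Proof. exact: raddf0. Qed.
Lemma e_exY m : e (exY m) = e m.
Proof. exact: (@e_ex _ _ _ MY). Qed.
Lemma dx_add m n : dx (m + n) = dx m + dx n.
Proof. exact: raddfD. Qed.
Lemma dx_yZ m : dx (y *: m) = y *: dx m.
Proof. exact: (@mdx_y _ _ _ MY). Qed.

Lemma e_dx_d m : e (dx (d m)) = e (dx (d (i (e m)))) + D0 (e (dx m)).
Proof.
rewrite dx_d (e_add (_ + d _) (y *: _)) e_yZ addr0.
by rewrite (e_add (dx _) (d _)) ed.
Qed.
Lemma e_dye_d m : e (dye (d m)) = e (dye (d (i (e m)))) + D0 (e (dye m)).
Proof. by rewrite dye_d (e_add (dye _) (exY _)) e_exY ed. Qed.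
Lemma e_dye_dx_d m : e (dye (dx (d m))) = e (dye (dx (d (i (e m)))))
  + e (dye (d (i (e (dx m))))) + e (dx (d (i (e (dye m))))) + D0 (e (dye (dx m))).
Proof.
rewrite dx_d (dyeD (_ + d _) (y *: _)) dye_y (dyeD (dx _) (d _)).
rewrite (e_add (_ + dye _) (exY _)) (e_add (dye _) (dye _)) e_exY e_dye_d e_dx_d dx_dye.
rewrite e0 (linear0 D0); abel.
Qed.
Lemma e_dx_dx_d m : e (dx (dx (d m))) = e (dx (dx (d (i (e m)))))
  + e (dx (d (i (e (dx m))))) + D0 (e (dx (dx m))).
Proof.
rewrite dx_d (dx_add (_ + d _) (y *: _)) dx_yZ (dx_add (dx _) (d _)).
by rewrite (e_add (_ + dx _) (y *: _)) e_yZ addr0 (e_add (dx _) (dx _)) e_dx_d addrA.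
Qed.
Lemma e_dye_dye_d m : e (dye (dye (d m))) = e (dye (dye (d (i (e m)))))
  + e (dye (d (i (e (dye m))))) + D0 (e (dye (dye m))).
Proof.
by rewrite dye_d (dyeD (dye _) (exY _)) dye_ex (e_add (dye _) (dye _)) e_dye_d addrA.
Qed.

Lemma dx_v p : dx (v *: i p) = y *: i p.
Proof.
rewrite (v_scaleE vE) (raddfD (mdx MY)) (@mdxc _ _ _ MY) (@mdx_i _ _ _ MY).
by rewrite scaler0 add0r (@mdx_x _ _ _ MY).
Qed.
Lemma dye_v p : dye (v *: i p) = 0.
Proof.
rewrite (v_scaleE vE) dyeD dye_x addr0 dye_c /dye (@ex_i _ _ _ MY).
by rewrite (@mdy_i _ _ _ MY) scaler0.
Qed.

Lemma base_op (f : N' -> N') : zmod_morphism f ->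
  (forall r m, f (c r *: m) = c r *: f m) ->
  {g : {linear P -> P} | forall p, g p = e (f (i p))}.
Proof.
move=> fB fZ; have gL : linear (fun p => e (f (i p))).
  have fD m n : f (m + n) = f m + f n by exact: (raddfD (mk_additive fB)).
  move=> a p q; rewrite (raddfD (xi MY)) (@xiZ _ _ _ MY) fD fZ (raddfD (xe MY)).
  by rewrite (@xeZ _ _ _ MY) xev_c.
by exists (mk_linear gL).
Qed.

Lemma dB m n : d (m - n) = d m - d n. Proof. exact: (linearB d). Qed.
Lemma dZ a m : d (a *: m) = a *: d m. Proof. exact: (linearZ_LR d). Qed.
Lemma dxB m n : dx (m - n) = dx m - dx n. Proof. exact: (raddfB (mdx MY)). Qed.
Lemma dxZ r m : dx (c r *: m) = c r *: dx m. Proof. exact: (@mdxc _ _ _ MY). Qed.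

(* With [d = D0 + x ph + y th + xy ps + x^2 D20 + y^2 D02 + ..], these are the
   coefficients of [x], [y], [xy], [x^2] and [y^2] in [d^2 = w + xy]. *)
Lemma base_relations : exists ph th ps D20 D02 : {linear P -> P},
  [/\ forall p, ph p = e (dx (d (i p))),
      forall p, th p = e (dye (d (i p))),
      forall p, ph (D0 p) + D0 (ph p) = 0,
      forall p, th (D0 p) + D0 (th p) = 0 &
      [/\ forall p, ps (D0 p) + th (ph p) + ph (th p) + D0 (ps p) = p,
      forall p, D20 (D0 p) + ph (ph p) + D0 (D20 p) = 0
    & forall p, D02 (D0 p) + th (th p) + D0 (D02 p) = 0]].
Proof.
have [ph phE] := @base_op (fun m => dx (d m)) (fun m n => etrans (congr1 _ (dB m n)) (dxB _ _))
  (fun r m => etrans (congr1 _ (dZ _ m)) (dxZ r _)).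
have [th thE] := @base_op (fun m => dye (d m)) (fun m n => etrans (congr1 _ (dB m n)) (dyeB _ _))
  (fun r m => etrans (congr1 _ (dZ _ m)) (dye_c r _)).
have [ps psE] : {g : {linear P -> P} | forall p, g p = e (dye (dx (d (i p))))}.
  apply: (@base_op (fun m => dye (dx (d m)))) => [m n|r m].
    by rewrite dB dxB dyeB.
  by rewrite dZ dxZ dye_c.
have [D20 D20E] : {g : {linear P -> P} | forall p, g p = e (dx (dx (d (i p))))}.
  apply: (@base_op (fun m => dx (dx (d m)))) => [m n|r m].
    by rewrite dB !dxB.
  by rewrite dZ !dxZ.
have [D02 D02E] : {g : {linear P -> P} | forall p, g p = e (dye (dye (d (i p))))}.
  apply: (@base_op (fun m => dye (dye (d m)))) => [m n|r m].
    by rewrite dB !dyeB.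
  by rewrite dZ !dye_c.
have ddi p : d (d (i p)) = v *: i p by exact: mf_dd.
have eD p : e (d (i p)) = D0 p by [].
exists ph, th, ps, D20, D02; split=> [//|//|p|p|].
- by rewrite !phE -(eD p) -e_dx_d ddi dx_v e_yZ.
- by rewrite !thE -(eD p) -e_dye_d ddi dye_v raddf0.
split=> p.
- rewrite psE !thE !phE psE -(eD p) -e_dye_dx_d ddi dx_v dye_y (@ex_i _ _ _ MY).
  exact: (@xei _ _ _ MY).
- by rewrite D20E !phE D20E -(eD p) -e_dx_dx_d ddi dx_v (@mdx_y _ _ _ MY) e_yZ.
- rewrite D02E !thE D02E -(eD p) -e_dye_dye_d ddi dye_v.
  by rewrite dye0 raddf0.
Qed.

End BaseOperators.

Section PairParity.
Variables (B : comPzRingType) (V0 V1 : lmodType B).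
Local Notation P := (V0 * V1)%type.

Definition pair_pr_fun (j : bool) (p : P) : P := if j then (0, p.2) else (p.1, 0).
Lemma pair_pr_linear j : linear (pair_pr_fun j).
Proof.
move=> a [p1 p2] [q1 q2]; rewrite /pair_pr_fun.
by case: j; congr pair => /=; rewrite ?scaler0 ?addr0.
Qed.
Definition pair_pr j : {linear P -> P} := mk_linear (pair_pr_linear j).

Definition pair_sg_fun (p : P) : P := (p.1, - p.2).
Lemma pair_sg_linear : linear pair_sg_fun.
Proof. by move=> a [p1 p2] [q1 q2]; congr pair; rewrite /= opprD scalerN. Qed.
Definition pair_sg : {linear P -> P} := mk_linear pair_sg_linear.

Lemma pair_sgE p : pair_sg p = pair_pr false p - pair_pr true p.
Proof. by case: p => a b; congr pair; rewrite /= ?subr0 ?sub0r. Qed.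
Lemma pair_sgK p : pair_sg (pair_sg p) = p.
Proof. by case: p => a b; congr pair; rewrite /= opprK. Qed.

Lemma pair_pr_sg j p : pair_pr j (pair_sg p) = pair_sg (pair_pr j p).
Proof. by case: p => a b; case: j; congr pair; rewrite /= ?oppr0. Qed.
End PairParity.

Lemma odd_sg (B : comPzRingType) (V0 V1 W0 W1 : lmodType B)
    (f : {linear (V0 * V1)%type -> (W0 * W1)%type}) :
  (forall j p, f (pair_pr V0 V1 j p) = pair_pr W0 W1 (~~ j) (f p)) ->
  forall p, f (pair_sg V0 V1 p) = - pair_sg W0 W1 (f p).
Proof. by move=> h p; rewrite !pair_sgE (linearB f) !h opprB. Qed.

Section BaseParity.
Variables (B Q : comPzRingType) (A : xalg B Q) (v : Q).
Local Notation c := (xc A).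
Variables (V0 V1 : lmodType B).
Variables (p0 : projective (tens c V0)) (p1 : projective (tens c V1)).
Variables (d01 : {linear tens c V0 -> tens c V1}).
Variables (d10 : {linear tens c V1 -> tens c V0}).
Hypothesis d2_0 : forall u, d10 (d01 u) = v *: u.
Hypothesis d2_1 : forall u, d01 (d10 u) = v *: u.
Local Notation Y := (ext_mfact p0 p1 d2_0 d2_1).
Local Notation MY := (ext_xmod A V0 V1).
Local Notation N' := (mf_tot Y).
Local Notation P := (V0 * V1)%type.
Local Notation i := (xi MY : P -> N').
Local Notation e := (xe MY : N' -> P).
Local Notation dy := (mdy MY : N' -> N').
Local Notation pr := (pair_pr V0 V1).

Lemma i_pr j p : i (pr j p) = mf_pr Y j (i p).
Proof.
case: p => a b; case: j.
  by rewrite -[LHS]/(ti c 0, ti c b) raddf0.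
by rewrite -[LHS]/(ti c a, ti c 0) raddf0.
Qed.
Lemma e_pr j m : e (mf_pr Y j m) = pr j (e m).
Proof.
case: m => a b; case: j.
  by rewrite -[LHS]/(xe (tens_xmod A V0) 0, xe (tens_xmod A V1) b) raddf0.
by rewrite -[LHS]/(xe (tens_xmod A V0) a, xe (tens_xmod A V1) 0) raddf0.
Qed.
Lemma dy_pr j m : dy (mf_pr Y j m) = mf_pr Y j (dy m).
Proof.
case: m => a b; case: j.
  by rewrite -[LHS]/(mdy (tens_xmod A V0) 0, mdy (tens_xmod A V1) b) raddf0.
by rewrite -[LHS]/(mdy (tens_xmod A V0) a, mdy (tens_xmod A V1) 0) raddf0.
Qed.
Lemma dye_pr j m : dye (mf_pr Y j m) = mf_pr Y j (dye m).
Proof.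
rewrite /dye !(@exE _ _ _ MY) (@dx_pr _ _ A v V0 V1 p0 p1 d01 d10 d2_0 d2_1).
by rewrite -(linearZ_LR (mf_pr Y j)) -(linearB (mf_pr Y j)) dy_pr.
Qed.
Lemma e_sg m : e (mf_sg Y m) = pair_sg V0 V1 (e m).
Proof. by rewrite mf_sgE (raddfB (xe MY)) !e_pr pair_sgE. Qed.

End BaseParity.

(** * Essential surjectivity in finite rank *)

Section FiniteRank.
Variables (k : fieldType) (B Q : comPzRingType) (A : xalg B Q) (L : clocal k B).
Variables (rhoQ : {rmorphism k -> Q}) (w : B) (v : Q).
Hypothesis vE : v = xc A w + xx A * xy A.
Local Notation c := (xc A).
Variables r0 r1 : nat.
Local Notation V0 := ('rV[B]_r0 : lmodType B).
Local Notation V1 := ('rV[B]_r1 : lmodType B).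
Variables (p0 : projective (tens c V0)) (p1 : projective (tens c V1)).
Variables (d01 : {linear tens c V0 -> tens c V1}).
Variables (d10 : {linear tens c V1 -> tens c V0}).
Hypothesis d2_0 : forall u, d10 (d01 u) = v *: u.
Hypothesis d2_1 : forall u, d01 (d10 u) = v *: u.
Local Notation Y := (ext_mfact p0 p1 d2_0 d2_1).
Local Notation MY := (ext_xmod A V0 V1).
Local Notation N' := (mf_tot Y).
Local Notation P := (V0 * V1)%type.
Local Notation d := (mf_d Y).
Local Notation D0 := (base_d p0 p1 d2_0 d2_1).
Local Notation i := (xi MY : P -> N').
Local Notation e := (xe MY : N' -> P).
Local Notation dx := (mdx MY : N' -> N').
Local Notation exY := (ex MY : N' -> N').
Local Notation pr := (pair_pr V0 V1).
Local Notation sg := (pair_sg V0 V1).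

Lemma base_dd p : D0 (D0 p) = w *: p.
Proof.
have -> : D0 (D0 p) = e (d (d (i p))) by apply/esym; exact: ed.
by rewrite mf_dd (@xeZ _ _ _ MY) vE rmorphD rmorphM xev_c xev_x mul0r addr0 (@xei _ _ _ MY).
Qed.
Lemma base_d_pr j p : D0 (pr j p) = pr (~~ j) (D0 p).
Proof. by rewrite !base_dE i_pr mf_d_pr e_pr. Qed.
Lemma base_d_sg p : D0 (sg p) = - sg (D0 p).
Proof. exact: (odd_sg base_d_pr). Qed.

(* [F T = ph th] is idempotent up to homotopy; [ep] is a strict idempotent in
   its homotopy class, obtained by Fitting's lemma. *)
Lemma base_idempotent : exists (ph th F T ep : {linear P -> P}),
  [/\ [/\ forall p, ph p = e (dx (d (i p))), forall p, th p = e (dye (d (i p))),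
      forall p, F p = ph (sg p), forall p, T p = sg (th p) & chain D0 F],
      [/\ forall j p, th (pr j p) = pr (~~ j) (th p), forall j p, ph (pr j p) = pr (~~ j) (ph p),
        forall j p, ep (pr j p) = pr j (ep p), forall p, ep (ep p) = ep p & chain D0 ep]
    & [/\ htpic D0 (F \o T) ep, htpic D0 (ep \o T \o ep) \0, htpic D0 (F \o F \o T) \0
        & htpic D0 ((F \o T \o ep) \+ (T \o ep \o F)) idfun]].
Proof.
have [ph [th [ps [D20 [D02 [phE thE ph_d th_d [rel11 rel20 rel02]]]]]]] :=
  base_relations vE p0 p1 d2_0 d2_1.
have ph_pr j p : ph (pr j p) = pr (~~ j) (ph p).
  by rewrite !phE i_pr mf_d_pr dx_pr e_pr.
have th_pr j p : th (pr j p) = pr (~~ j) (th p).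
  by rewrite !thE i_pr mf_d_pr dye_pr e_pr.
have ph_sg p : ph (sg p) = - sg (ph p) by exact: (odd_sg ph_pr).
have th_sg p : th (sg p) = - sg (th p) by exact: (odd_sg th_pr).
have phD p : ph (D0 p) = - D0 (ph p) by apply/eqP; rewrite -addr_eq0 ph_d.
have thD p : th (D0 p) = - D0 (th p) by apply/eqP; rewrite -addr_eq0 th_d.
(* [ph] and [th] anticommute with [D0]; the grading involution makes chain maps of them. It acts on
   the source for [F] and on the target for [T], so that [F T = ph th] without a sign. *)
have [F FE] : exists F : {linear P -> P}, forall p, F p = ph (sg p) by exists (ph \o sg).
have [T TE] : exists T : {linear P -> P}, forall p, T p = sg (th p) by exists (sg \o th).
have cF : chain D0 F.
  move=> p; rewrite !FE -[sg (D0 p)]opprK -base_d_sg (linearN ph) phD opprK.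
  by [].
have cT : chain D0 T.
  by move=> p; rewrite !TE thD (linearN sg) -base_d_sg.
have FT p : F (T p) = ph (th p) by rewrite FE TE pair_sgK.
have TF p : T (F p) = th (ph p).
  by rewrite FE TE ph_sg (linearN th) th_sg opprK pair_sgK.
have FF p : F (F p) = - ph (ph p) by rewrite !FE (ph_sg p) (linearN sg) pair_sgK (linearN ph).
have TT p : T (T p) = - th (th p) by rewrite !TE th_sg (linearN sg) pair_sgK.
have H1 : htpic D0 ((F \o T) \+ (T \o F)) idfun.
  exists (\- ps) => p; rewrite -[LHS]/(F (T p) + T (F p) - p) FT TF -{3}[p]rel11.
  by rewrite -[RHS]/(D0 (- ps p) - ps (D0 p)) (linearN D0); abel.
have H2 : htpic D0 (F \o F) \0.
  exists D20 => p; rewrite -[LHS]/(F (F p) - 0) FF subr0.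
  by apply/eqP; rewrite eq_sym -subr_eq0 opprK; apply/eqP; rewrite -[RHS](rel20 p); abel.
have H3 : htpic D0 (T \o T) \0.
  exists D02 => p; rewrite -[LHS]/(T (T p) - 0) TT subr0.
  by apply/eqP; rewrite eq_sym -subr_eq0 opprK; apply/eqP; rewrite -[RHS](rel02 p); abel.
have [E EE] : exists E : {linear P -> P}, forall p, E p = F (T p) by exists (F \o T).
have [f [g [fK gK]]] : exists (f : {linear P -> 'rV[B]_(r0 + r1)}) (g : {linear 'rV[B]_(r0 + r1) -> P}),
    cancel f g /\ cancel g f.
  have fL : linear (fun p : P => row_mx p.1 p.2).
    by move=> a p q; rewrite scale_row_mx add_row_mx.
  have gL : linear (fun u : 'rV[B]_(r0 + r1) => (lsubmx u, rsubmx u) : P).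
    by move=> a u u'; rewrite !linearP.
  exists (mk_linear fL), (mk_linear gL); split=> [[a b]|u].
    by rewrite -[LHS]/(lsubmx (row_mx a b), rsubmx (row_mx a b)) row_mxKl row_mxKr.
  exact: hsubmxK.
have [Z [Zc Ze]] := linear_fitting L E fK gK.
have [ep epE] : exists ep : {linear P -> P}, forall p, ep p = E p + (E (E (Z p)) - E (Z p)).
  by exists (E \+ ((E \o E \o Z) \- (E \o Z))).
(* Applied below to [D0] and to the parity projections, so [ep] is an even chain map. *)
have epc (h : {linear P -> P}) : (forall p, h (E p) = E (h p)) -> forall p, ep (h p) = h (ep p).
  move=> hE p; have hZ := Zc h hE.
  by rewrite !epE (linearD h) (linearB h) !hE hZ.
have cE : chain D0 E by move=> p; rewrite !EE cT cF.
have cep : chain D0 ep by apply: epc => p; rewrite cE.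
have ep_pr j p : ep (pr j p) = pr j (ep p).
  apply: epc => q; rewrite !EE !FT th_pr ph_pr negbK.
  by [].
have cZ : chain D0 Z by move=> p; rewrite Zc // => q; rewrite cE.
have FTE : htpic D0 (F \o T) E by apply: htpic_eq => p; rewrite EE.
have EFT : htpic D0 ep (F \o T).
  have [h hE] := htpic_compr cZ (htpic_idempotent cF cT H1 H2).
  exists h => p; rewrite -hE epE -[LHS]/(E p + (E (E (Z p)) - E (Z p)) - F (T p)).
  by rewrite !EE [F (T p) + _]addrC addrK.
have [S1 S2] := htpic_split cF cT cep EFT H1 H2 H3.
exists ph, th, F, T, ep; split; split=> //.
- exact: Ze.
- exact: htpic_sym.
exact: (htpic0 (f := idfun) (chain_id D0) (chain_comp cF cF) H2 cT).
Qed.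

(** Compressing a homotopy on [P] by chain maps to and from [W] gives one on [W]; it carries
    relations up to homotopy to the image of [ep]. *)
Lemma linear_homotopy_retract (W : lmodType B) (DX : {linear W -> W}) (D : {linear P -> P})
    (pi : {linear P -> W}) (io : {linear W -> P}) (f g : {linear P -> P}) :
  (forall p, pi (D p) = DX (pi p)) -> (forall t, io (DX t) = D (io t)) -> htpic D f g ->
  exists a : {linear W -> W}, forall t,
    pi (f (io t)) - pi (g (io t)) = DX (a t) + a (DX t).
Proof.
move=> pD iD [h hE]; exists (pi \o h \o io) => t.
rewrite -[RHS]/(DX (pi (h (io t))) + pi (h (io (DX t)))) -(linearB pi) hE.
by rewrite (linearD pi) pD iD.
Qed.

(* [X] is the image of [ep]. The summands [T] and [T e] of the base of the
   stabilization of [X] match the images of [F T] and [T F]. *)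
Lemma finite_H0_iso : exists X : mfact w,
  [/\ fin_gen (mf0 X), fin_gen (mf1 X) & @H0_iso k (MFinf rhoQ v) (st_obj vE X) Y].
Proof.
have [ph [th [F [T [ep [[phE thE FE TE cF] [th_pr ph_pr ep_pr ep_ep cep] [H1 H2 H3 H4]]]]]]] :=
  base_idempotent.
have th_sg p : th (sg p) = - sg (th p) by exact: (odd_sg th_pr).
have ph_sg p : ph (sg p) = - sg (ph p) by exact: (odd_sg ph_pr).
have e0L : linear (fun a : V0 => (ep (a, 0)).1).
  move=> r a b; rewrite -[RHS]/((r *: ep (a, 0) + ep (b, 0)).1) -(linearP ep).
  by rewrite -[r *: (a, 0) + _]/(r *: a + b, r *: 0 + 0) scaler0 addr0.
have e1L : linear (fun a : V1 => (ep (0, a)).2).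
  move=> r a b; rewrite -[RHS]/((r *: ep (0, a) + ep (0, b)).2) -(linearP ep).
  by rewrite -[r *: (0, a) + _]/(r *: 0 + 0, r *: a + b) scaler0 addr0.
have ep0 a : ep (a, 0) = ((ep (a, 0)).1, 0) by exact: (ep_pr false (a, 0)).
have ep1 a : ep (0, a) = (0, (ep (0, a)).2) by exact: (ep_pr true (0, a)).
have [|s0 [pi0 [io0 [pio0 iop0]]]] := @linear_split k B L r0 (mk_linear e0L).
  move=> u; rewrite -[LHS]/((ep ((ep (u, 0)).1, 0)).1) -ep0 ep_ep.
  by [].
have [|s1 [pi1 [io1 [pio1 iop1]]]] := @linear_split k B L r1 (mk_linear e1L).
  move=> u; rewrite -[LHS]/((ep (0, (ep (0, u)).2)).2) -ep1 ep_ep.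
  by [].
pose W0 : lmodType B := 'rV[B]_s0; pose W1 : lmodType B := 'rV[B]_s1.
pose W : lmodType B := (W0 * W1)%type.
have [pi piE] : exists pi : {linear P -> W}, forall p, pi p = (pi0 p.1, pi1 p.2).
  have piL : linear (fun p : P => (pi0 p.1, pi1 p.2) : W).
    move=> r p q; rewrite -[LHS]/(pi0 (r *: p.1 + q.1), pi1 (r *: p.2 + q.2)).
    by rewrite (linearP pi0) (linearP pi1).
  by exists (mk_linear piL).
have [io ioE] : exists io : {linear W -> P}, forall t, io t = (io0 t.1, io1 t.2).
  have ioL : linear (fun t : W => (io0 t.1, io1 t.2) : P).
    move=> r p q; rewrite -[LHS]/(io0 (r *: p.1 + q.1), io1 (r *: p.2 + q.2)).
    by rewrite (linearP io0) (linearP io1).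
  by exists (mk_linear ioL).
have pio t : pi (io t) = t.
  by rewrite piE ioE; case: t => a b; congr pair; rewrite /= ?pio0 ?pio1.
have iop p : io (pi p) = ep p.
  have -> : ep p = ep (p.1, 0) + ep (0, p.2).
    rewrite -(linearD ep) -[_ + _]/(p.1 + 0, 0 + p.2) addr0 add0r.
    by case: (p).
  rewrite ioE piE ep0 ep1 -[RHS]/((ep (p.1, 0)).1 + 0, 0 + (ep (0, p.2)).2).
  by rewrite addr0 add0r; congr pair; rewrite /= ?iop0 ?iop1.
pose prW := pair_pr W0 W1; pose sgW := pair_sg W0 W1.
have pi_pr j p : pi (pr j p) = prW j (pi p).
  rewrite !piE; case: j; congr pair; rewrite /=.
    exact: linear0.
  exact: linear0.
have io_pr j t : io (prW j t) = pr j (io t).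
  rewrite !ioE; case: j; congr pair; rewrite /=.
    exact: linear0.
  exact: linear0.
have io_sg t : io (sgW t) = sg (io t) by rewrite !pair_sgE (linearB io) !io_pr.
have [DX DXE] : exists DX : {linear W -> W}, forall t, DX t = pi (D0 (io t)).
  by exists (pi \o D0 \o io).
have pe p : pi (ep p) = pi p by rewrite -iop pio.
have ei t : ep (io t) = io t by rewrite -iop pio.
have piD p : pi (D0 p) = DX (pi p) by rewrite DXE iop -cep pe.
have ioD t : io (DX t) = D0 (io t) by rewrite DXE iop cep ei.
have DX_pr j t : DX (prW j t) = prW (~~ j) (DX t).
  by rewrite !DXE io_pr base_d_pr pi_pr.
have [|||dX01 [dX10 [hX0 [hX1 dXE]]]] :=
    @mfact_of_odd B w W0 W1 (@rV_projective B s0) (@rV_projective B s1) DX.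
- by move=> a; exact: (congr1 fst (DX_pr false (a, 0))).
- by move=> a; exact: (congr1 snd (DX_pr true (0, a))).
- by move=> t; rewrite -[t]pio -!piD base_dd (linearZ_LR pi).
set X := MFact _ _ hX0 hX1 in dXE.
exists X; split; try exact: rV_fin_gen.
(* The image of [t e] is the coefficient of [y] in [d] at [x = 0], up to the grading sign.
   Closedness modulo [x] follows by applying [dye] to [d^2 = v], since [dye (v *: i p)] vanishes. *)
pose b (t : mf_tot X) : N' := dye (d (i (io (sgW t)))).
have bB : zmod_morphism b.
  move=> s t; rewrite /b (linearB sgW) (linearB io) (raddfB (xi MY)) (linearB d).
  exact: dyeB.
have bE t : mk_additive bB t = dye (d (i (io (sgW t)))) by [].
have bZ : semilinear c (mk_additive bB).
  move=> r t; rewrite !bE (linearZ_LR sgW) (linearZ_LR io).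
  by rewrite (@xiZ _ _ _ MY) (linearZ_LR d) dye_c.
have b_odd j t : mk_additive bB (mf_pr X j t) = mf_pr Y (~~ j) (mk_additive bB t).
  rewrite !bE -[mf_pr X j t]/(prW j t) -[sgW (prW j t)]/(pair_sg W0 W1 _) -pair_pr_sg.
  by rewrite -/prW io_pr i_pr mf_d_pr dye_pr.
have DXsg t : DX (sgW t) = - sgW (DX t) by exact: (odd_sg DX_pr).
have b_closed t : exY (d (mk_additive bB t) - mk_additive bB (mf_d X t)) = 0.
  rewrite (raddfB (ex MY)) dXE !bE.
  have -> : sgW (DX t) = - DX (sgW t) by rewrite DXsg opprK.
  rewrite (linearN io) ioD (raddfN (xi MY)) (linearN d).
  set p := io (sgW t).
  have dyeN m : dye (- m) = - dye m :> N'.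
    by apply/eqP; rewrite -addr_eq0 -dyeD addNr dye0.
  have edye m : exY (dye m) = dye m by exact: (@ex_dy_ex _ _ _ MY).
  have := dye_d (d (i p)); rewrite mf_dd (dye_v vE) => /eqP.
  rewrite eq_sym addrC addr_eq0 => /eqP ->.
  by rewrite dyeN (raddfN (ex MY)) edye opprK -[X in _ + X]/(dye (d (i (e (d (i p)))))) addNr.
(* The image of [t1] is the coefficient of [x] in [d], applied to that of [t1 e]; this is how the
   composite [F T] appears. *)
have cmpE t1 te : base_cmp (p0 := p0) (p1 := p1) (d2_0 := d2_0) (d2_1 := d2_1) bZ (t1, te)
    = F (T (io t1)) - T (io te).
  have eb t : e (mk_additive bB t) = - T (io t).
    by rewrite bE io_sg -thE th_sg -TE.
  rewrite base_cmpE (eb te); congr (_ - _).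
  rewrite /cmp1 e_sg (raddfB (mdx MY)) !bE (dx_dye (d (i (io (sgW (mf_d X t1)))))) subr0.
  rewrite e_dx_d dx_dye e0 (linear0 D0) addr0 -bE eb -phE (linearN ph) (linearN sg).
  by rewrite -ph_sg -FE.
have [a aE] := linear_homotopy_retract piD ioD H1.
have [b' bE'] := linear_homotopy_retract piD ioD H2.
have [c' cE'] := linear_homotopy_retract piD ioD H3.
have aE1 t : pi (F (T (io t))) - t = DX (a t) + a (DX t).
  by have <- := aE t; rewrite -[RHS]/(pi (F (T (io t))) - pi (ep (io t))) pe pio.
have bE1 t : pi (T (io t)) = DX (b' t) + b' (DX t).
  have <- := bE' t; rewrite -[RHS]/(pi (ep (T (ep (io t)))) - pi 0).
  by rewrite (linear0 pi) subr0 pe ei.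
have cE1 t : pi (F (F (T (io t)))) = DX (c' t) + c' (DX t).
  have <- := cE' t; rewrite -[RHS]/(pi (F (F (T (io t)))) - pi 0).
  by rewrite (linear0 pi) subr0.
have [h3 h3E] := H4.
(* On the image of [ep], [F T] is homotopic to the identity while the compressions of [T] and
   [F F T] are nullhomotopic, so [h1] inverts the comparison on one side. On the other side the
   composite is [F T ep + T ep F ~ 1]. *)
have h1L : linear (fun p => (pi p, - pi (F p)) : W * W).
  move=> r p q; rewrite (linearP F) !(linearP pi).
  by rewrite -[RHS]/(r *: pi p + pi q, r *: - pi (F p) + - pi (F q)) scalerN -opprD.
have h2L : linear (fun t : W * W => (a t.1 - b' t.2, a t.2 - c' t.1) : W * W).
  move=> r t t'; rewrite -[(r *: t + t').1]/(r *: t.1 + t'.1).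
  rewrite -[(r *: t + t').2]/(r *: t.2 + t'.2) !(linearP a) (linearP b') (linearP c').
  rewrite -[RHS]/(r *: (a t.1 - b' t.2) + (a t'.1 - b' t'.2),
    r *: (a t.2 - c' t.1) + (a t'.2 - c' t'.1)).
  by rewrite !(scalerBr r); congr pair; abel.
apply: (H0_iso_stabilization rhoQ vE (b := mk_additive bB) (bZ := bZ) b_odd b_closed
  (h1 := mk_linear h1L) (h2 := mk_linear h2L) (h3 := h3)).
- move=> p; rewrite -[LHS]/(pi (D0 p), - pi (F (D0 p))).
  rewrite -[RHS]/(mf_d X (pi p), mf_d X (- pi (F p))) !dXE (linearN DX) -!piD cF.
  by [].
- move=> [t1 te]; rewrite cmpE -[DD X (t1, te)]/(mf_d X t1, mf_d X te) !dXE.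
  rewrite -[DD X _]/(mf_d X (a t1 - b' te), mf_d X (a te - c' t1)) !dXE.
  set z := F (T (io t1)) - T (io te).
  rewrite -[LHS]/(pi z - t1, - pi (F z) - te).
  rewrite -[RHS]/(DX (a t1 - b' te) + (a (DX t1) - b' (DX te)),
    DX (a te - c' t1) + (a (DX te) - c' (DX t1))).
  rewrite /z (linearB F) !(linearB pi) !(linearB DX) bE1 cE1.
  have e1 := aE1 t1; have e2 := aE1 te.
  congr pair; apply/eqP; rewrite -subr_eq0; apply/eqP.
    transitivity (pi (F (T (io t1))) - t1 - (DX (a t1) + a (DX t1))); first by abel.
    by rewrite e1 subrr.
  transitivity (pi (F (T (io te))) - te - (DX (a te) + a (DX te))); first by abel.
  by rewrite e2 subrr.
move=> p; rewrite -h3E cmpE !(linearN io) !(linearN T) opprK !iop.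
by [].
Qed.

End FiniteRank.

(** * Finite rank factorizations over the completions *)

Lemma prod_fin_gen (B : comPzRingType) (V W : lmodType B) :
  fin_gen V -> fin_gen W -> fin_gen (V * W)%type.
Proof.
move=> [m [a ha]] [n [b hb]].
exists (m + n)%N, (fun i => match split i with inl j => (a j, 0) | inr j => (0, b j) end).
move=> [u t]; have [r ->] := ha u; have [q ->] := hb t.
exists (fun i => match split i with inl j => r j | inr j => q j end).
rewrite big_split_ord /=.
have -> : (\sum_i r i *: a i, \sum_i q i *: b i) = (\sum_i r i *: a i, 0) + (0, \sum_i q i *: b i) :> V * W.
  by rewrite -[RHS]/(\sum_i r i *: a i + 0, 0 + \sum_i q i *: b i) addr0 add0r.
have i1 : zmod_morphism (fun u : V => (u, 0) : V * W).
  by move=> x y; rewrite -[RHS]/(x - y, 0 - 0) subrr.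
have i2 : zmod_morphism (fun u : W => (0, u) : V * W).
  by move=> x y; rewrite -[RHS]/(0 - 0, x - y) subrr.
congr (_ + _).
  rewrite -[LHS]/(mk_additive i1 (\sum_i r i *: a i)) raddf_sum; apply: eq_bigr => i _.
  rewrite (unsplitK (inl i)) -[LHS]/(r i *: a i, 0) -[RHS]/(r i *: a i, r i *: 0).
  by rewrite scaler0.
rewrite -[LHS]/(mk_additive i2 (\sum_i q i *: b i)) raddf_sum; apply: eq_bigr => i _.
rewrite (unsplitK (inr i)) -[LHS]/(0, q i *: b i) -[RHS]/(q i *: 0, q i *: b i).
by rewrite scaler0.
Qed.

(** * Restriction to finite rank *)

Section FullSubcategories.
Variables (k : fieldType) (A B : dgcat k) (F : dgfun A B).
Variables (P : A -> Prop) (P' : B -> Prop).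
Hypothesis FP : forall x, P x -> P' (F x).

Definition dgf_full : dgfun (dg_full P) (dg_full P') :=
  @DGFun k (dg_full P) (dg_full P')
    (fun x => exist P' (F (sval x)) (FP (svalP x)))
    (fun x y => dgf_hom F (sval x) (sval y))
    (fun x y i f => dgf_part F i f) (fun x y f => dgf_d F f)
    (fun x => dgf_id F (sval x)) (fun x y z g f => dgf_comp F g f).

Lemma dgf_full_quasi_equiv :
  (forall x y, quasi_iso (dgf_hom F x y)) ->
  (forall b, P' b -> exists2 a, P a & H0_iso (F a) b) ->
  quasi_equiv dgf_full.
Proof.
move=> qF ess; split=> [x y|[b Pb]]; first exact: qF.
by have [a Pa ab] := ess b Pb; exists (exist P a Pa).
Qed.

End FullSubcategories.

Section FiniteStabilization.
Variables (k : fieldType) (B Q : comPzRingType) (A : xalg B Q).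
Variables (L : clocal k B) (LQ : clocal k Q).
Variables (rho : {rmorphism k -> B}) (rhoQ : {rmorphism k -> Q}).
Hypothesis rhoQE : forall a, rhoQ a = xc A (rho a).
Variables (w : B) (v : Q).
Hypothesis vE : v = xc A w + xx A * xy A.

Lemma st_fin_gen (X : MFinf rho w) : fin_gen (mf0 X) /\ fin_gen (mf1 X) ->
  fin_gen (mf0 (stabilization rhoQE vE X)) /\ fin_gen (mf1 (stabilization rhoQE vE X)).
Proof. by case=> f0 f1; split; apply/tens_fin_gen/prod_fin_gen. Qed.

(** [P] is already free, so the contractible summand of [transport_H0_iso] is the zero module
    ['rV[Q]_0]. *)
Lemma fin_gen_extended (P : lmodType Q) : projective P -> fin_gen P ->
  exists n (f : {linear (P * 'rV[Q]_0)%type -> tens (xc A) 'rV[B]_n})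
    (g : {linear tens (xc A) 'rV[B]_n -> (P * 'rV[Q]_0)%type}), cancel f g /\ cancel g f.
Proof.
move=> pP fP; have [n [f [g [fK gK]]]] := fin_gen_free LQ pP fP.
have [h [h' [hK h'K]]] := tens_rV (xc A) n.
have FL : linear (fun p : P * 'rV[Q]_0 => h' (f p.1)).
  move=> a p q; rewrite -[(a *: p + q).1]/(a *: p.1 + q.1).
  by rewrite (linearP f) (linearP h').
have GL : linear (fun u => (g (h u), 0) : P * 'rV[Q]_0).
  move=> a p q; rewrite (linearP h) (linearP g).
  by rewrite -[RHS]/(a *: g (h p) + g (h q), a *: 0 + 0) scaler0 addr0.
exists n, (mk_linear FL), (mk_linear GL); split=> [[p z]|u].
  rewrite -[LHS]/(g (h (h' (f p))), 0) h'K fK; congr pair.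
  by apply/matrixP => i [].
by rewrite -[LHS]/(h' (f (g (h u)))) gK hK.
Qed.

Lemma finite_stabilization : weakly_equivalent (MF rho w) (MF rhoQ v).
Proof.
apply: (weakly_equivalent_of_quasi_equiv (F := dgf_full st_fin_gen)).
apply: dgf_full_quasi_equiv => [X Y|Y [f0 f1]]; first exact: st_hom_quasi_iso.
have [r0 [F0 [F0' [F0K F0'K]]]] := fin_gen_extended (@mf_proj0 _ v Y) f0.
have [r1 [F1 [F1' [F1K F1'K]]]] := fin_gen_extended (@mf_proj1 _ v Y) f1.
have pL0 : projective (tens (xc A) 'rV[B]_r0) by exact/tens_projective/rV_projective.
have pL1 : projective (tens (xc A) 'rV[B]_r1) by exact/tens_projective/rV_projective.
have [d01 [d10 [h0 [h1 isoY]]]] := transport_H0_iso rhoQ F0K F0'K F1K F1'K pL0 pL1.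
have [X [X0 X1 isoX]] := finite_H0_iso L rhoQ vE pL0 pL1 h0 h1.
by exists X; [|exact: H0_iso_trans isoX isoY].
Qed.

End FiniteStabilization.

(** * The residue field and the completed equivalence *)

Section ResidueField.
Variables (k : fieldType) (R : comAlgType k) (s : prime_idealr R).
Hypothesis resk : bijective (fun c : k => \pi_({ideal_quot s})%qT (c%:A : R)).

(** [ka a] is the only scalar with [a - (ka a)%:A] in [s]; the laws of a morphism follow from the
    closure of [s] under the ideal operations. *)
Lemma residue_morphism : exists ka : {rmorphism R -> k},
  (forall a, ka a = 0 <-> a \in s) /\ forall c, ka c%:A = c.
Proof.
have [g fK gK] := resk.
have mem a : (\pi_({ideal_quot s})%qT a == 0) = (a \in s).
  by rewrite -[0](rmorph0 \pi_({ideal_quot s})%qT) -Quotient.idealrBE subr0.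
have gE a c : a - c%:A \in s -> g (\pi_({ideal_quot s})%qT a) = c.
  by rewrite Quotient.idealrBE => /eqP ->; exact: fK.
have hg a : a - (g (\pi_({ideal_quot s})%qT a))%:A \in s.
  by rewrite Quotient.idealrBE gK.
pose ka a := g (\pi_({ideal_quot s})%qT a).
have kB : zmod_morphism ka.
  move=> a b; apply: gE; rewrite scalerBl.
  have -> : a - b - ((ka a)%:A - (ka b)%:A) = (a - (ka a)%:A) - (b - (ka b)%:A) by abel.
  by rewrite rpredB ?hg.
have kM : monoid_morphism ka.
  split=> [|a b]; first by apply: gE; rewrite scale1r subrr rpred0.
  apply: gE; have -> : (ka a * ka b)%:A = (ka a)%:A * (ka b)%:A :> R.
    by rewrite -[LHS]/(in_alg R _) rmorphM.
  have -> : a * b - (ka a)%:A * (ka b)%:A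
      = b * (a - (ka a)%:A) + (ka a)%:A * (b - (ka b)%:A).
    by rewrite !mulrBr [b * a]mulrC [b * _]mulrC; abel.
  by rewrite rpredD // idealMr // hg.
pose kr : {rmorphism R -> k} := HB.pack ka (GRing.isZmodMorphism.Build _ _ ka kB)
  (GRing.isMonoidMorphism.Build _ _ ka kM).
exists kr; rewrite -[GRing.RMorphism.sort kr]/ka.
split=> [a|c]; last by apply: gE; rewrite subrr rpred0.
split=> [h|sa]; last by apply: gE; rewrite scale0r subr0.
by rewrite -[a]subr0 -(scale0r 1) -h; exact: hg.
Qed.

Local Notation m := ((fun a => a \in s) : set R).
Local Notation mxy := (ideal_sxy s).
Local Notation P := (polyxy_xalg R).

Lemma completion_equivalence (w : R) :
  weakly_equivalent
    (MF (to_completion m \o in_alg R : {rmorphism k -> completion m})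
        (to_completion m w))
    (MF (to_completion mxy \o in_polyxy R : {rmorphism k -> completion mxy})
        (to_completion mxy (knorrer_potential w))).
Proof.
have [ka [kaP kar]] := residue_morphism.
pose L := completion_clocal (prime_is_ideal s) (r := in_alg R) kaP kar.
(* [(s, x, y)] is the kernel of evaluation at [x = y = 0] followed by [ka]: [xdecomp] writes [p] as
   its value plus multiples of [x] and [y]. *)
have kaQP p : (ka \o xev P : {rmorphism polyxy R -> k}) p = 0 <-> mxy p.
  split=> [/kaP h|/mxy_ev]; last by move/kaP.
  have [_ hD hM] := mxy_ideal s.
  rewrite [p](xdecomp P); apply: (hD); last by rewrite mulrC; apply: hM; exact: mxy_y.
  apply: hD; first exact: mxy_c.
  by rewrite mulrC; apply: hM; exact: mxy_x.
have karQ a : (ka \o xev P : {rmorphism polyxy R -> k}) (in_polyxy R a) = a.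
  by rewrite -[LHS]/(ka (xev P (xc P a%:A))) xev_c kar.
pose LQ := completion_clocal (mxy_ideal s) kaQP karQ.
have rE (a : k) : (to_completion mxy \o in_polyxy R : {rmorphism k -> completion mxy}) a
    = xc (completed_xalg s) ((to_completion m \o in_alg R : {rmorphism k -> completion m}) a).
  by rewrite -[RHS]/(xc (completed_xalg s) (to_completion m a%:A)) completed_xcE.
exact: (finite_stabilization L LQ rE (completed_potentialE s w)).
Qed.

End ResidueField.

Theorem mainTheorem15 (k : fieldType) (n : nat) (R : comAlgType k) (w : R)
    (s : prime_idealr R) (hB : conditionB n w s) :
  let m : set R := fun a => a \in s in
  let mxy : set (polyxy R) := ideal_sxy s in
  weakly_equivalent
    (MFinf (in_alg R : {rmorphism k -> R}) w)
    (MFinf (in_polyxy R) (knorrer_potential w)) /\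
  weakly_equivalent
    (MF (to_completion m \o in_alg R : {rmorphism k -> completion m})
        (to_completion m w))
    (MF (to_completion mxy \o in_polyxy R : {rmorphism k -> completion mxy})
        (to_completion mxy (knorrer_potential w))).
Proof.
move: hB => [_ [_ resk _]] m mxy; split.
  exact: weakly_equivalent_of_quasi_equiv (polyxy_stab_quasi_equiv w).
exact: completion_equivalence resk w.
Qed.
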